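(* Let $(X,\omega)$ be a compact Hermitian manifold of dimension $n$, let $\Sigma$ be a smooth analytic hypersurface of $X$, and let $\varrho$, the cover $\mathcal{W}=\{W_j\}_{1\leq j\leq N}$ of $\Sigma$ and the neighborhood $W$ of $\Sigma$ be as described in the context. There exists a constant $A\geq1$ depending only on $\varrho$ and $\mathcal{W}$ (for the given $(X,\omega)$ and $\Sigma$) such that the following holds. Let $t>0$ be a real number, let $(L,h)$ be a singular Hermitian holomorphic line bundle on $X$ whose metric $h$ has locally bounded weights, and let $$U_t:=\Big\{x\in W:\ \big(Ae^{\varrho(x)}\big)^{t}\,e^{4\|h\|_\infty}<1\Big\}.$$ Then for any $x\in U_t$ and $p>2t^{-1}$ we have $$P_{0,p}(x)\leq\Big[\big(Ae^{\varrho(x)}\big)^{t}\,e^{4\|h\|_\infty}\Big]^p.$$ In particular $P_{0,p}=O(p^{-\infty})$ as $p\to\infty$ on $U_t$.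
   Context: $S_\Sigma\in H^0(X,\mathcal{O}(\Sigma))$ is a canonical holomorphic section of $\mathcal{O}(\Sigma)$, vanishing to first order on $\Sigma$, and $h_\Sigma$ is a fixed smooth Hermitian metric on $\mathcal{O}(\Sigma)$ such that $\varrho:=\log|S_\Sigma|_{h_\Sigma}<0$ on $X$. Cover: for a coordinate chart with coordinates $z=(z_1,\dots,z_n)$, $\Delta^n(y,r)=\{z:|z_j-y_j|\leq r,\ j=1,\dots,n\}$ is the closed polydisk. $\mathcal{W}=\{W_j\}_{1\leq j\leq N}$ is a fixed open cover of $\Sigma$ by Stein contractible coordinate neighborhoods $W_j$ centered at points $y_j\in\Sigma$, such that $\Delta^n(y_j,2)\subset W_j$, $\Sigma\cap W_j=\{z\in W_j:z_1=0\}$ for all $j$, where $z=(z_1,\dots,z_n)$ are the coordinates on $W_j$, and $W:=\bigcup_{j=1}^N\Delta^n(y_j,1)$ is a neighborhood of $\Sigma$. Weights: on each $W_j$ fix a holomorphic frame $e_j$ of $L|_{W_j}$ and let $\varphi_j$ be the corresponding weight of $h$, $|e_j|_h=e^{-\varphi_j}$ (locally bounded weights means each such weight is locally bounded). Set $\|\varphi_j\|_{\infty,W_j}=\sup\{|\varphi_j(w)|:w\in\Delta^n(y_j,2)\}$ and $\|h\|_\infty:=\max\{1,\|\varphi_j\|_{\infty,W_j}:1\leq j\leq N\}$. Sections: $L^p=L^{\otimes p}$, $h_p=h^{\otimes p}$, $\|S\|_p^2=\int_X|S|^2_{h_p}\frac{\omega^n}{n!}$. $H^0_0(X,L^p):=H^0(X,L^p\otimes\mathcal{O}(-\lfloor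 tp\rfloor\Sigma))$ is regarded as the space of holomorphic sections of $L^p$ vanishing to order at least $\lfloor tp\rfloor$ along $\Sigma$, with $\lfloor\cdot\rfloor$ the integral part. $P_{0,p}(x)=\sum_j|S_j(x)|^2_{h_p}$ for any orthonormal basis $\{S_j\}$ of $H^0_0(X,L^p)$ with respect to the inner product inducing $\|\cdot\|_p$. $f_p=O(p^{-\infty})$ on a set means: for every compact subset $K$ of it and every $\ell\in\mathbb{N}$ there is $C_{K,\ell}>0$ with $\sup_K|f_p|\leq C_{K,\ell}\,p^{-\ell}$ for all $p\in\mathbb{N}$. *)

(* Defs.v *)
From HB Require Import structures.
From mathcomp Require Import all_boot all_order all_algebra complex.
From mathcomp Require Import all_classical all_reals all_analysis.

Set Implicit Arguments.
Unset Strict Implicit.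
Unset Printing Implicit Defensive.
Import Order.TTheory GRing.Theory Num.Theory.
Import numFieldNormedType.Exports.

Local Open Scope classical_set_scope.
Local Open Scope ring_scope.

Notation cabs := ComplexField.Normc.normc.

Lemma cabs_ge0 (R : rcfType) (z : R[i]) : 0 <= cabs z.
Proof. by case: z => a b; rewrite /= sqrtr_ge0. Qed.

Lemma cabsX (R : rcfType) (z : R[i]) (k : nat) : cabs (z ^+ k) = cabs z ^+ k.
Proof.
elim: k => [|k IHk]; first by rewrite !expr0 ComplexField.Normc.normc1.
by rewrite !exprS ComplexField.Normc.normcM IHk.
Qed.

(* The topology of the normed field R[i], declared on the type R[i] itself. *)
HB.instance Definition _ (R : rcfType) := NormedModule.copy R[i] R[i]^o.

Section lebesgue_cons.
Context (R : realType) (k : nat).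
Local Notation T := (measurableTypeR R).
Variable m : {sigma_finite_measure set (k.-tuple T) -> \bar R}.

Definition cons_pair (x : T * k.-tuple T) : k.+1.-tuple T :=
  [the k.+1.-tuple T of x.1 :: x.2].

Let mcons : measurable_fun setT cons_pair.
Proof. exact: measurable_cons. Qed.

Definition lebesgue_cons : set (k.+1.-tuple T) -> \bar R :=
  pushforward (@lebesgue_measure R \x m)%E cons_pair.

HB.instance Definition _ := Measure.copy lebesgue_cons
  (measure_function_pushforward__canonical__measure_function_Measure
    (@lebesgue_measure R \x m)%E mcons).

Let lebesgue_cons_sigma_finite : sigma_finite setT lebesgue_cons.
Proof.
have /sigma_finiteP[F [FT ndF Foo]] := sigma_finiteT (@lebesgue_measure R).
have /sigma_finiteP[G [GT ndG Goo]] := sigma_finiteT m.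
exists (fun i => [set t | F i (thead t) /\ G i [tuple of behead t]]) => [|i].
  apply/seteqP; split=> // t _.
  have [i _ Fi] : (\bigcup_i F i) (thead t) by rewrite -FT.
  have [j _ Gj] : (\bigcup_j G j) [tuple of behead t] by rewrite -GT.
  exists (maxn i j) => //; split.
    by move: Fi; exact/subsetPset/ndF/leq_maxl.
  by move: Gj; exact/subsetPset/ndG/leq_maxr.
have [mF Fo] := Foo i; have [mG Go] := Goo i; split.
  apply: measurableI.
    by rewrite -[X in measurable X]setTI; exact: (@measurable_tnth _ _ k.+1 ord0).
  by rewrite -[X in measurable X]setTI; exact: measurable_behead.
rewrite /lebesgue_cons /pushforward.
rewrite (_ : _ @^-1` _ = F i `*` G i); last first.
  apply/funext => -[x t] /=; rewrite theadE.
  suff -> : [tuple of behead (cons_pair (x, t))] = t :> k.-tuple T by [].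
  exact: val_inj.
by rewrite product_measure1E// lte_mul_pinfty// ge0_fin_numE.
Qed.

HB.instance Definition _ := Measure_isSigmaFinite.Build _ _ _ lebesgue_cons
  lebesgue_cons_sigma_finite.

End lebesgue_cons.

Fixpoint lebesgue_tuple (R : realType) (k : nat) :
    {sigma_finite_measure set (k.-tuple (measurableTypeR R)) -> \bar R} :=
  if k is k'.+1 then lebesgue_cons (lebesgue_tuple R k')
  else dirac [tuple].

(* The point x + iy of C^n, for t = (x_1, ..., x_n, y_1, ..., y_n). *)
Definition complex_point (R : realType) (n : nat)
    (t : (n + n).-tuple (measurableTypeR R)) : 'rV[R[i]]_n :=
  \row_k Complex (tnth t (lshift n k)) (tnth t (rshift n k)).

Section functions_on_Cn.
Context (R : realType) (n : nat).
Local Notation C := R[i].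
Local Notation V := 'rV[C]_n.

(* [differentiable] is here Frechet differentiability over the field C. *)
Definition holomorphic (D : set V) (f : V -> C) :=
  forall z, D z -> differentiable (f : V -> C^o) z.

(* C^k in the real sense: continuous, with directional derivatives of order
   at most k along real lines that exist and are continuous. *)
Fixpoint Ck (k : nat) (D : set V) (f : V -> R) : Prop :=
  (forall z, D z -> {for z, continuous f}) /\
  if k is k'.+1 then
    forall v : V,
      (forall z, D z ->
         derivable (fun s : R => f (z + (s%:C)%C *: v) : R^o) 0 1) /\
      Ck k' D (fun z => derive1 (fun s : R => f (z + (s%:C)%C *: v) : R^o) 0)
  else True.

Definition smooth (D : set V) (f : V -> R) := forall k, Ck k D f.

End functions_on_Cn.

Section manifold.
Context (R : realType) (n : nat) (X : ptopologicalType).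
Local Notation C := R[i].
Local Notation V := 'rV[C]_n.

(* [cmap] and [cinv] are only meaningful on [cdom] and on its image. *)
Record chart := Chart {
  cdom : set X ;
  cmap :> X -> V ;
  cinv : V -> X ;
  cdom_open : open cdom ;
  cimg_open : open (cmap @` cdom) ;
  cmapK : forall x, cdom x -> cinv (cmap x) = x ;
  cmap_continuous : forall x, cdom x -> {for x, continuous cmap} ;
  cinv_continuous : forall x, cdom x -> {for cmap x, continuous cinv} }.

Definition transition_holomorphic (c c' : chart) :=
  forall x, cdom c x -> cdom c' x ->
    differentiable (c' \o cinv c : V -> V) (c x).

(* The atlas is maximal: its members are all the holomorphic charts. *)
Record complex_manifold := ComplexManifold {
  atlas : set chart ;
  atlas_cover : forall x, exists2 c, atlas c & cdom c x ;
  atlas_compatible : forall c c', atlas c -> atlas c' ->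
    transition_holomorphic c c' ;
  atlas_maximal : forall c,
    (forall c', atlas c' ->
       transition_holomorphic c c' /\ transition_holomorphic c' c) ->
    atlas c }.

Variable M : complex_manifold.

Definition holomorphic_on (U : set X) (f : X -> C) :=
  forall c, atlas M c -> holomorphic (c @` (U `&` cdom c)) (f \o cinv c).

Definition smooth_on (U : set X) (f : X -> R) :=
  forall c, atlas M c -> smooth (c @` (U `&` cdom c)) (f \o cinv c).

Definition polydisk (c : chart) (y : X) (r : R) : set X :=
  [set x | cdom c x /\ forall k, cabs (c x ord0 k - c y ord0 k) <= r].

(* The closed polydisk of radius r around y in C^n lies in the image of the
   chart; [polydisk c y r] by itself could be truncated by the domain. *)
Definition polydisk_in_chart (c : chart) (y : X) (r : R) :=
  [set z : V | forall k, cabs (z ord0 k - c y ord0 k) <= r]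
    `<=` c @` cdom c.

Definition holomorphically_convex (U : set X) :=
  forall K : set X, compact K -> K `<=` U ->
    compact [set x | U x /\
      forall f, holomorphic_on U f ->
      forall m : R, (forall y, K y -> cabs (f y) <= m) -> cabs (f x) <= m].

Definition holomorphically_separable (U : set X) :=
  forall x y, U x -> U y -> x <> y ->
    exists2 f, holomorphic_on U f & f x <> f y.

Definition stein (U : set X) :=
  holomorphically_convex U /\ holomorphically_separable U.

Definition contractible (U : set X) :=
  exists (x0 : X) (H : R * X -> X),
    [/\ U x0,
        {within `[0%R, 1%R]%classic `*` U, continuous H},
        forall x, U x -> H (0, x) = x /\ H (1, x) = x0 &
        forall s x, 0 <= s <= 1 -> U x -> U (H (s, x))].

(* The (1,1)-form is (i/2) sum_jk h_jk dz_j /\ d(conj z_k), where [hmat c] is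
   the matrix (h_jk) in the chart c. The rows of [jacobian (c' \o cinv c)] are
   indexed by the coordinates of c, the columns by those of c'. *)
Record hermitian_form := HermitianForm {
  hmat : chart -> X -> 'M[C]_n ;
  hmat_hermitian : forall c x, atlas M c -> cdom c x ->
    map_mx Num.conj (hmat c x)^T = hmat c x ;
  hmat_posdef : forall c x, atlas M c -> cdom c x ->
    forall v : V, v != 0 ->
      0 < (v *m hmat c x *m map_mx Num.conj v^T) ord0 ord0 ;
  hmat_smooth : forall c, atlas M c -> forall j k,
    smooth_on (cdom c) (fun x => complex.Re (hmat c x j k)) /\
    smooth_on (cdom c) (fun x => complex.Im (hmat c x j k)) ;
  hmat_transition : forall c c' x, atlas M c -> atlas M c' ->
    cdom c x -> cdom c' x ->
    let J := jacobian (c' \o cinv c : V -> V) (c x) in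
    hmat c x = J *m hmat c' x *m map_mx Num.conj J^T }.

Local Notation borelX := (g_sigma_algebraType (@open X)).

(* vol is the Borel measure A |-> \int_A omega^n/n!. In a chart
   omega^n/n! = det(h_jk) dx_1 dy_1 ... dx_n dy_n, and these values determine
   the measure. *)
Definition is_volume_measure (omega : hermitian_form)
    (vol : {measure set borelX -> \bar R}) :=
  forall c, atlas M c -> forall A : set borelX, measurable A ->
    A `<=` cdom c ->
    vol A = (\int[lebesgue_tuple R (n + n)]_(t in
               (@complex_point R n) @^-1` (c @` A))
               (complex.Re (\det (hmat omega c (cinv c (complex_point t)))))%:E)%E.

(* A line bundle is given by a trivializing cover, with local frames eps_i and
   eps_j = g_ij eps_i; [tloc x] is the index of some member of the cover
   containing x. *)
Record line_bundle := LineBundle {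
  tidx : Type ;
  triv : tidx -> set X ;
  tloc : X -> tidx ;
  cocycle : tidx -> tidx -> X -> C ;
  triv_open : forall i, open (triv i) ;
  tlocP : forall x, triv (tloc x) x ;
  cocycle_holomorphic : forall i j,
    holomorphic_on (triv i `&` triv j) (cocycle i j) ;
  cocycle_neq0 : forall i j x, triv i x -> triv j x -> cocycle i j x != 0 ;
  cocycleP : forall i j k x, triv i x -> triv j x -> triv k x ->
    cocycle i j x * cocycle j k x = cocycle i k x }.

(* The coefficients s_i of a section s = s_i eps_i; the values of s_i outside
   [triv i] are irrelevant. *)
Definition local_coefs (L : line_bundle) := tidx L -> X -> C.

Definition holomorphic_section (L : line_bundle) (U : set X)
    (s : local_coefs L) :=
  (forall i, holomorphic_on (U `&` triv i) (s i)) /\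
  (forall i j x, U x -> triv i x -> triv j x -> s i x = cocycle i j x * s j x).

Definition nowhere_zero (L : line_bundle) (U : set X) (s : local_coefs L) :=
  forall i x, U x -> triv i x -> s i x != 0.

Definition holomorphic_frame (L : line_bundle) (U : set X)
    (s : local_coefs L) :=
  holomorphic_section U s /\ nowhere_zero U s.

Section tensor_power.
Variables (L : line_bundle) (p : nat).

Let g i j x := @cocycle L i j x ^+ p.

Let g_holomorphic i j : holomorphic_on (triv i `&` triv j) (g i j).
Proof.
move=> c cM z Dz; have := cocycle_holomorphic cM Dz.
rewrite /g; set f := cocycle i j => df; case: p => [|q].
  by rewrite (_ : _ \o _ = cst 1)//; exact: differentiable_cst.
rewrite (_ : (fun _ => _) \o _ = (f \o cinv c : _ -> C^o) ^+ q.+1).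
  exact: differentiableX.
by apply/funext => w /=; rewrite fctE.
Qed.

Let g_neq0 i j x : triv i x -> triv j x -> g i j x != 0.
Proof. by move=> xi xj; rewrite expf_neq0// cocycle_neq0. Qed.

Let gP i j k x : triv i x -> triv j x -> triv k x -> g i j x * g j k x = g i k x.
Proof. by move=> xi xj xk; rewrite /g -exprMn cocycleP. Qed.

Definition tensor_power : line_bundle :=
  LineBundle (@triv_open L) (@tlocP L) g_holomorphic g_neq0 gP.

End tensor_power.

(* |eps_i| = exp (- phi_i), with phi_i = [weight i]. *)
Record bundle_metric (L : line_bundle) := BundleMetric {
  weight : tidx L -> X -> R ;
  weight_transition : forall i j x, triv i x -> triv j x ->
    weight j x = weight i x - ln (cabs (cocycle i j x)) }.

Section tensor_power_metric.
Variables (L : line_bundle) (h : bundle_metric L) (p : nat).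

Let wt i x := p%:R * weight h i x.

Let wtP (i j : tidx (tensor_power L p)) x : triv i x -> triv j x ->
  wt j x = wt i x - ln (cabs (cocycle i j x)).
Proof.
move=> xi xj; rewrite /wt (weight_transition h xi xj) mulrBr; congr (_ - _).
have gx0 : 0 < cabs (@cocycle L i j x).
  rewrite lt_neqAle cabs_ge0 andbT eq_sym.
  apply: contra (@cocycle_neq0 L i j x xi xj) => /eqP/ComplexField.Normc.eq0_normc ->.
  exact: eqxx.
by rewrite /= cabsX lnXn// mulr_natl.
Qed.

Definition metric_power : bundle_metric (tensor_power L p) := BundleMetric wtP.

End tensor_power_metric.

Section norms.
Variables (L : line_bundle) (h : bundle_metric L).

Definition section_norm (s : local_coefs L) (x : X) : R :=
  cabs (s (tloc L x) x) * expR (- weight h (tloc L x) x).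

Definition section_dot (s s' : local_coefs L) (x : X) : C :=
  s (tloc L x) x * Num.conj (s' (tloc L x) x)
  * ((expR (- 2 * weight h (tloc L x) x))%:C)%C.

Definition smooth_metric := forall i, smooth_on (triv i) (weight h i).

Definition locally_bounded_weights :=
  forall i x, triv i x -> exists m : R, \forall y \near x, `|weight h i y| <= m.

(* Measurability is with respect to the completion of vol. With local
   boundedness, it gives weights in L^1_loc. *)
Definition measurable_weights (vol : {measure set borelX -> \bar R}) :=
  forall i, exists2 psi : borelX -> R, measurable_fun setT psi &
    vol.-negligible [set x | triv i x /\ weight h i x <> psi x].

Definition inner_product (vol : {measure set borelX -> \bar R})
    (s s' : local_coefs L) : C :=
  Complex (\int[vol]_x complex.Re (section_dot s s' x))
          (\int[vol]_x complex.Im (section_dot s s' x)).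

End norms.

End manifold.

Section hypersurface.
Context (R : realType) (n : nat) (X : ptopologicalType).
Context (M : complex_manifold R n.+1 X).
Local Notation C := R[i].
Local Notation V := 'rV[C]_n.+1.
Local Notation borelX := (g_sigma_algebraType (@open X)).
Local Notation chart := (chart R n.+1 X).

Definition adapted_chart (Sigma : set X) (c : chart) :=
  atlas M c /\ Sigma `&` cdom c = [set x | cdom c x /\ c x ord0 ord0 = 0].

Definition smooth_hypersurface (Sigma : set X) :=
  closed Sigma /\
  forall x, Sigma x -> exists2 c, adapted_chart Sigma c & cdom c x.

(* The section s of E has divisor Sigma, with multiplicity one: up to
   isomorphism, E is O(Sigma) and s its canonical section. *)
Definition canonical_section (Sigma : set X) (E : line_bundle M)
    (s : local_coefs E) :=
  [/\ holomorphic_section setT s,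
      forall i x, triv i x -> (s i x = 0 <-> Sigma x) &
      forall i c x, atlas M c -> triv i x -> cdom c x -> Sigma x ->
        exists v : V, 'd (s i \o cinv c : V -> C) (c x) v != 0].

(* rho = log |S_Sigma|_{h_Sigma}, which is -oo on Sigma. *)
Definition is_log_norm (Sigma : set X) (rho : X -> \bar R) :=
  exists (E : line_bundle M) (h : bundle_metric E) (s : local_coefs E),
    [/\ canonical_section Sigma s, smooth_metric h &
        forall x, rho x = lne (section_norm h s x)%:E].

Record good_cover (Sigma : set X) (N : nat) (W : 'I_N -> chart)
    (y : 'I_N -> X) : Prop := GoodCover {
  cover_stein : forall j, stein M (cdom (W j)) ;
  cover_contractible : forall j, contractible R (cdom (W j)) ;
  cover_adapted : forall j, adapted_chart Sigma (W j) ;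
  cover_center : forall j,
    [/\ Sigma (y j), cdom (W j) (y j) & W j (y j) = 0] ;
  cover_polydisk : forall j, polydisk_in_chart (W j) (y j) 2 ;
  cover_Sigma : Sigma `<=` \bigcup_j cdom (W j) ;
  cover_nbhs : Sigma `<=` (\bigcup_j polydisk (W j) (y j) 1)^° }.

(* s_i is locally divisible by the m-th power of the first coordinate of an
   adapted chart. *)
Definition vanishes_to_order (Sigma : set X) (m : nat) (L : line_bundle M)
    (s : local_coefs L) :=
  forall i c x, adapted_chart Sigma c -> Sigma x -> cdom c x -> triv i x ->
    exists (U : set X) (u : X -> C),
      [/\ open U, U x, U `<=` cdom c `&` triv i, holomorphic_on M U u &
          forall z, U z -> s i z = c z ord0 ord0 ^+ m * u z].

Variables (vol : {measure set borelX -> \bar R}) (Sigma : set X) (t : R).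
Variables (L : line_bundle M) (h : bundle_metric L).

Definition H0_0 (p : nat) (s : local_coefs (tensor_power L p)) :=
  holomorphic_section setT s /\
  vanishes_to_order Sigma (Num.truncn (t * p%:R)) s.

Definition orthonormal_basis (p d : nat)
    (S : 'I_d -> local_coefs (tensor_power L p)) :=
  [/\ forall j, H0_0 (S j),
      forall j k, inner_product (metric_power h p) vol (S j) (S k) = (j == k)%:R &
      forall s, H0_0 s -> exists a : 'I_d -> C,
        forall i x, triv i x -> s i x = \sum_j a j * S j i x].

Definition bergman_kernel (p d : nat)
    (S : 'I_d -> local_coefs (tensor_power L p)) (x : X) : R :=
  \sum_j section_norm (metric_power h p) (S j) x ^+ 2.

Definition frame_weight (e : local_coefs L) (x : X) : R :=
  - ln (section_norm h e x).

Definition sup_norm (N : nat) (W : 'I_N -> chart) (y : 'I_N -> X)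
    (e : 'I_N -> local_coefs L) : R :=
  \big[Num.max/1]_(j < N)
    sup [set `|frame_weight (e j) w| | w in polydisk (W j) (y j) 2].

End hypersurface.

(* f_p = O(p^-oo) on U, for p = 1, 2, ... *)
Definition O_pinfty (R : realType) (X : topologicalType) (U : set X)
    (f : nat -> X -> R) :=
  forall K : set X, compact K -> K `<=` U -> forall l : nat,
    exists2 B : R, 0 < B &
      forall p : nat, (0 < p)%N -> forall x, K x -> `|f p x| <= B * p%:R ^- l.

(* Main.v *)
(* In an adapted chart a section vanishing to order [m] along Sigma is
   [F = z_1^m u], so the Schwarz lemma in the first variable bounds [|F x|] on
   the unit polydisk by [|x_1|^m] times the maximum of [|F|] on a larger
   polydisk, and this maximum is controlled by the L^2 norm of [F] over the
   polydisk of radius 2. Comparing Lebesgue measure with the volume form and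
   [F] with the section costs a constant [B] and twice a factor
   [e^(2 p ||h||)]. The extremal property of the Bergman kernel gives
   [P_(0,p) <= B |x_1|^(2m) e^(4 p ||h||)], and [|x_1| <= A' e^rho] because the
   canonical section vanishes to first order. Since [m = floor (t p)], one has
   [2m >= t p] for [t p > 2], and then [A = B A'] works.
   Holomorphic functions are only assumed complex differentiable at every
   point, so the Schwarz lemma is derived from Goursat's theorem on
   rectangles. *)
Require Import Defs.
From mathcomp Require Import all_boot all_order all_algebra complex.
From mathcomp Require Import all_classical all_reals all_analysis.
From mathcomp Require Import measurable_realfun perm.
From mathcomp Require Import ring lra.
Import Order.TTheory GRing.Theory Num.Theory.
Import numFieldNormedType.Exports.
Set Implicit Arguments.
Unset Strict Implicit.
Unset Printing Implicit Defensive.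
Local Open Scope classical_set_scope.
Local Open Scope ring_scope.

(** * Goursat's theorem and the Schwarz lemma *)

(** Goursat's theorem yields only a bound |f p| <= B K, with K the maximum of |f| on the boundary
    and B a crude constant that depends on the rectangle and the point but not on f. Applied to
    powers, the bound loses its constant since B^(1/k) tends to 1, and the sharp Schwarz lemma
    remains. The L^2 norm is bounded below on a single small cube. At a point where |F| d^(n+1) is
    nearly maximal, F is almost constant on a cube of side proportional to d. In complex dimension
    n+1 the volume of this cube is proportional to d^(2(n+1)), which is the square of the weight, so
    d cancels and the final constant does not depend on where that point lies. Orthonormality
    prescribes only the values of some integrals, and the weights are Borel only up to a null set.
    The L^2 norm of a linear combination of the basis is therefore computed exactly after the
    removal of one null set common to all sections. *)

Section cabs.
Context {R : rcfType}.
Implicit Types z w : R[i].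

Lemma cabsM z w : cabs (z * w) = cabs z * cabs w.
Proof. exact: ComplexField.Normc.normcM. Qed.

Lemma cabsV z : cabs z^-1 = (cabs z)^-1.
Proof. exact: ComplexField.Normc.normcV. Qed.

Lemma cabsN z : cabs (- z) = cabs z.
Proof. exact: normcN. Qed.

Lemma cabs0 : cabs (0 : R[i]) = 0.
Proof. exact: ComplexField.Normc.normc0. Qed.

Lemma cabs1 : cabs (1 : R[i]) = 1.
Proof. exact: ComplexField.Normc.normc1. Qed.

Lemma cabsD z w : cabs (z + w) <= cabs z + cabs w.
Proof. exact: le_normcD. Qed.

Lemma cabsB z w : cabs (z - w) = cabs (w - z).
Proof. by rewrite -cabsN opprB. Qed.

Lemma cabsD3 z w u : cabs (z - u) <= cabs (z - w) + cabs (w - u).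
Proof. by rewrite (le_trans _ (cabsD _ _))// addrA subrK. Qed.

Lemma cabs_eq0 z : (cabs z == 0) = (z == 0).
Proof.
apply/eqP/eqP => [/ComplexField.Normc.eq0_normc//|->]; exact: cabs0.
Qed.

Lemma cabs_gt0 z : (0 < cabs z) = (z != 0).
Proof. by rewrite lt_neqAle cabs_ge0 andbT eq_sym cabs_eq0. Qed.

Lemma cabs_re z : `|complex.Re z| <= cabs z.
Proof. by case: z => a b /=; rewrite -sqrtr_sqr ler_wsqrtr// lerDl sqr_ge0. Qed.

Lemma cabs_im z : `|complex.Im z| <= cabs z.
Proof. by case: z => a b /=; rewrite -sqrtr_sqr ler_wsqrtr// lerDr sqr_ge0. Qed.

Lemma cabs_le z : cabs z <= `|complex.Re z| + `|complex.Im z|.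
Proof.
case: z => a b /=; rewrite -(ger0_norm (addr_ge0 (normr_ge0 a) (normr_ge0 b))).
rewrite -sqrtr_sqr ler_wsqrtr// sqrrD !real_normK ?num_real//.
by rewrite lerD2r lerDl mulrn_wge0// mulr_ge0.
Qed.

Lemma cabsE z : `|z| = (cabs z)%:C%C.
Proof. by []. Qed.

Lemma sqr_cabs z : cabs z ^+ 2 = complex.Re z ^+ 2 + complex.Im z ^+ 2.
Proof. by case: z => a b /=; rewrite sqr_sqrtr// addr_ge0// sqr_ge0. Qed.

Lemma cabs_real (r : R) : cabs (r%:C)%C = `|r|.
Proof. by rewrite /= expr0n/= addr0 sqrtr_sqr. Qed.

Lemma cabs_conj z : cabs (conjc z) = cabs z.
Proof. by case: z => a b /=; rewrite sqrrN. Qed.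

Lemma lec0E (e : R[i]) : 0 < e -> e = (complex.Re e)%:C%C /\ 0 < complex.Re e.
Proof. by rewrite ltcE; case: e => a b /= /andP[/eqP-> ->]. Qed.

End cabs.

Section continuity.
Context {R : realType}.
Local Notation C := R[i].

(** The norm of [R[i]] takes its values in [R[i]], so its balls have complex radii. This restatement
    and the next one work with real radii. *)
Lemma nbhs_cabsP (w : C) (P : C -> Prop) :
  (\forall z \near w, P z) <->
  exists2 d : R, 0 < d & forall z, cabs (z - w) < d -> P z.
Proof.
split.
  move=> /nbhs_normP[e /= e0 eP]; have [eE re0] := lec0E e0.
  exists (complex.Re e) => // z zw; apply: eP => /=.
  by rewrite eE /ball_/= distrC cabsE ltcR.
move=> [d d0 dP]; apply/nbhs_normP; exists (d%:C)%C => /=; first by rewrite ltcR.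
by move=> z; rewrite /ball_/= distrC cabsE ltcR; exact: dP.
Qed.

Lemma cvg_cabsP (T : Type) (F : set_system T) (FF : Filter F) (f : T -> C) (l : C) :
  f @ F --> l <-> forall e : R, 0 < e -> \forall t \near F, cabs (f t - l) < e.
Proof.
split=> [/cvgrPdistC_lt fl e e0|fl].
  by near do rewrite -ltcR -cabsE; apply: fl; rewrite ltcR.
apply/cvgrPdistC_lt => e /lec0E[-> re0]; near do rewrite cabsE ltcR; exact: fl.
Unshelve. all: by end_near. Qed.

(** The differential is linear over the complex field, hence multiplication by its value [l] at
    [1]. *)
Lemma differentiable_cabsP (f : C^o -> C^o) (w : C) : differentiable f w ->
  exists l : C, forall e : R, 0 < e -> exists2 d : R, 0 < d & forall z,
    cabs (z - w) < d -> cabs (f z - f w - l * (z - w)) <= e * cabs (z - w).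
Proof.
move=> fw; have /diff_locally/eqaddoP ofw := fw; exists ('d f w (1 : C^o)) => e e0.
have e0' : 0 < (e%:C)%C by rewrite ltcR.
have /nbhs_cabsP[d d0 dP] := ofw _ e0'.
exists d => // z zd; have := dP (z - w); rewrite subr0 => /(_ zd) /=.
rewrite !cabsE -rmorphM lecR /= !fctE/= subrK.
have -> : 'd f w (z - w) = ('d f w (1 : C^o) : C) * (z - w).
  have -> : z - w = ((z - w : C) *: (1 : C^o)) by rewrite /GRing.scale/= mulr1.
  by rewrite linearZ /= mulrC /GRing.scale/= mulr1.
by rewrite opprD addrA.
Qed.

End continuity.

(** * Integrals of continuous functions over segments *)

Section segment_integral.
Context {R : realType}.
Implicit Types (f g : R -> R) (a b m K : R).

Definition segint f a b : R := \int[@lebesgue_measure R]_(x in `[a, b]) f x.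

Definition segcont f a b := forall x, a <= x <= b -> {for x, continuous f}.

Lemma segcont_sub f a b a' b' : a <= a' -> b' <= b ->
  segcont f a b -> segcont f a' b'.
Proof.
move=> aa bb fc x /andP[ax xb]; apply: fc.
by rewrite (le_trans aa ax) (le_trans xb bb).
Qed.

Lemma segcont_integrable f a b : segcont f a b ->
  (@lebesgue_measure R).-integrable `[a, b] (EFin \o f).
Proof.
move=> fc; apply: continuous_compact_integrable; first exact: segment_compact.
apply: continuous_in_subspaceT => x; rewrite inE /= in_itv /=; exact: fc.
Qed.

Lemma segint_split f a m b : a <= m -> m <= b -> segcont f a b ->
  segint f a b = segint f a m + segint f m b.
Proof.
move=> am mb fc; rewrite /segint -[X in _ + X]Rintegral_itv_obnd_cbnd; last first.
  apply: integrableS (segcont_integrable (segcont_sub am (lexx b) fc)) => //.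
  by apply: subset_itvr; rewrite bnd_simp.
rewrite -(@Rintegral_itvB _ f (BLeft a) (BRight b) m) ?bnd_simp//.
- by rewrite subrKC.
- exact: segcont_integrable.
Qed.

Lemma segintB f g a b : segcont f a b -> segcont g a b ->
  segint (fun x => f x - g x) a b = segint f a b - segint g a b.
Proof.
by move=> fc gc; rewrite /segint RintegralB//; exact: segcont_integrable.
Qed.

Lemma eq_segint f g a b : (forall x, a <= x <= b -> f x = g x) ->
  segint f a b = segint g a b.
Proof.
by move=> fg; apply: eq_Rintegral => x; rewrite inE /= in_itv/=; exact: fg.
Qed.

Lemma segint_cst c a b : a <= b -> segint (fun=> c) a b = c * (b - a).
Proof.
move=> ab; rewrite /segint Rintegral_cst//= lebesgue_measure_itv/= lte_fin.
by move: ab; rewrite le_eqVlt => /predU1P[->|->]; rewrite ?ltxx ?subrr.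
Qed.

Lemma le_segint f g a b : segcont f a b -> segcont g a b ->
  (forall x, a <= x <= b -> f x <= g x) -> segint f a b <= segint g a b.
Proof.
move=> fc gc fg; have fi := segcont_integrable fc; have gi := segcont_integrable gc.
by apply: le_Rintegral => // x; rewrite /= in_itv/=; exact: fg.
Qed.

Lemma segcont_cst c a b : segcont (fun=> c) a b.
Proof. by move=> x _; exact: cvg_cst. Qed.

Lemma segint_bound f a b K : a <= b -> segcont f a b ->
  (forall x, a <= x <= b -> `|f x| <= K) -> `|segint f a b| <= K * (b - a).
Proof.
move=> ab fc fK; have ci c : segcont (fun=> c) a b by exact: segcont_cst.
have [l u] : - K * (b - a) <= segint f a b /\ segint f a b <= K * (b - a).
  rewrite -!segint_cst//; split.
    by apply: (le_segint (ci _) fc) => x /fK; rewrite ler_norml => /andP[].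
  by apply: (le_segint fc (ci _)) => x /fK; rewrite ler_norml => /andP[].
by rewrite ler_norml u -mulNr l.
Qed.

End segment_integral.

(** * Integrals along the boundary of a rectangle *)

Section contour_integral.
Context {R : realType}.
Local Notation C := R[i].
Implicit Types (f g : C -> C) (a b c d K : R).

(* The real part of the integral of [f dz] along the boundary of the rectangle
   [a, b] x [c, d], counterclockwise. *)
Definition rectint f a b c d : R :=
  segint (fun x => complex.Re (f (Complex x c))) a b
  - segint (fun x => complex.Re (f (Complex x d))) a b
  - segint (fun y => complex.Im (f (Complex b y))) c d
  + segint (fun y => complex.Im (f (Complex a y))) c d.

Definition rect a b c d (z : C) :=
  a <= complex.Re z <= b /\ c <= complex.Im z <= d.

Definition hcont f a b c :=
  forall x, a <= x <= b -> {for Complex x c, continuous f}.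
Definition vcont f a c d :=
  forall y, c <= y <= d -> {for Complex a y, continuous f}.

Lemma hcont_Re f a b c : hcont f a b c ->
  segcont (fun x => complex.Re (f (Complex x c))) a b.
Proof.
move=> fc x xab; apply/cvgrPdistC_lt => e e0.
have /cvg_cabsP/(_ e e0)/nbhs_cabsP[d d0 dP] := fc _ xab.
near=> y; rewrite -raddfB; apply: le_lt_trans (cabs_re _) (dP _ _).
rewrite (_ : _ - _ = ((y - x)%:C)%C); last by rewrite /= /GRing.add/=/GRing.opp/= subrr.
rewrite cabs_real; near: y; exact: cvgr_distC_lt.
Unshelve. all: by end_near. Qed.

Lemma vcont_Im f a c d : vcont f a c d ->
  segcont (fun y => complex.Im (f (Complex a y))) c d.
Proof.
move=> fc x xab; apply/cvgrPdistC_lt => e e0.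
have /cvg_cabsP/(_ e e0)/nbhs_cabsP[de d0 dP] := fc _ xab.
near=> y; rewrite -raddfB; apply: le_lt_trans (cabs_im _) (dP _ _).
apply: le_lt_trans (cabs_le _) _.
rewrite /= subrr normr0 add0r; near: y; exact: cvgr_distC_lt.
Unshelve. all: by end_near. Qed.

Lemma rectint_hsplit f a m b c d : a <= m -> m <= b ->
  hcont f a b c -> hcont f a b d ->
  rectint f a b c d = rectint f a m c d + rectint f m b c d.
Proof.
move=> am mb /hcont_Re fc /hcont_Re fd.
rewrite /rectint (segint_split am mb fc) (segint_split am mb fd); lra.
Qed.

Lemma rectint_vsplit f a b c m d : c <= m -> m <= d ->
  vcont f a c d -> vcont f b c d ->
  rectint f a b c d = rectint f a b c m + rectint f a b m d.
Proof.
move=> am mb /vcont_Im fc /vcont_Im fd.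
rewrite /rectint (segint_split am mb fc) (segint_split am mb fd); lra.
Qed.

Lemma rectint_bound f a b c d K : a <= b -> c <= d ->
  hcont f a b c -> hcont f a b d -> vcont f a c d -> vcont f b c d ->
  (forall x, a <= x <= b -> cabs (f (Complex x c)) <= K) ->
  (forall x, a <= x <= b -> cabs (f (Complex x d)) <= K) ->
  (forall y, c <= y <= d -> cabs (f (Complex a y)) <= K) ->
  (forall y, c <= y <= d -> cabs (f (Complex b y)) <= K) ->
  `|rectint f a b c d| <= K * (2 * ((b - a) + (d - c))).
Proof.
move=> ab cd /hcont_Re fc /hcont_Re fd /vcont_Im fa /vcont_Im fb Kc Kd Ka Kb.
have := segint_bound ab fc (fun x h => le_trans (cabs_re _) (Kc x h)).
have := segint_bound ab fd (fun x h => le_trans (cabs_re _) (Kd x h)).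
have := segint_bound cd fa (fun x h => le_trans (cabs_im _) (Ka x h)).
have := segint_bound cd fb (fun x h => le_trans (cabs_im _) (Kb x h)).
rewrite /rectint !ler_norml; move: (segint _ _ _) => w; move: (segint _ _ _) => x.
move: (segint _ _ _) => y; move: (segint _ _ _) => z; lra.
Qed.

Lemma rectintB f g a b c d :
  hcont f a b c -> hcont f a b d -> vcont f a c d -> vcont f b c d ->
  hcont g a b c -> hcont g a b d -> vcont g a c d -> vcont g b c d ->
  rectint (fun z => f z - g z) a b c d = rectint f a b c d - rectint g a b c d.
Proof.
move=> /hcont_Re fc /hcont_Re fd /vcont_Im fa /vcont_Im fb.
move=> /hcont_Re gc /hcont_Re gd /vcont_Im ga /vcont_Im gb; rewrite /rectint.
have eRe (h : R -> C) u v : segint (fun x => complex.Re (f (h x) - g (h x))) u v =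
    segint (fun x => complex.Re (f (h x)) - complex.Re (g (h x))) u v.
  by apply: eq_segint => x _; rewrite raddfB.
have eIm (h : R -> C) u v : segint (fun x => complex.Im (f (h x) - g (h x))) u v =
    segint (fun x => complex.Im (f (h x)) - complex.Im (g (h x))) u v.
  by apply: eq_segint => x _; rewrite raddfB.
rewrite (eRe (fun x => Complex x c)) (eRe (fun x => Complex x d)).
rewrite (eIm (fun y => Complex b y)) (eIm (fun y => Complex a y)).
by rewrite !segintB//; lra.
Qed.

End contour_integral.

(** * Bisection of rectangles *)

Section bisection.
Context {R : realType}.
Implicit Types (a b c d : R).

(** The supremum of the left end points is a common point. *)
Lemma nested_segments (u l : nat -> R) :
  (forall k, u k <= u k.+1) -> (forall k, u k.+1 + l k.+1 <= u k + l k) ->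
  (forall k, 0 <= l k) -> exists x, forall k, u k <= x <= u k + l k.
Proof.
move=> ui di l0.
have um n m : (n <= m)%N -> u n <= u m by move: n m; exact/nondecreasing_seqP.
have dm n m : (n <= m)%N -> u m + l m <= u n + l n.
  elim: m => [|m IH]; first by rewrite leqn0 => /eqP->.
  rewrite leq_eqVlt => /predU1P[->//|/IH]; exact/le_trans/di.
have ub n m : u m <= u n + l n.
  have [nm|/ltW mn] := leP n m.
    by rewrite (le_trans _ (dm _ _ nm))// lerDl.
  by rewrite (le_trans (um _ _ mn))// lerDl.
exists (sup (range u)) => k; apply/andP; split.
  by apply: ub_le_sup; [exists (u 0%N + l 0%N) => _ [m _ <-]; exact: ub|exists k].
by apply: ge_sup; [exists (u 0%N), 0%N|move=> _ [m _ <-]; exact: ub].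
Qed.

(** If [Q] fails on a rectangle, it fails on one of its quarters. The quarters selected in this way
    shrink to a point [w], and the local hypothesis at [w] makes [Q] hold on the small ones. *)
Lemma rect_bisection (Q : R -> R -> R -> R -> Prop) a b c d : a <= b -> c <= d ->
  (forall a b c d (m := (a + b) / 2) (k := (c + d) / 2), a <= b -> c <= d ->
    Q a m c k -> Q m b c k -> Q a m k d -> Q m b k d -> Q a b c d) ->
  (forall w, rect a b c d w -> exists2 e, 0 < e & forall a' b' c' d',
    a <= a' -> a' <= b' -> b' <= b -> c <= c' -> c' <= d' -> d' <= d ->
    rect a' b' c' d' w -> (b' - a') + (d' - c') < e -> Q a' b' c' d') ->
  Q a b c d.
Proof.
move=> ab cd Qsplit Qloc; apply: contrapT => nQ.
pose s k : R := (b - a) / 2 ^+ k; pose t k : R := (d - c) / 2 ^+ k.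
have p2 k : (0 : R) < 2 ^+ k by rewrite exprn_gt0.
have sS k : s k.+1 = s k / 2 by rewrite /s exprS; field; rewrite gt_eqF.
have tS k : t k.+1 = t k / 2 by rewrite /t exprS; field; rewrite gt_eqF.
have s0 k : 0 <= s k by rewrite divr_ge0 ?subr_ge0// ltW.
have t0 k : 0 <= t k by rewrite divr_ge0 ?subr_ge0// ltW.
pose bad k (p : R * R) := ~ Q p.1 (p.1 + s k) p.2 (p.2 + t k).
(* The premise [bad k p] stands inside the existential, so that [choice] gives a total function,
   which is then iterated. *)
have step (kp : nat * (R * R)) : exists p' : R * R, let: (k, p) := kp in bad k p ->
    [/\ bad k.+1 p', p.1 <= p'.1, p'.1 <= p.1 + s k.+1,
        p.2 <= p'.2 & p'.2 <= p.2 + t k.+1].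
  case: kp => k [u v]; apply: contrapT => /forallNP nex; apply: (nex (u, v)) => bk.
  have good u' v' : u <= u' -> u' <= u + s k.+1 -> v <= v' -> v' <= v + t k.+1 ->
      Q u' (u' + s k.+1) v' (v' + t k.+1).
    move=> h1 h2 h3 h4; apply: contrapT => nQ'; apply: (nex (u', v')) => _.
    by split.
  exfalso; apply: bk => /=; have := s0 k; have := t0 k; have := s0 k.+1; have := t0 k.+1.
  move=> h1 h2 h3 h4.
  have mE : (u + (u + s k)) / 2 = u + s k.+1 by rewrite sS; lra.
  have kE : (v + (v + t k)) / 2 = v + t k.+1 by rewrite tS; lra.
  have uE : u + s k = u + s k.+1 + s k.+1 by rewrite sS; lra.
  have vE : v + t k = v + t k.+1 + t k.+1 by rewrite tS; lra.
  apply: Qsplit; rewrite ?mE ?kE ?lerDl// ?uE ?vE; apply: good; lra.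
have [g gP] := choice step.
pose f := fix f k := if k is k'.+1 then g (k', f k') else (a, c).
have fbad k : bad k (f k).
  elim: k => [|k IH]; first by rewrite /bad /s /t !expr0 !divr1 /= !subrKC.
  by have [] := gP (k, f k) IH.
have fS k := gP (k, f k) (fbad k).
have [x xP] : exists x, forall k, (f k).1 <= x <= (f k).1 + s k.
  apply: nested_segments => // k; have [_ h1 h2 _ _] := fS k => //=.
  by rewrite -/f sS in h2 *; move: h2; rewrite /=; lra.
have [z zP] : exists x, forall k, (f k).2 <= x <= (f k).2 + t k.
  apply: nested_segments => // k; have [_ _ _ h1 h2] := fS k => //=.
  by rewrite -/f tS in h2 *; move: h2; rewrite /=; lra.
have f1 k : a <= (f k).1 /\ (f k).1 + s k <= b.
  elim: k => [|k [IH1 IH2]]; first by rewrite /s expr0 divr1 /= subrKC.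
  by have [_ h1 h2 _ _] := fS k; rewrite -/f /= sS in h1 h2 *; lra.
have f2 k : c <= (f k).2 /\ (f k).2 + t k <= d.
  elim: k => [|k [IH1 IH2]]; first by rewrite /t expr0 divr1 /= subrKC.
  by have [_ _ _ h1 h2] := fS k; rewrite -/f /= tS in h1 h2 *; lra.
have [|e e0 eP] := Qloc (Complex x z).
  split=> /=; first by have /andP[] := xP 0%N; have := f1 0%N; lra.
  by have /andP[] := zP 0%N; have := f2 0%N; lra.
have [k ke] : exists k, s k + t k < e.
  have : (fun k => s k + t k) @ \oo --> (0 : R).
    rewrite (_ : (fun _ => _) = (fun k => ((b - a) + (d - c)) * (1 / 2) ^+ k)).
      by rewrite -[X in _ --> X](mulr0 ((b - a) + (d - c))); apply: cvgMr;
         apply: cvg_expr; rewrite ger0_norm; lra.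
    by apply/funext => k; rewrite /s /t expr_div_n expr1n; field; rewrite gt_eqF.
  move=> /cvgrPdistC_lt/(_ _ e0)[k _ /(_ k (leqnn k))] /=; rewrite subr0 => kP.
  by exists k; exact: le_lt_trans (ler_norm _) kP.
apply: (fbad k); have [h1 h2] := f1 k; have [h3 h4] := f2 k.
apply: eP => //; rewrite ?lerDl//.
by move: ke; lra.
Qed.

End bisection.

(** * Goursat's theorem on rectangles *)

Section goursat.
Context {R : realType}.
Local Notation C := R[i].
Implicit Types (f : C -> C) (a b c d : R).

Lemma continuous_affine (p q w : C) : {for w, continuous (fun z : C => p + q * z)}.
Proof.
apply: (@differentiable_continuous _ C^o C^o w (fun z : C => p + q * z)).
apply: differentiableD; first exact: differentiable_cst.
by apply: differentiableM; [exact: differentiable_cst|exact: ex_diff].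
Qed.

(** On each pair of opposite sides the two integrands differ by a constant, and the contributions of
    the two pairs cancel. *)
Lemma rectint_affine (p q : C) a b c d : a <= b -> c <= d ->
  rectint (fun z => p + q * z) a b c d = 0.
Proof.
move=> ab cd; pose f z := p + q * z; rewrite -/f.
have cf w : {for w, continuous f} by exact: continuous_affine.
have hc y := @hcont_Re _ f a b y (fun x _ => cf _).
have vc x := @vcont_Im _ f x c d (fun x _ => cf _).
rewrite /rectint -(segintB (hc c) (hc d)) -addrA addrC (addrC (- _)).
rewrite -(segintB (vc a) (vc b)) /f.
case: p q {f cf hc vc} => [p1 p2] [q1 q2] /=.
rewrite (@eq_segint _ _ (fun=> q2 * (a - b))); last by move=> x _ /=; ring.
rewrite [X in _ + X](@eq_segint _ _ (fun=> q2 * (d - c))); last by move=> x _ /=; ring.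
by rewrite !segint_cst//; ring.
Qed.

Lemma differentiable_continuousC f (w : C) :
  differentiable (f : C^o -> C^o) w -> {for w, continuous f}.
Proof. exact: (@differentiable_continuous _ C^o C^o). Qed.

(** A bound of the integral by [e] times the square of the sum of the two sides is stable under
    bisection: this sum is halved in each quarter, and there are four quarters. Near a point the
    bound holds because [f] is close to its affine approximation, whose integral vanishes. *)
Theorem goursat f a b c d : a <= b -> c <= d ->
  (forall w, rect a b c d w -> differentiable (f : C^o -> C^o) w) ->
  rectint f a b c d = 0.
Proof.
move=> ab cd df.
suff H e : 0 < e -> `|rectint f a b c d| <= e * ((b - a) + (d - c)) ^+ 2.
  apply/eqP; rewrite -normr_eq0; apply/negP => /negP n0.
  have {}n0 : 0 < `|rectint f a b c d| by rewrite lt_def n0 normr_ge0.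
  set L := ((b - a) + (d - c)) ^+ 2 in H.
  have L0 : 0 <= L by rewrite exprn_even_ge0.
  have q0 : 0 < `|rectint f a b c d| / (L + 1) by rewrite divr_gt0// ltr_wpDl.
  have := H _ (divr_gt0 q0 (ltr0Sn R 1)).
  have -> : `|rectint f a b c d| = `|rectint f a b c d| / (L + 1) * (L + 1).
    by rewrite divfK// gt_eqF// ltr_wpDl.
  rewrite mulfK ?gt_eqF ?ltr_wpDl//; move: q0; set q := _ / _ => q0.
  have := mulr_ge0 (ltW q0) L0; lra.
move=> e0.
apply: (@rect_bisection _ (fun a b c d =>
  a <= b -> c <= d -> (forall w, rect a b c d w -> differentiable (f : C^o -> C^o) w) ->
  `|rectint f a b c d| <= e * ((b - a) + (d - c)) ^+ 2)) => //.
  move=> {ab cd df} {}a {}b {}c {}d m k ab cd H1 H2 H3 H4 _ _ df.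
  have am : a <= m by rewrite /m; lra.
  have mb : m <= b by rewrite /m; lra.
  have ck : c <= k by rewrite /k; lra.
  have kd : k <= d by rewrite /k; lra.
  have cf w : rect a b c d w -> {for w, continuous f}.
    by move=> /df; exact: differentiable_continuousC.
  rewrite (rectint_hsplit am mb); last first.
  - by move=> x xab; apply: cf; split=> //=; rewrite lexx cd.
  - by move=> x xab; apply: cf; split=> //=; rewrite lexx cd.
  rewrite !(rectint_vsplit ck kd); last first.
  - by move=> x xab; apply: cf; split=> //=; rewrite am.
  - by move=> x xab; apply: cf; split=> //=; rewrite lexx ab.
  - by move=> x xab; apply: cf; split=> //=; rewrite lexx ab.
  - by move=> x xab; apply: cf; split=> //=; rewrite am.
  have sub a' b' c' d' : a <= a' -> b' <= b -> c <= c' -> d' <= d ->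
      forall w, rect a' b' c' d' w -> differentiable (f : C^o -> C^o) w.
    move=> h1 h2 h3 h4 w [/andP[w1 w2] /andP[w3 w4]]; apply: df.
    by split; apply/andP; split; lra.
  have {}H1 := H1 am ck (sub _ _ _ _ (lexx _) mb (lexx _) kd).
  have {}H2 := H2 mb ck (sub _ _ _ _ am (lexx _) (lexx _) kd).
  have {}H3 := H3 am kd (sub _ _ _ _ (lexx _) mb ck (lexx _)).
  have {}H4 := H4 mb kd (sub _ _ _ _ am (lexx _) ck (lexx _)).
  apply: le_trans (ler_normD _ _) _.
  have := lerD (ler_normD (rectint f a m c k) (rectint f a m k d))
    (ler_normD (rectint f m b c k) (rectint f m b k d)).
  move=> /le_trans; apply; apply: le_trans (lerD (lerD H1 H3) (lerD H2 H4)) _.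
  by rewrite le_eqVlt; apply/orP; left; apply/eqP; rewrite /m /k; field.
move=> w wab; have [l lP] := differentiable_cabsP (df w wab).
(* The perimeter is [2 * L], so an error of [e / 2 * L] on the boundary integrates to at most
   [e * L ^+ 2]. *)
have [|del d0 dP] := lP (e / 2); first by rewrite divr_gt0.
exists del => // a' b' c' d' aa ab' bb cc cd' dd w' Ldel _ _ df'.
pose g z := (f w - l * w) + l * z; set L := (b' - a') + (d' - c') in Ldel *.
have cf z : rect a' b' c' d' z -> {for z, continuous f}.
  by move=> /df'; exact: differentiable_continuousC.
have cg z : {for z, continuous g} by exact: continuous_affine.
have zw z : rect a' b' c' d' z -> cabs (z - w) <= L.
  move=> [/andP[z1 z2] /andP[z3 z4]]; have [/andP[w1 w2] /andP[w3 w4]] := w'.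
  apply: le_trans (cabs_le _) _; rewrite !raddfB.
  by apply: lerD; rewrite ler_norml; lra.
have fg z : rect a' b' c' d' z -> cabs (f z - g z) <= e / 2 * L.
  move=> rz; have -> : f z - g z = f z - f w - l * (z - w) by rewrite /g; ring.
  apply: le_trans (dP _ (le_lt_trans (zw _ rz) Ldel)) _.
  by rewrite ler_wpM2l ?zw// divr_ge0// ltW.
have r1 x : a' <= x <= b' -> rect a' b' c' d' (Complex x c').
  by split=> //=; rewrite lexx.
have r2 x : a' <= x <= b' -> rect a' b' c' d' (Complex x d').
  by split=> //=; rewrite lexx cd'.
have r3 x : c' <= x <= d' -> rect a' b' c' d' (Complex a' x).
  by split=> //=; rewrite lexx.
have r4 x : c' <= x <= d' -> rect a' b' c' d' (Complex b' x).
  by split=> //=; rewrite lexx ab'.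
have g0 : rectint g a' b' c' d' = 0 by exact: rectint_affine.
have hg y : hcont g a' b' y by move=> x _; exact: cg.
have vg x : vcont g x c' d' by move=> y _; exact: cg.
have hf1 : hcont f a' b' c' by move=> x /r1 /cf.
have hf2 : hcont f a' b' d' by move=> x /r2 /cf.
have vf1 : vcont f a' c' d' by move=> x /r3 /cf.
have vf2 : vcont f b' c' d' by move=> x /r4 /cf.
have := rectintB hf1 hf2 vf1 vf2 (hg _) (hg _) (vg _) (vg _).
rewrite g0 subr0 => <-.
have cfg z : rect a' b' c' d' z -> {for z, continuous (fun z => f z - g z)}.
  by move=> rz; exact: (@continuousB _ C^o C _ _ _ (cf _ rz) (cg z)).
have h1 : hcont (fun z => f z - g z) a' b' c' by move=> x /r1 /cfg.
have h2 : hcont (fun z => f z - g z) a' b' d' by move=> x /r2 /cfg.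
have v1 : vcont (fun z => f z - g z) a' c' d' by move=> x /r3 /cfg.
have v2 : vcont (fun z => f z - g z) b' c' d' by move=> x /r4 /cfg.
apply: le_trans (rectint_bound (K := e / 2 * L) ab' cd' h1 h2 v1 v2 _ _ _ _) _.
- by move=> x /r1 /fg.
- by move=> x /r2 /fg.
- by move=> x /r3 /fg.
- by move=> x /r4 /fg.
by rewrite -/L le_eqVlt; apply/orP; left; apply/eqP; field.
Qed.

End goursat.

(** * Isolated singularities and the Cauchy kernel *)

Section cauchy_bound.
Context {R : realType}.
Local Notation C := R[i].
Implicit Types (f : C -> C) (a b c d e s K M : R) (p z w : C).

Definition inrect a b c d (z : C) :=
  a < complex.Re z < b /\ c < complex.Im z < d.

Definition rectbd a b c d (z : C) := rect a b c d z /\ ~ inrect a b c d z.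

Lemma rect_bottom a b c d x : c <= d -> a <= x <= b -> rectbd a b c d (Complex x c).
Proof. by move=> cd xab; split; [split=> //=; rewrite lexx|case=> /=; rewrite ltxx]. Qed.

Lemma rect_top a b c d x : c <= d -> a <= x <= b -> rectbd a b c d (Complex x d).
Proof.
by move=> cd xab; split; [split=> //=; rewrite lexx cd|case=> /=; rewrite ltxx andbF].
Qed.

Lemma rect_left a b c d y : a <= b -> c <= y <= d -> rectbd a b c d (Complex a y).
Proof. by move=> cd xab; split; [split=> //=; rewrite lexx|case=> /=; rewrite ltxx]. Qed.

Lemma rect_right a b c d y : a <= b -> c <= y <= d -> rectbd a b c d (Complex b y).
Proof.
by move=> cd xab; split; [split=> //=; rewrite lexx cd|case=> /=; rewrite ltxx andbF].
Qed.

(** A small square of half-side [r] around [p] is cut out. Goursat's theorem applies to the four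
    rectangles that surround it, and the square contributes at most [M] times its perimeter [8 * r],
    which tends to 0. *)
Lemma rectint_hole f p a b c d M e : inrect a b c d p ->
  (forall w, rect a b c d w -> w <> p -> differentiable (f : C^o -> C^o) w) ->
  0 < e -> (forall w, w <> p -> cabs (w - p) < e -> cabs (f w) <= M) ->
  rectint f a b c d = 0.
Proof.
case: p => p1 p2 [/andP[/= ap pb] /andP[/= cp pd]] df e0 fM.
have M0 : 0 <= M.
  apply: le_trans (cabs_ge0 _) (fM (Complex (p1 + e / 2) p2) _ _).
    by case; lra.
  apply: le_lt_trans (cabs_le _) _ => /=.
  by rewrite subrr normr0 addr0 addrC addKr ger0_norm; lra.
suff H : \forall r \near 0^'+, `|rectint f a b c d| <= M * (8 * r).
  apply/eqP; rewrite -normr_eq0; apply: contraT => n0.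
  have {}n0 : 0 < `|rectint f a b c d| by rewrite lt_def n0 normr_ge0.
  have M1 : 0 < 8 * M + 1 by lra.
  have [r [[/= rH r0] rM]] := filter_ex (filterI (filterI H (nbhs_right_gt 0))
    (nbhs_right_lt (divr_gt0 n0 M1))).
  by move: rM; rewrite ltr_pdivlMr//; lra.
near=> r.
have r0 : 0 < r by near: r; exact: nbhs_right_gt.
have re : r < e / 2 by near: r; apply: nbhs_right_lt; rewrite divr_gt0.
have r1 : r < p1 - a by near: r; apply: nbhs_right_lt; rewrite subr_gt0.
have r2 : r < b - p1 by near: r; apply: nbhs_right_lt; rewrite subr_gt0.
have r3 : r < p2 - c by near: r; apply: nbhs_right_lt; rewrite subr_gt0.
have r4 : r < d - p2 by near: r; apply: nbhs_right_lt; rewrite subr_gt0.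
pose P := Complex p1 p2.
have cf w : rect a b c d w -> w <> P -> {for w, continuous f}.
  by move=> rw wp; apply: differentiable_continuousC; exact: df.
have hf y : c <= y <= d -> y != p2 -> hcont f a b y.
  by move=> ycd /eqP yp x xab; apply: cf => // -[_].
have vf x : a <= x <= b -> x != p1 -> vcont f x c d.
  by move=> xab /eqP xp y ycd; apply: cf => // -[].
have hsub a' b' y : a <= a' -> b' <= b -> hcont f a b y -> hcont f a' b' y.
  by move=> aa bb h x /andP[x1 x2]; apply: h; rewrite (le_trans aa x1) (le_trans x2 bb).
have vsub c' d' x : c <= c' -> d' <= d -> vcont f x c d -> vcont f x c' d'.
  by move=> aa bb h y /andP[x1 x2]; apply: h; rewrite (le_trans aa x1) (le_trans x2 bb).
have G a' b' c' d' : a <= a' -> a' <= b' -> b' <= b -> c <= c' -> c' <= d' -> d' <= d ->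
    (~ rect a' b' c' d' P) -> rectint f a' b' c' d' = 0.
  move=> h1 h2 h3 h4 h5 h6 nP; apply: goursat => // w rw; apply: df.
    by have [/andP[? ?] /andP[? ?]] := rw; split; apply/andP; split; lra.
  by move=> wP; apply: nP; move: rw; rewrite wP.
have hc : hcont f a b c by apply: hf; lra.
have hd : hcont f a b d by apply: hf; lra.
have v1 : vcont f (p1 - r) c d by apply: vf; lra.
have v2 : vcont f (p1 + r) c d by apply: vf; lra.
rewrite (@rectint_hsplit _ f a (p1 - r) b)//; [|lra..].
rewrite (G a (p1 - r)) ?add0r; [|lra..|by case=> /= /andP[]; lra].
rewrite (@rectint_hsplit _ f _ (p1 + r) b);
  [|lra|lra|by apply: hsub hc; lra|by apply: hsub hd; lra].
rewrite (G (p1 + r)) ?addr0; [|lra..|by case=> /= /andP[]; lra].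
rewrite (@rectint_vsplit _ f _ _ _ (p2 - r) d)//; [|lra..].
rewrite (G _ _ c) ?add0r; [|lra..|by case=> /= _ /andP[]; lra].
rewrite (@rectint_vsplit _ f _ _ _ (p2 + r) d);
  [|lra|lra|by apply: vsub v1; lra|by apply: vsub v2; lra].
rewrite (G _ _ (p2 + r)) ?addr0; [|lra..|by case=> /= _ /andP[]; lra].
have near_ u v : p1 - r <= u <= p1 + r -> p2 - r <= v <= p2 + r ->
    (u != p1) || (v != p2) -> cabs (f (Complex u v)) <= M.
  move=> /andP[u1 u2] /andP[w1 w2] uv; apply: fM.
    by case=> h1 h2; move: uv; rewrite h1 h2 !eqxx.
  apply: le_lt_trans (cabs_le _) _ => /=.
  have /= : `|u - p1| <= r by rewrite ler_norml; lra.
  have /= : `|v - p2| <= r by rewrite ler_norml; lra.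
  lra.
have -> : M * (8 * r) = M * (2 * (p1 + r - (p1 - r) + (p2 + r - (p2 - r)))) by ring.
apply: rectint_bound; try lra.
- by apply: hsub (hf _ _ _); lra.
- by apply: hsub (hf _ _ _); lra.
- by apply: vsub v1; lra.
- by apply: vsub v2; lra.
- by move=> x xp; apply: near_ => //; [lra|apply/orP; right; lra].
- by move=> x xp; apply: near_ => //; [lra|apply/orP; right; lra].
- by move=> x xp; apply: near_ => //; [lra|apply/orP; left; lra].
- by move=> x xp; apply: near_ => //; [lra|apply/orP; left; lra].
Unshelve. all: by end_near. Qed.

Lemma differentiable_kernel (l p w : C) : w <> p ->
  differentiable ((fun z => l * (z - p)^-1) : C^o -> C^o) w.
Proof.
move=> wp; apply: differentiableM; first exact: differentiable_cst.
apply: differentiableV; last by rewrite subr_eq0; exact/eqP.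
by apply: differentiableB; [exact: ex_diff|exact: differentiable_cst].
Qed.

Lemma inv_complexE (u v : R) :
  (Complex u v)^-1 = Complex (u / (u ^+ 2 + v ^+ 2)) (- (v / (u ^+ 2 + v ^+ 2))) :> C.
Proof. by []. Qed.

(** The exact value is 2 pi s. A positive lower bound is enough: each of the four sides contributes
    a nonnegative amount, and on the bottom side |z - p|^2 is at most
    [(b - a) ^+ 2 + (d - c) ^+ 2]. *)
Lemma rectint_kernel_ge (s : R) p a b c d : 0 <= s -> inrect a b c d p ->
  s * ((complex.Im p - c) / ((b - a) ^+ 2 + (d - c) ^+ 2) * (b - a))
  <= rectint (fun z => Complex 0 (- s) * (z - p)^-1) a b c d.
Proof.
move=> s0 ip; set f := fun z : C => _.
have cf w : rectbd a b c d w -> {for w, continuous f}.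
  move=> [_ wp]; apply/differentiable_continuousC/differentiable_kernel.
  by move=> wE; apply: wp; rewrite wE.
have [ab cd] : a <= b /\ c <= d by case: ip => /andP[? ?] /andP[? ?]; lra.
have hc : hcont f a b c by move=> x /(rect_bottom cd) /cf.
have hd : hcont f a b d by move=> x /(rect_top cd) /cf.
have va : vcont f a c d by move=> x /(rect_left ab) /cf.
have vb : vcont f b c d by move=> x /(rect_right ab) /cf.
case: p => p1 p2 in ip f cf hc hd va vb *.
have [/andP[/= ap pb] /andP[/= cp pd]] := ip.
have fRe x y : complex.Re (f (Complex x y)) = - (s * ((y - p2) / ((x - p1) ^+ 2 + (y - p2) ^+ 2))).
  by rewrite /f inv_complexE/=; ring.
have fIm x y : complex.Im (f (Complex x y)) = - (s * ((x - p1) / ((x - p1) ^+ 2 + (y - p2) ^+ 2))).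
  by rewrite /f inv_complexE/=; ring.
have n0 (u v : R) : 0 <= u ^+ 2 + v ^+ 2 by rewrite addr_ge0// sqr_ge0.
have L1 : s * ((p2 - c) / ((b - a) ^+ 2 + (d - c) ^+ 2)) * (b - a) <=
    segint (fun x => complex.Re (f (Complex x c))) a b.
  rewrite -segint_cst//; apply: le_segint.
  - exact: segcont_cst.
  - exact: hcont_Re.
  - move=> x xab; rewrite fRe -mulrN ler_wpM2l// -mulNr opprB.
    have le_sq (u v : R) : - v <= u <= v -> u ^+ 2 <= v ^+ 2.
      by move=> /andP[h1 h2]; rewrite -subr_ge0 subr_sqr mulr_ge0//; lra.
    have n1 : 0 < (b - a) ^+ 2 + (d - c) ^+ 2.
      by rewrite ltr_pwDl ?sqr_ge0// exprn_gt0//; lra.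
    have n2 : 0 < (x - p1) ^+ 2 + (c - p2) ^+ 2.
      by rewrite ltr_wpDl ?sqr_ge0// -sqrrN exprn_gt0//; lra.
    rewrite ler_wpM2l ?subr_ge0 ?(ltW cp)// lef_pV2 ?posrE//.
    by apply: lerD; apply: le_sq; lra.
have L2 : segint (fun x => complex.Re (f (Complex x d))) a b <= 0.
  rewrite -(mul0r (b - a)) -segint_cst//; apply: le_segint.
  - exact: hcont_Re.
  - exact: segcont_cst.
  - by move=> x xab; rewrite fRe oppr_le0 mulr_ge0// divr_ge0// subr_ge0 ltW.
have L3 : segint (fun y => complex.Im (f (Complex b y))) c d <= 0.
  rewrite -(mul0r (d - c)) -segint_cst//; apply: le_segint.
  - exact: vcont_Im.
  - exact: segcont_cst.
  - by move=> x xab; rewrite fIm oppr_le0 mulr_ge0// divr_ge0// subr_ge0 ltW.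
have L4 : 0 <= segint (fun y => complex.Im (f (Complex a y))) c d.
  rewrite -(mul0r (d - c)) -segint_cst//; apply: le_segint.
  - exact: segcont_cst.
  - exact: vcont_Im.
  - move=> x xab; rewrite fIm -mulrN mulr_ge0// -mulNr opprB divr_ge0// subr_ge0.
    exact: ltW.
by rewrite /rectint /= mulrA; move: L1 L2 L3 L4; lra.
Qed.

End cauchy_bound.

(** * From a bound with a constant to the Schwarz lemma *)

Section schwarz.
Context {R : realType}.
Local Notation C := R[i].
Implicit Types (f : C -> C) (a b c d e s K M B : R) (p z w x : C).

Lemma rectbd_dist a b c d p : inrect a b c d p ->
  exists2 r : R, 0 < r & forall w, rectbd a b c d w -> r <= cabs (w - p).
Proof.
move=> [/andP[ap pb] /andP[cp pd]].
exists (Num.min (Num.min (complex.Re p - a) (b - complex.Re p))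
                (Num.min (complex.Im p - c) (d - complex.Im p))).
  by rewrite !lt_min !subr_gt0 ap pb cp.
move=> w [[/andP[aw wb] /andP[cw wd]] nw].
rewrite leNgt; apply/negP; rewrite !lt_min => /andP[/andP[h1 h2] /andP[h3 h4]].
have := cabs_re (w - p); have := cabs_im (w - p); rewrite !raddfB.
rewrite !ler_norml => /andP[h5 h6] /andP[h7 h8].
by apply: nw; split; apply/andP; split; lra.
Qed.

(** The difference quotient of [f] at [p] is bounded near [p], so its integral vanishes and f(z)/(z
    - p) has the same integral as f(p)/(z - p). The latter is bounded below through the Cauchy
    kernel, the former is bounded above by [K] times the perimeter over the distance [r] from [p] to
    the boundary. *)
Lemma cauchy_crude_bound a b c d p : inrect a b c d p ->
  exists2 B, 0 <= B & forall f K,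
    (forall w, rect a b c d w -> differentiable (f : C^o -> C^o) w) ->
    (forall w, rectbd a b c d w -> cabs (f w) <= K) -> cabs (f p) <= B * K.
Proof.
move=> ip; have [r r0 rP] := rectbd_dist ip.
have [ab cd] : a < b /\ c < d by case: ip => /andP[? ?] /andP[? ?]; lra.
have cp : c < complex.Im p by case: ip => _ /andP[].
pose c0 := (complex.Im p - c) / ((b - a) ^+ 2 + (d - c) ^+ 2) * (b - a).
have c0_gt0 : 0 < c0.
  by rewrite mulr_gt0 ?divr_gt0 ?subr_gt0// addr_gt0// exprn_gt0// subr_gt0.
exists (r^-1 * (2 * ((b - a) + (d - c))) / c0).
  rewrite divr_ge0 ?(ltW c0_gt0)// mulr_ge0 ?invr_ge0 ?(ltW r0)//; lra.
move=> f K df fK.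
have K0 : 0 <= K.
  apply: le_trans (cabs_ge0 _) (fK (Complex a c) _).
  by apply: (rect_bottom (ltW cd)); rewrite lexx ltW.
have [fp0|fp0] := eqVneq (f p) 0.
  rewrite fp0 cabs0 mulr_ge0// divr_ge0 ?(ltW c0_gt0)// mulr_ge0 ?invr_ge0 ?(ltW r0)//; lra.
have {}fp0 : 0 < cabs (f p) by rewrite cabs_gt0.
(* Since [rectint] keeps only the real part, the integrand is rotated: [l * f p] is -i |f p|^2,
   which makes the integral of [h2] real and positive. *)
pose l : C := Complex 0 (-1) * conjc (f p).
pose h1 (z : C) : C := (l * f z) * (z - p)^-1.
pose h2 (z : C) : C := (l * f p) * (z - p)^-1.
have lfp : l * f p = Complex 0 (- cabs (f p) ^+ 2).
  rewrite sqr_cabs /l; case: (f p) => u v /=.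
  by apply/eqP; rewrite eq_complex /=; apply/andP; split; apply/eqP; ring.
have absl : cabs l = cabs (f p).
  rewrite /l cabsM cabs_conj; suff -> : cabs (Complex 0 (-1) : C) = 1 by rewrite mul1r.
  by rewrite /= expr0n/= add0r sqrrN expr1n sqrtr1.
have dh1 w : rect a b c d w -> w <> p -> differentiable (h1 : C^o -> C^o) w.
  move=> rw wp.
  apply: (@differentiableM _ C^o (fun z => l * f z) (fun z => (z - p)^-1)).
    by apply: differentiableM; [exact: differentiable_cst|exact: df].
  apply: differentiableV; last by rewrite subr_eq0; exact/eqP.
  by apply: differentiableB; [exact: ex_diff|exact: differentiable_cst].
have dh2 w : w <> p -> differentiable (h2 : C^o -> C^o) w.
  exact: differentiable_kernel.
have bp w : rectbd a b c d w -> rect a b c d w /\ w <> p.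
  by move=> [rw nw]; split=> // wp; apply: nw; rewrite wp.
have ch1 w : rectbd a b c d w -> {for w, continuous h1}.
  by move=> /bp[? ?]; apply: differentiable_continuousC; exact: dh1.
have ch2 w : rectbd a b c d w -> {for w, continuous h2}.
  by move=> /bp[? ?]; apply: differentiable_continuousC; exact: dh2.
have [abW cdW] := (ltW ab, ltW cd).
have hole : rectint (fun z => h1 z - h2 z) a b c d = 0.
  have rp : rect a b c d p.
    by case: ip => /andP[? ?] /andP[? ?]; split; apply/andP; split; exact: ltW.
  have [f' f'P] := differentiable_cabsP (df p rp).
  have [e e0 eP] := f'P _ (@ltr01 R).
  apply: (@rectint_hole _ _ p _ _ _ _ (cabs l * (cabs f' + 1)) e ip _ e0).
    by move=> w rw wp; apply: differentiableB; [exact: dh1|exact: dh2].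
  move=> w wp wpe; have wp0 : 0 < cabs (w - p) by rewrite cabs_gt0 subr_eq0; exact/eqP.
  rewrite -mulrBl -mulrBr -mulrA cabsM ler_wpM2l ?cabs_ge0// cabsM cabsV.
  rewrite ler_pdivrMr// mulrDl -cabsM.
  have := le_trans (cabsD3 _ _ _) (lerD (eP w wpe) (lexx (cabs (f' * (w - p) - 0)))).
  rewrite !subr0; lra.
have hc1 : hcont h1 a b c by move=> x /(rect_bottom cdW) /ch1.
have hd1 : hcont h1 a b d by move=> x /(rect_top cdW) /ch1.
have va1 : vcont h1 a c d by move=> x /(rect_left abW) /ch1.
have vb1 : vcont h1 b c d by move=> x /(rect_right abW) /ch1.
have hc2 : hcont h2 a b c by move=> x /(rect_bottom cdW) /ch2.
have hd2 : hcont h2 a b d by move=> x /(rect_top cdW) /ch2.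
have va2 : vcont h2 a c d by move=> x /(rect_left abW) /ch2.
have vb2 : vcont h2 b c d by move=> x /(rect_right abW) /ch2.
have L : rectint h2 a b c d = rectint h1 a b c d.
  have := rectintB hc1 hd1 va1 vb1 hc2 hd2 va2 vb2; rewrite hole => /esym/eqP.
  by rewrite subr_eq0 => /eqP.
have lo : cabs (f p) ^+ 2 * c0 <= rectint h2 a b c d.
  by rewrite /h2 lfp; apply: rectint_kernel_ge => //; exact: sqr_ge0.
have hb w : rectbd a b c d w -> cabs (h1 w) <= cabs (f p) * K * r^-1.
  move=> bw; rewrite /h1 cabsM (cabsM l) absl cabsV.
  rewrite ler_pM ?mulr_ge0 ?cabs_ge0 ?invr_ge0 ?cabs_ge0//.
    by rewrite ler_wpM2l ?cabs_ge0// fK.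
  by rewrite lef_pV2 ?posrE ?rP// (lt_le_trans r0) ?rP.
have : `|rectint h1 a b c d| <= cabs (f p) * K * r^-1 * (2 * ((b - a) + (d - c))).
  apply: (rectint_bound abW cdW hc1 hd1 va1 vb1).
  - by move=> x /(rect_bottom cdW) /hb.
  - by move=> x /(rect_top cdW) /hb.
  - by move=> x /(rect_left abW) /hb.
  - by move=> x /(rect_right abW) /hb.
move=> /(le_trans (ler_norm _)); rewrite -L => /(le_trans lo).
rewrite expr2 -!mulrA ler_pM2l// => h.
move: h; rewrite -ler_pdivlMr// => /le_trans; apply.
by rewrite le_eqVlt; apply/orP; left; apply/eqP; ring.
Qed.

Lemma differentiable_pow (V : normedModType C) (g : V -> C) (n : nat) (v : V) :
  differentiable (g : V -> C^o) v ->
  differentiable ((fun u => g u ^+ n) : V -> C^o) v.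
Proof.
elim: n => [|n IH] dg; first exact: differentiable_cst.
rewrite (_ : (fun u => _) = (fun u => g u * g u ^+ n)).
  by apply: differentiableM => //; exact: IH.
by apply/funext => u; rewrite exprS.
Qed.

Lemma differentiable_square_bound f x B : f x = 0 ->
  (\forall z \near x, cabs (f z) <= B * cabs (z - x) ^+ 2) ->
  differentiable (f : C^o -> C^o) x.
Proof.
move=> fx0 fB; apply/derivable1_diffP; apply/cvg_ex; exists (0 : C).
apply/cvg_cabsP => e e0; rewrite near_withinE.
have /nbhs_cabsP[d d0 dB] := fB.
have B1 : 0 < `|B| + 1 by rewrite ltr_wpDl.
apply/nbhs_cabsP; exists (Num.min d (e / (`|B| + 1))).
  by rewrite lt_min d0 divr_gt0.
move=> h; rewrite subr0 lt_min => /andP[hd he] h0.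
rewrite subr0 fx0 subr0 /= /GRing.scale/= mulr1 cabsM cabsV.
have ch0 : 0 < cabs h by rewrite cabs_gt0.
have := dB (h + x); rewrite addrK => /(_ hd) fh.
rewrite -(ltr_pM2l ch0) mulVKf ?gt_eqF//; apply: le_lt_trans fh _.
rewrite expr2 mulrCA ltr_pM2l//; move: he; rewrite ltr_pdivlMr// mulrDr mulr1 => he.
have : B * cabs h <= cabs h * `|B| by rewrite mulrC ler_pM2l// ler_norm.
lra.
Qed.

(** If [v < u], then [e0 * (v / u) ^+ k] tends to 0 and drops below [s0]. *)
Lemma le_of_powers (s0 e0 u v : R) : 0 < s0 -> 0 <= v -> 0 <= u ->
  (forall k : nat, (0 < k)%N -> s0 * u ^+ k <= e0 * v ^+ k) -> u <= v.
Proof.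
move=> s00 v0 u0 H; rewrite leNgt; apply/negP => vu.
have up : 0 < u by exact: le_lt_trans vu.
have : e0 * (v / u) ^+ k @[k --> \oo] --> (0 : R).
  rewrite -[X in _ --> X](mulr0 e0); apply: cvgMr; apply: cvg_expr.
  by rewrite ger0_norm ?divr_ge0// ltr_pdivrMr// mul1r.
move=> /cvgrPdistC_lt/(_ _ s00)[k _ /(_ k.+1 (leqnSn k))] /=.
rewrite subr0 expr_div_n mulrA; apply/negP; rewrite -leNgt (le_trans _ (ler_norm _))//.
by rewrite ler_pdivlMr ?exprn_gt0// H.
Qed.

(* The powers of [f z / (z - x)^m], multiplied by [(z - x)^2] to make them
   differentiable at [x], satisfy a bound whose constant does not depend on the
   exponent; it disappears as the exponent grows. *)
Lemma schwarz f x (m : nat) a b c d B K : (0 < m)%N -> inrect a b c d x ->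
  (forall w, rect a b c d w -> differentiable (f : C^o -> C^o) w) ->
  (\forall z \near x, cabs (f z) <= B * cabs (z - x) ^+ m) ->
  (forall w, rectbd a b c d w -> cabs (f w) <= K * cabs (w - x) ^+ m) ->
  forall w, rect a b c d w -> cabs (f w) <= K * cabs (w - x) ^+ m.
Proof.
move=> m0 ix df fB fK w rw.
have [iw|/(conj rw)/fK//] := pselect (inrect a b c d w).
have [->|wx] := eqVneq w x.
  apply: le_trans (nbhs_singleton fB) _.
  by rewrite subrr cabs0 expr0n eqn0Ngt m0 !mulr0.
have [A A0 AP] := cauchy_crude_bound iw.
have [r r0 rP] := rectbd_dist ix.
have K0 : 0 <= K.
  have [ab cd] : a <= b /\ c <= d by case: iw => /andP[? ?] /andP[? ?]; lra.
  have bd : rectbd a b c d (Complex a c) by apply: rect_bottom; rewrite // lexx.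
  have := le_trans (cabs_ge0 _) (fK _ bd).
  by rewrite pmulr_lge0// exprn_gt0// (lt_le_trans r0)// rP.
(* [D] bounds |z - x| on the rectangle. The factor (z - x)^2 therefore costs at most [D ^+ 2] on the
   boundary, uniformly in the exponent [k]. *)
pose D := (b - a) + (d - c).
have Dw z : rect a b c d z -> cabs (z - x) <= D.
  move=> [/andP[z1 z2] /andP[z3 z4]]; have [/andP[x1 x2] /andP[x3 x4]] := ix.
  apply: le_trans (cabs_le _) _; rewrite !raddfB /D.
  by apply: lerD; rewrite ler_norml; lra.
have D0 : 0 <= D by exact: le_trans (cabs_ge0 _) (Dw w rw).
have wx0 : 0 < cabs (w - x) by rewrite cabs_gt0 subr_eq0.
rewrite -ler_pdivrMr ?exprn_gt0//.
apply: (@le_of_powers (cabs (w - x) ^+ 2) (A * D ^+ 2)) => //.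
- by rewrite exprn_gt0.
- by rewrite divr_ge0 ?exprn_ge0 ?cabs_ge0.
move=> k k0; pose Psi (z : C) : C := (z - x) ^+ 2 * (f z * ((z - x)^-1) ^+ m) ^+ k.
have cPsi z : cabs (Psi z) = cabs (z - x) ^+ 2 * (cabs (f z) / cabs (z - x) ^+ m) ^+ k.
  by rewrite /Psi cabsM !cabsX cabsM cabsX cabsV exprVn.
rewrite -cPsi -mulrA; apply: AP => [z rz|z bz]; last first.
  rewrite cPsi ler_pM ?exprn_ge0 ?divr_ge0 ?exprn_ge0 ?cabs_ge0//.
    by rewrite lerXn2r ?nnegrE ?cabs_ge0// Dw//; case: bz.
  rewrite lerXn2r ?nnegrE ?divr_ge0 ?exprn_ge0 ?cabs_ge0//.
  by rewrite ler_pdivrMr ?fK// exprn_gt0// (lt_le_trans r0) ?rP.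
have [->|zx] := eqVneq z x.
  apply: (@differentiable_square_bound _ _ (`|B| ^+ k)).
    by rewrite /Psi subrr expr0n mul0r.
  near=> u; rewrite cPsi mulrC ler_wpM2r ?exprn_ge0 ?cabs_ge0//.
  rewrite lerXn2r ?nnegrE ?divr_ge0 ?exprn_ge0 ?cabs_ge0//.
  have [->|ux] := eqVneq u x; first by rewrite subrr cabs0 expr0n eqn0Ngt m0 invr0 mulr0.
  have u0 : 0 < cabs (u - x) by rewrite cabs_gt0 subr_eq0.
  rewrite ler_pdivrMr ?exprn_gt0//.
  suff : cabs (f u) <= B * cabs (u - x) ^+ m.
    by move=> /le_trans; apply; rewrite ler_wpM2r ?exprn_ge0 ?cabs_ge0// ler_norm.
  by near: u.
have dzx : differentiable ((fun z => z - x) : C^o -> C^o) z.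
  by apply: differentiableB; [exact: ex_diff|exact: differentiable_cst].
apply: (@differentiableM _ C^o (fun z => (z - x) ^+ 2)
  (fun z => (f z * (z - x)^-1 ^+ m) ^+ k)).
  exact: (@differentiable_pow C^o (fun z => z - x)).
apply: (@differentiable_pow C^o (fun z => f z * (z - x)^-1 ^+ m)).
apply: (@differentiableM _ C^o f (fun z => (z - x)^-1 ^+ m)); first exact: df.
apply: (@differentiable_pow C^o (fun z => (z - x)^-1)).
by apply: differentiableV => //; rewrite subr_eq0.
Unshelve. all: by end_near. Qed.

End schwarz.

(** * Holomorphic functions on polydisks *)

Section compactness.

(** Compactness is used as a covering property for the filter at [+oo]: since [g] is nonnegative, a
    local bound persists for all larger constants. The function [g] may vanish on [K], as the norm
    of the canonical section does on the hypersurface. *)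
Lemma compact_locally_dominated (R : realType) (T : topologicalType) (K : set T)
    (f g : T -> R) : (forall x, 0 <= g x) -> compact K ->
  (forall x, K x -> exists M, \forall y \near x, K y -> f y <= M * g y) ->
  exists M, forall x, K x -> f x <= M * g x.
Proof.
move=> g0 /compact_near_coveringP/near_covering_withinP cK fM.
have : \forall M \near +oo, K `<=` (fun x => f x <= M * g x).
  apply: cK => x /fM[M xM]; near=> y i.
  have Mi : M <= i by near: i; apply: nbhs_pinfty_ge; rewrite num_real.
  by move=> Ky; apply: le_trans (near xM y _ Ky) (ler_wpM2r (g0 y) Mi).
by move=> /filter_ex[M fKM]; exists M.
Unshelve. all: by end_near. Qed.

Lemma compact_locally_bounded (R : realType) (T : topologicalType) (K : set T)
    (f : T -> R) : compact K ->
  (forall x, K x -> exists M, \forall y \near x, K y -> f y <= M) ->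
  exists M, forall x, K x -> f x <= M.
Proof.
move=> cK fM.
have [x Kx|M MP] := compact_locally_dominated (f := f) (g := cst 1) (fun=> ler01) cK.
  have [M xM] := fM x Kx; exists M; apply: filterS xM => y.
  by rewrite /cst mulr1.
by exists M => x /MP; rewrite /cst mulr1.
Qed.

Context {R : realType}.
Local Notation C := R[i].

Lemma continuous_cabs : continuous (fun z : C => cabs z).
Proof.
move=> z; apply/(@cvgrPdistC_lt R R C (nbhs z) (nbhs_filter z)) => e e0.
apply/nbhs_cabsP; exists e => // w wz.
apply: le_lt_trans wz; rewrite ler_norml.
have := cabsD (w - z) z; have := cabsD (z - w) w; rewrite !subrK (cabsB z w); lra.
Qed.

Lemma continuous_complex : continuous (fun p : R * R => (Complex p.1 p.2 : C)).
Proof.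
move=> [a b]; apply/cvg_cabsP => e e0; near=> p.
apply: le_lt_trans (cabs_le _) _ => /=; rewrite (splitr e) ltrD//; near: p.
  have : fst @ nbhs (a, b) --> a by exact: cvg_fst.
  by move/cvgr_distC_lt; apply; rewrite divr_gt0.
have : snd @ nbhs (a, b) --> b by exact: cvg_snd.
by move/cvgr_distC_lt; apply; rewrite divr_gt0.
Unshelve. all: by end_near. Qed.

Lemma compact_disc (r : R) : compact [set z : C | cabs z <= r].
Proof.
have c1 : compact ((fun p : R * R => (Complex p.1 p.2 : C)) @`
    (`[-r, r]%classic `*` `[-r, r]%classic)).
  apply: continuous_compact; last by apply: compact_setX; exact: segment_compact.
  by apply: continuous_subspaceT; exact: continuous_complex.
apply: subclosed_compact c1 _.
  rewrite (_ : [set z | _] = (fun z : C => cabs z) @^-1` [set x | x <= r])//.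
  by apply: preimage_closed; [move=> z _; exact: continuous_cabs|exact: closed_le].
move=> [a b] /= ab; exists (a, b) => //; split; rewrite /= in_itv/= -ler_norml.
  exact: le_trans (cabs_re (Complex a b)) ab.
exact: le_trans (cabs_im (Complex a b)) ab.
Qed.

Definition cpolydisk (n : nat) (r : R) : set 'rV[C]_n :=
  [set z | forall k, cabs (z ord0 k) <= r].

Lemma compact_cpolydisk (n : nat) (r : R) : compact (@cpolydisk n r).
Proof.
exact: (@rV_compact C n (fun=> [set z : C | cabs z <= r]) (fun=> @compact_disc r)).
Qed.

End compactness.

Section maxnorm.
Context {R : realType} {n : nat}.
Local Notation C := R[i].
Local Notation V := 'rV[C]_n.
Implicit Types z w v : V.

(** The sup norm as an element of [R]; the norm of the space [V] has values in [C]. *)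
Definition maxabs (z : V) : R := \big[Num.max/0]_k cabs (z ord0 k).

Lemma le_maxabs z k : cabs (z ord0 k) <= maxabs z.
Proof. by apply: le_bigmax. Qed.

Lemma maxabs_le z (r : R) : 0 <= r -> cpolydisk r z -> maxabs z <= r.
Proof. by move=> r0 zr; apply: bigmax_le => // k _; exact: zr. Qed.

Lemma maxabs_ge0 z : 0 <= maxabs z.
Proof.
rewrite /maxabs; elim/big_ind: _ => [//|x y x0 y0|k _]; last exact: cabs_ge0.
by rewrite le_max x0.
Qed.

Lemma maxabs_cpolydisk z (r : R) : maxabs z <= r -> cpolydisk r z.
Proof. by move=> zr k; exact: le_trans (le_maxabs _ _) zr. Qed.

Lemma maxabsD z v (r : R) : 0 <= r -> cpolydisk r v -> maxabs (z + v) <= maxabs z + r.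
Proof.
move=> r0 vr; apply: maxabs_le => [|k]; first by rewrite addr_ge0// maxabs_ge0.
by rewrite mxE (le_trans (cabsD _ _))// lerD// le_maxabs.
Qed.

Lemma differentiable_line (F : V -> C) z v (u : C) :
  differentiable (F : V -> C^o) (z + u *: v) ->
  differentiable ((fun u => F (z + u *: v)) : C^o -> C^o) u.
Proof.
move=> dF; exact: (@differentiable_comp _ C^o V C^o (fun u => z + u *: v) F).
Qed.

End maxnorm.

Lemma rectbd_square (R : realType) (r : R) (u : R[i]) :
  rectbd (- r) r (- r) r u -> r <= cabs u.
Proof.
move=> [_ nu]; rewrite leNgt; apply/negP => ur; apply: nu.
have := le_lt_trans (cabs_re u) ur; have := le_lt_trans (cabs_im u) ur.
by rewrite !ltr_norml => /andP[? ?] /andP[? ?]; split; apply/andP.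
Qed.

(** * From the values on a small polydisk to a bound on the unit polydisk *)

Section polydisk_bound.
Context {R : realType} {n : nat}.
Local Notation C := R[i].
Local Notation V := 'rV[C]_n.+1.
Local Notation e1 := (delta_mx ord0 ord0 : V).

Lemma cpolydisk0 (r : R) : 0 <= r -> cpolydisk r (0 : V).
Proof. by move=> r0 k; rewrite mxE cabs0. Qed.

(** Any point where [g] exceeds half of its supremum serves, if the supremum is positive. If [g]
    vanishes on [K], the point is [x0], which can be chosen away from the boundary beforehand. *)
Lemma near_max (T : Type) (K : set T) (g : T -> R) (x0 : T) : K x0 ->
  (exists M, forall x, K x -> g x <= M) -> (forall x, K x -> 0 <= g x) ->
  exists2 x, K x & (x = x0 \/ 0 < g x) /\ forall y, K y -> g y <= 2 * g x.
Proof.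
move=> Kx0 [M gM] g0.
have [gx0|/existsNP[x1 /not_implyP[Kx1 /negP]]] := pselect (forall x, K x -> g x <= 0).
  exists x0 => //; split; [by left|move=> y Ky].
  by rewrite (le_trans (gx0 _ Ky))// mulr_ge0// g0.
rewrite -ltNge => gx1.
have hs : has_sup (g @` K) by split; [exists (g x0), x0|exists M => _ [x Kx <-]; exact: gM].
have s0 : 0 < sup (g @` K) by apply: lt_le_trans gx1 (ub_le_sup _ _); [case: hs|exists x1].
have [_ [x Kx <-] xs] := sup_adherent (divr_gt0 s0 (ltr0Sn R 1)) hs.
exists x => //; split; first by right; lra.
move=> y Ky; have : g y <= sup (g @` K) by apply: ub_le_sup; [case: hs|exists y].
lra.
Qed.

(* The point [z0] almost maximizes [|F z| d^(n+1)], with [d] the distance to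
   the boundary of the polydisk. This weight makes [F] bounded by a multiple of
   [|F z0|] on the polydisk of radius [d/2] around [z0], and then [F] is almost
   constant on a smaller one, by the Schwarz lemma. *)
Lemma polydisk_bound : exists eps C0 : R, [/\ 0 < eps, 0 < C0 &
  forall (F : V -> C) (m : nat),
  (forall z, cpolydisk 2 z -> differentiable (F : V -> C^o) z) -> (0 < m)%N ->
  (forall z, cpolydisk 2 z -> z ord0 ord0 = 0 -> exists B : R,
    \forall u \near (0 : C), cabs (F (z + u *: e1)) <= B * cabs u ^+ m) ->
  exists z0 d, 0 < d /\ forall z, cpolydisk (eps * d) (z - z0) ->
    cpolydisk 2 z /\ forall x, cpolydisk 1 x ->
      cabs (F x) <= cabs (x ord0 ord0) ^+ m * (C0 * d ^+ n.+1 * cabs (F z))].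
Proof.
(* For [v = z - z0] in the polydisk of radius [eps * d] and |u| at most [2 * rho], the point
   [z0 + u *: v] stays within [d / 2] of [z0], where |F| is at most [2 * 2 ^+ n.+1] times |F z0|.
   With this [rho], the Schwarz lemma gives that |F z - F z0| is at most half of |F z0|. *)
pose rho : R := 8 * 2 ^+ n.+1; pose eps : R := (4 * rho)^-1.
have p2 : (1 : R) <= 2 ^+ n.+1 by rewrite exprn_ege1// ler1n.
have rho8 : 8 <= rho by rewrite /rho; lra.
have eps0 : 0 < eps by rewrite invr_gt0; lra.
have epsE : eps * rho = 4^-1.
  by rewrite /eps invfM mulfVK// gt_eqF//; lra.
have eps1 : eps <= 1 / 2 by rewrite /eps -div1r ler_pdivrMr; [lra|lra].
have c3 : 0 < (3 / 10 : R) ^+ n.+1 by rewrite exprn_gt0; lra.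
(* The factor [4] collects a [2] from the near maximum and a [2] from the comparison of [F z0] with
   [F z]; [3 / 10] is the distance to the boundary that is kept around the unit polydisk. *)
exists eps, (4 / (3 / 10) ^+ n.+1); split=> // F m dF m0 Fm.
pose g (z : V) : R := cabs (F z) * (2 - maxabs z) ^+ n.+1.
have mx z : cpolydisk 2 z -> maxabs z <= 2 by move=> /maxabs_le; apply.
have [//|||z0 z02 [z0d gz0]] := @near_max _ (cpolydisk 2) g (0 : V).
- exact/cpolydisk0/ler0n.
- have [|M FM] := compact_locally_bounded (f := fun z => cabs (F z))
    (@compact_cpolydisk R n.+1 2).
    move=> z z2; exists (cabs (F z) + 1).
    have cF : {for z, continuous (F : V -> C^o)} by apply/differentiable_continuous/dF.
    move/cvg_cabsP: cF => /(_ 1 ltr01) cF; near=> w => _.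
    have h : cabs (F w - F z) < 1 by near: w.
    have := cabsD (F w - F z) (F z); rewrite subrK; lra.
  exists (M * 2 ^+ n.+1) => z z2; apply: ler_pM; rewrite ?cabs_ge0 ?FM//.
    by rewrite exprn_ge0// subr_ge0 mx.
  rewrite lerXn2r ?nnegrE ?subr_ge0 ?mx//.
  by rewrite lerBlDr lerDl maxabs_ge0.
- by move=> z z2; rewrite mulr_ge0 ?cabs_ge0// exprn_ge0// subr_ge0 mx.
pose d : R := 2 - maxabs z0.
have d0 : 0 < d.
  case: z0d => [z00|gz].
    have := maxabs_le (lexx 0) (cpolydisk0 (lexx (0 : R))); rewrite -z00 /d; lra.
  rewrite lt_def subr_ge0 mx// andbT; apply: contraTneq gz => d0.
  by rewrite /g -/d d0 expr0n /= mulr0 ltxx.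
exists z0, d; split=> // z zz0.
have Fbound w (r : R) : 0 < r -> maxabs w <= 2 - r ->
    cabs (F w) <= 2 * (cabs (F z0) * d ^+ n.+1) / r ^+ n.+1.
  move=> r0 wr; rewrite ler_pdivlMr ?exprn_gt0//.
  have w2 : cpolydisk 2 w by apply: maxabs_cpolydisk; lra.
  apply: le_trans (gz0 w w2); rewrite ler_wpM2l ?cabs_ge0//.
  by rewrite lerXn2r ?nnegrE ?(ltW r0)//; lra.
pose v := z - z0; have vz : z = z0 + v by rewrite /v subrKC.
have ed : eps * d <= d / 2 by have := ler_wpM2r (ltW d0) eps1; lra.
have ed0 : 0 <= eps * d by rewrite mulr_ge0// ltW.
have z2 : cpolydisk 2 z.
  apply: maxabs_cpolydisk; rewrite vz (le_trans (maxabsD _ ed0 zz0))//.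
  by rewrite /d in d0 ed *; lra.
split=> // x x1.
have FzFz0 : cabs (F z0) <= 2 * cabs (F z).
  pose f u := F (z0 + u *: v) - F z0.
  pose K := 2 * (cabs (F z0) * d ^+ n.+1) / (d / 2) ^+ n.+1.
  have KE : K = 2 * 2 ^+ n.+1 * cabs (F z0).
    rewrite /K expr_div_n; field.
    by rewrite gt_eqF ?exprn_gt0//= gt_eqF// exprn_gt0.
  have urho u : rect (- rho) rho (- rho) rho u -> maxabs (z0 + u *: v) <= 2 - d / 2.
    move=> [/andP[u1 u2] /andP[u3 u4]].
    have ur : cabs u <= 2 * rho.
      apply: le_trans (cabs_le _) _.
      have -> : 2 * rho = rho + rho by ring.
      by apply: lerD; rewrite ler_norml; lra.
    have -> : 2 - d / 2 = maxabs z0 + d / 2 by rewrite /d; field.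
    apply: maxabsD => [|k]; first by rewrite divr_ge0// ltW.
    rewrite mxE cabsM; apply: le_trans (ler_pM (cabs_ge0 _) (cabs_ge0 _) ur (zz0 k)) _.
    by rewrite mulrA -[2 * rho * eps]mulrA [rho * eps]mulrC epsE; lra.
  have df u : rect (- rho) rho (- rho) rho u -> differentiable (f : C^o -> C^o) u.
    move=> ru; apply: differentiableB; last exact: differentiable_cst.
    apply: differentiable_line; apply: dF; apply: maxabs_cpolydisk.
    by apply: le_trans (urho _ ru) _; lra.
  have f0 : f 0 = 0 by rewrite /f scale0r addr0 subrr.
  have r0 : inrect (- rho) rho (- rho) rho (0 : C) by split; apply/andP => /=; lra.
  have r00 : rect (- rho) rho (- rho) rho (0 : C) by split; apply/andP => /=; lra.
  have [l lP] := differentiable_cabsP (df 0 r00).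
  have [e e0 eP] := lP _ (@ltr01 R).
  have fz : f 1 = F z - F z0 by rewrite /f scale1r -vz.
  have : cabs (f 1) <= 2 * K / rho * cabs (1 - 0) ^+ 1.
    apply: (@schwarz _ f 0 1 (- rho) rho (- rho) rho (cabs l + 1) _ isT r0 df).
  - apply/nbhs_cabsP; exists e => // u ue; have := eP u ue; rewrite f0 !subr0 expr1.
    have := cabsD (f u - l * u) (l * u); rewrite subrK cabsM mulrDl; lra.
  - move=> u ub; rewrite subr0 expr1; have [ru _] := ub.
    have ur : rho <= cabs u.
      exact: rectbd_square.
    have fK : cabs (f u) <= 2 * K.
      rewrite /f (le_trans (cabsD _ _))// cabsN.
      have h1 := Fbound _ _ (divr_gt0 d0 (ltr0Sn R 1)) (urho _ ru).
      have h2 := Fbound _ _ (divr_gt0 d0 (ltr0Sn R 1)) (urho _ r00).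
      by rewrite scale0r addr0 in h2; rewrite -/K in h1 h2; lra.
    apply: le_trans fK _; rewrite mulrAC ler_pdivlMr; last lra.
    by rewrite ler_wpM2l//; rewrite KE; have := cabs_ge0 (F z0); nra.
  - by split; apply/andP => /=; lra.
  rewrite fz subr0 cabs1 mulr1 => h; have := cabsD (F z0 - F z) (F z); rewrite subrK (cabsB (F z0)).
  suff : 2 * K / rho = 1 / 2 * cabs (F z0) by move: h => /[swap] ->; lra.
  rewrite KE /rho; field; rewrite gt_eqF//; lra.
pose x0 := x ord0 ord0.
pose f u := F ((x - x0 *: e1) + u *: e1).
pose K := 2 * (cabs (F z0) * d ^+ n.+1) / (3 / 10) ^+ n.+1.
have lineE u k : ((x - x0 *: e1) + u *: e1) ord0 k = if k == ord0 then u else x ord0 k.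
  rewrite !mxE eqxx /=; case: eqVneq => [->|_].
    by rewrite mulr1 subrr add0r mulr1.
  by rewrite !mulr0 subr0 addr0.
(* The boundary of this square lies outside the unit disc, where [1 <= cabs u ^+ m], and its corners
   have modulus 6 sqrt(2) / 5 < 17 / 10. *)
have maxline u : rect (- (6 / 5)) (6 / 5) (- (6 / 5)) (6 / 5) u ->
    maxabs ((x - x0 *: e1) + u *: e1) <= 2 - 3 / 10.
  move=> [/andP[u1 u2] /andP[u3 u4]]; apply: maxabs_le => [|k]; first lra.
  rewrite lineE; case: ifP => _; last by apply: le_trans (x1 k) _; lra.
  have u5 : complex.Re u ^+ 2 <= (6 / 5) ^+ 2 by rewrite -subr_ge0 subr_sqr mulr_ge0//; lra.
  have u6 : complex.Im u ^+ 2 <= (6 / 5) ^+ 2 by rewrite -subr_ge0 subr_sqr mulr_ge0//; lra.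
  rewrite -ler_sqr ?nnegrE ?cabs_ge0//; last lra.
  by rewrite sqr_cabs; move: u5 u6; rewrite !expr2; lra.
have df u : rect (- (6 / 5)) (6 / 5) (- (6 / 5)) (6 / 5) u ->
    differentiable (f : C^o -> C^o) u.
  move=> ru; apply: differentiable_line; apply: dF; apply: maxabs_cpolydisk.
  by apply: le_trans (maxline _ ru) _; lra.
have r00 : rect (- (6 / 5)) (6 / 5) (- (6 / 5)) (6 / 5) (0 : C).
  by split; apply/andP => /=; lra.
have [B' B'P] : exists B, \forall u \near (0 : C), cabs (f u) <= B * cabs u ^+ m.
  apply: Fm; last by rewrite -[_ - _]addr0 -(scale0r e1) lineE.
  apply: maxabs_cpolydisk; rewrite -[_ - _]addr0 -(scale0r e1).
  by apply: le_trans (maxline _ r00) _; lra.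
have fx : f x0 = F x by rewrite /f subrK.
have x01 : cabs x0 <= 1 by exact: x1.
have Kx : cabs (F x) <= K * cabs x0 ^+ m.
  have := @schwarz _ f 0 m (- (6 / 5)) (6 / 5) (- (6 / 5)) (6 / 5) B' K m0.
  rewrite -fx -{2}[x0]subr0; apply.
  - by split; apply/andP => /=; lra.
  - exact: df.
  - by near=> u; rewrite subr0; near: u.
  - move=> u ub; have [ru _] := ub; rewrite subr0.
    have u1 : 1 <= cabs u by apply: le_trans (rectbd_square ub); lra.
    rewrite -[X in X <= _]mulr1 ler_pM ?cabs_ge0 ?exprn_ege1//.
    by apply: Fbound; [lra|exact: maxline].
  - have := cabs_re x0; have := cabs_im x0; rewrite !ler_norml => /andP[h1 h2] /andP[h3 h4].
    by split; apply/andP; lra.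
apply: le_trans Kx _; rewrite mulrC ler_wpM2l ?exprn_ge0 ?cabs_ge0//.
have -> : 4 / (3 / 10) ^+ n.+1 * d ^+ n.+1 * cabs (F z) =
  2 * (2 * cabs (F z) * d ^+ n.+1) / (3 / 10) ^+ n.+1 by ring.
rewrite /K ler_pM2r ?invr_gt0//.
have : cabs (F z0) * d ^+ n.+1 <= 2 * cabs (F z) * d ^+ n.+1.
  by rewrite ler_pM2r ?exprn_gt0.
lra.
Unshelve. all: by end_near. Qed.

End polydisk_bound.

(** * Integrals and volumes *)

Section nonmeasurable_integral.
Context d (T : measurableType d) (R : realType) (mu : {measure set T -> \bar R}).
Local Open Scope ereal_scope.
Implicit Types (D : set T) (f g : T -> \bar R).

(* The integral of a nonnegative function is a supremum over the simple
   functions below it, also when the function is not measurable. *)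
Lemma ge0_le_integralT f g : (forall x, 0 <= f x) -> (forall x, f x <= g x) ->
  \int[mu]_x f x <= \int[mu]_x g x.
Proof.
move=> f0 fg; rewrite !ge0_integralTE// => [|x]; last exact: le_trans (fg x).
apply: ge_ereal_sup => _ [h /= hf <-]; apply: ereal_sup_ubound; exists h => //= x.
exact: le_trans (fg x).
Qed.

Lemma ge0_integral_ge (D : set T) f (k : R) : measurable D ->
  (0 <= k)%R -> (forall x, 0 <= f x) -> (forall x, D x -> k%:E <= f x) ->
  k%:E * mu D <= \int[mu]_x f x.
Proof.
move=> mD k0 f0 kf; rewrite -integral_cst// integral_mkcond.
apply: ge0_le_integralT => x; rewrite patchE; case: ifPn => //.
by rewrite inE; exact: kf.
Qed.

(** The function [f] is squeezed between two measurable modifications of [g], equal to 0 and to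
    [+oo] on a null set, which have the same integral as [g]. *)
Lemma ge0_negligible_integral_eq f g : (forall x, 0 <= f x) ->
  (forall x, 0 <= g x) -> measurable_fun setT g ->
  mu.-negligible [set x | f x <> g x] -> \int[mu]_x f x = \int[mu]_x g x.
Proof.
move=> f0 g0 mg [N [mN N0 fgN]].
have gN (h : T -> \bar R) : (forall x, 0 <= h x) -> measurable_fun setT h ->
    (forall x, ~ N x -> h x = g x) -> \int[mu]_x h x = \int[mu]_x g x.
  move=> h0 mh hg; apply: ge0_ae_eq_integral => //; exists N; split => // x /= nhg.
  by apply: contrapT => Nx; apply: nhg => _; exact: hg.
have fg x : ~ N x -> f x = g x by move=> Nx; apply: contrapT => /fgN.
apply/eqP; rewrite eq_le; apply/andP; split.
  rewrite -(gN (fun x => if x \in N then +oo else g x)).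
  - apply: ge0_le_integralT => // x; case: ifPn => [_|]; first exact: leey.
    by rewrite notin_setE => /fg ->.
  - by move=> x; case: ifP.
  - apply: measurable_fun_if => //.
      by apply: (measurable_fun_bool true); rewrite setTI preimage_mem_true.
    exact: measurable_funS mg.
  - by move=> x Nx; rewrite ifN// notin_setE.
rewrite -(gN (fun x => if x \in N then 0 else g x)).
- apply: ge0_le_integralT => // x; case: ifPn => //.
  by rewrite notin_setE => /fg ->.
- by move=> x; case: ifP.
- apply: measurable_fun_if => //.
    by apply: (measurable_fun_bool true); rewrite setTI preimage_mem_true.
  exact: measurable_funS mg.
- by move=> x Nx; rewrite ifN// notin_setE.
Qed.

Lemma negligible_integral_eq f g : measurable_fun setT g ->
  mu.-negligible [set x | f x <> g x] -> \int[mu]_x f x = \int[mu]_x g x.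
Proof.
move=> mg fg; rewrite integralE [RHS]integralE; congr (_ - _).
  apply: ge0_negligible_integral_eq => //; first exact: measurable_funepos.
  by apply: negligibleS fg => x /=; apply: contra_not; rewrite !funeposE => ->.
apply: ge0_negligible_integral_eq => //; first exact: measurable_funeneg.
by apply: negligibleS fg => x /=; apply: contra_not; rewrite !funenegE => ->.
Qed.

End nonmeasurable_integral.

(** * Lebesgue measure of boxes *)

Section lebesgue_box.
Context {R : realType}.
Local Notation T := (measurableTypeR R).

Definition box (k : nat) (a : 'I_k -> R) (r : R) : set (k.-tuple T) :=
  [set t | forall i, `|tnth t i - a i| <= r].

Lemma measurable_box k (a : 'I_k -> R) r : measurable (box a r).
Proof.
rewrite (_ : box a r = \bigcap_(i in [set: 'I_k])
    ((@tnth _ T)^~ i @^-1` `[a i - r, a i + r]%classic)); last first.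
  apply/seteqP; split=> t /= tb i; last first.
    by have := tb i I; rewrite /= in_itv/= ler_distl.
  by move=> _; rewrite /= in_itv/= -ler_distl.
apply: fin_bigcap_measurable => // i _; rewrite -[X in measurable X]setTI.
exact: measurable_tnth.
Qed.

Lemma lebesgue_tuple_box k (a : 'I_k -> R) r : 0 <= r ->
  lebesgue_tuple R k (box a r) = ((2 * r) ^+ k)%:E.
Proof.
move=> r0; elim: k a => [|k IH] a.
  by rewrite /= diracE mem_set// => -[].
rewrite /= /lebesgue_cons /pushforward.
rewrite (_ : _ @^-1` _ = `[a ord0 - r, a ord0 + r]%classic `*`
    box (fun i => a (lift ord0 i)) r); last first.
  apply/seteqP; split=> -[x t] /= => [h|[h1 h2] i].
    split; first by have := h ord0; rewrite (tnth_nth 0)/= in_itv/= ler_distl.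
    by move=> i; have := h (lift ord0 i); rewrite !(tnth_nth 0)/=.
  case: (unliftP ord0 i) => [j ->|->].
    by have := h2 j; rewrite !(tnth_nth 0).
  by move: h1; rewrite in_itv/= (tnth_nth 0)/= ler_distl.
rewrite product_measure1E//=; last exact: measurable_box.
rewrite IH lebesgue_measure_itv/= lte_fin -EFinB exprS EFinM.
have -> : a ord0 + r - (a ord0 - r) = 2 * r by ring.
case: ltP => //= h; rewrite (_ : r = 0) ?mulr0//; lra.
Qed.

End lebesgue_box.

(** By the spectral theorem the determinant is the product of the eigenvalues, and each eigenvalue
    is the value of the form at a row of the unitary matrix [P]. *)
Lemma posdef_det_gt0 (C : numClosedFieldType) (n : nat) (H : 'M[C]_n) :
  map_mx Num.conj H^T = H ->
  (forall v : 'rV[C]_n, v != 0 -> 0 < (v *m H *m map_mx Num.conj v^T) ord0 ord0) ->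
  0 < \det H.
Proof.
move=> Hh Hp; have Hn : H \is normalmx by apply/normalmxP; rewrite Hh.
have U := spectral_unitarymx H; have Pu := spectral_unit H.
have HE := orthomx_spectralP Hn; set P := spectralmx H in U Pu HE.
rewrite HE !det_mulmx det_inv mulrAC mulVr -?unitmxE// mul1r det_diag.
apply: prodr_gt0 => i _.
have PP : P *m map_mx Num.conj P^T = 1%:M by apply/unitarymxP.
have ri : row i P *m map_mx Num.conj (row i P)^T = 1%:M.
  apply/matrixP => a b; rewrite !ord1 mxE.
  have := congr1 (fun A : 'M[C]_n => A i i) PP; rewrite !mxE !eqxx => <-.
  by apply: eq_bigr => k _; rewrite !mxE.
have r0 : row i P != 0.
  apply: contra_eqN ri => /eqP->; rewrite mul0mx; apply/eqP => /matrixP/(_ ord0 ord0).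
  by rewrite !mxE eqxx => /eqP; rewrite eq_sym oner_eq0.
have := Hp _ r0.
have -> : row i P *m H = spectral_diag H ord0 i *: row i P.
  rewrite {1}HE 2!mulmxA -row_mul mulmxV// row1 -rowE row_diag_mx.
  by rewrite -scalemxAl -rowE.
by rewrite -scalemxAl ri !mxE eqxx mulr1.
Qed.

(** * Continuity through charts *)

Section chart_continuity.
Context {R : realType} {n : nat} {X : ptopologicalType}.
Variable (M : complex_manifold R n X).
Local Notation C := R[i].
Local Notation V := 'rV[C]_n.
Local Notation chart := (chart R n X).

Lemma chart_continuous (Y : topologicalType) (f : X -> Y) (c : chart) x :
  cdom c x -> {for c x, continuous (f \o cinv c)} -> {for x, continuous f}.
Proof.
move=> cx fc; have fcc : {for x, continuous ((f \o cinv c) \o c)}.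
  by apply: continuous_comp => //; exact: cmap_continuous.
rewrite /prop_for /continuous_at; have <- : ((f \o cinv c) \o c) x = f x.
  by rewrite /= cmapK.
apply: cvg_trans fcc; apply: near_eq_cvg; near=> y; rewrite /= cmapK//.
by near: y; exact: open_nbhs_nbhs (conj (@cdom_open _ _ _ c) cx).
Unshelve. all: by end_near. Qed.

Lemma smooth_on_continuous (U : set X) (f : X -> R) x :
  smooth_on M U f -> U x -> {for x, continuous f}.
Proof.
move=> fU Ux; have [c cM cx] := atlas_cover M x.
by apply: (chart_continuous cx); have [+ _] := fU c cM 0%N; apply; exists x.
Qed.

Lemma holomorphic_on_continuous (U : set X) (f : X -> C) x :
  holomorphic_on M U f -> U x -> {for x, continuous f}.
Proof.
move=> fU Ux; have [c cM cx] := atlas_cover M x.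
apply: (chart_continuous cx).
apply: (@differentiable_continuous _ V C^o); apply: (fU c cM); by exists x.
Qed.

End chart_continuity.

Section complex_continuity.
Context {R : realType} {X : topologicalType}.
Local Notation C := R[i].
Implicit Types (f g : X -> C) (x : X).

Lemma continuous_of_Re_Im f x :
  {for x, continuous (fun y => complex.Re (f y))} ->
  {for x, continuous (fun y => complex.Im (f y))} -> {for x, continuous f}.
Proof.
move=> cr ci; apply/cvg_cabsP => e e0.
have e2 : 0 < e / 2 by rewrite divr_gt0.
have /cvgrPdistC_lt/(_ _ e2) nr := cr; have /cvgrPdistC_lt/(_ _ e2) ni := ci.
near=> y; apply: le_lt_trans (cabs_le _) _; rewrite !raddfB (splitr e) ltrD//.
  by near: y.
by near: y.
Unshelve. all: by end_near. Qed.

Lemma continuous_Re f x : {for x, continuous f} ->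
  {for x, continuous (fun y => complex.Re (f y))}.
Proof.
move=> /cvg_cabsP fx; apply/cvgrPdistC_lt => e /fx; apply: filterS => y.
by apply: le_lt_trans; rewrite -raddfB; exact: cabs_re.
Qed.

Lemma continuous_Im f x : {for x, continuous f} ->
  {for x, continuous (fun y => complex.Im (f y))}.
Proof.
move=> /cvg_cabsP fx; apply/cvgrPdistC_lt => e /fx; apply: filterS => y.
by apply: le_lt_trans; rewrite -raddfB; exact: cabs_im.
Qed.

Lemma continuous_sumC (I : Type) (r : seq I) (F : I -> X -> C) x :
  (forall i, {for x, continuous (F i)}) ->
  {for x, continuous (fun y => \sum_(i <- r) F i y)}.
Proof.
move=> cF; elim: r => [|i r IH].
  have -> : (fun y => \sum_(i <- [::]) F i y) = cst 0 by apply/funext => y; rewrite big_nil.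
  exact: cvg_cst.
have -> : (fun y => \sum_(j <- i :: r) F j y) = (fun y => F i y + \sum_(j <- r) F j y).
  by apply/funext => y; rewrite big_cons.
exact: (@cvgD _ C^o X (nbhs x) _ (F i) (fun y => \sum_(i <- r) F i y) _ _ (cF i) IH).
Qed.

Lemma continuous_mulC f g x : {for x, continuous f} -> {for x, continuous g} ->
  {for x, continuous (fun y => f y * g y)}.
Proof. by move=> cf cg; exact: (@cvgM _ X (nbhs x) _ f g _ _ cf cg). Qed.

Lemma continuous_prodC (I : Type) (r : seq I) (F : I -> X -> C) x :
  (forall i, {for x, continuous (F i)}) ->
  {for x, continuous (fun y => \prod_(i <- r) F i y)}.
Proof.
move=> cF; elim: r => [|i r IH].
  have -> : (fun y => \prod_(i <- [::]) F i y) = cst 1 by apply/funext => y; rewrite big_nil.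
  exact: cvg_cst.
have -> : (fun y => \prod_(j <- i :: r) F j y) = (fun y => F i y * \prod_(j <- r) F j y).
  by apply/funext => y; rewrite big_cons.
exact: (@continuous_mulC (F i) (fun y => \prod_(j <- r) F j y) x (cF i) IH).
Qed.

Lemma continuous_det (n : nat) (H : X -> 'M[C]_n) x :
  (forall i j, {for x, continuous (fun y => H y i j)}) ->
  {for x, continuous (fun y => \det (H y))}.
Proof.
move=> cH.
have -> : (fun y => \det (H y)) =
    (fun y => \sum_(s : 'S_n) (-1) ^+ s * \prod_i H y i (s i)) by [].
apply: (continuous_sumC (F := fun (s : 'S_n) y => (-1) ^+ s * \prod_i H y i (s i))) => s.
apply: (@continuous_mulC (cst ((-1) ^+ s)) (fun y => \prod_i H y i (s i))).
  exact: cvg_cst.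
exact: (continuous_prodC (F := fun i y => H y i (s i))).
Qed.

End complex_continuity.

(** * Lower bounds for the volume of coordinate cubes *)

Section volume.
Context {R : realType} {n : nat} {X : ptopologicalType}.
Variable (M : complex_manifold R n X) (hausdorffX : hausdorff_space X).
Variables (omega : hermitian_form M).
Variable (vol : {measure set (g_sigma_algebraType (@open X)) -> \bar R}).
Hypothesis volP : is_volume_measure omega vol.
Local Notation C := R[i].
Local Notation V := 'rV[C]_n.
Local Notation chart := (chart R n X).
Local Notation borelX := (g_sigma_algebraType (@open X)).

(** A product of squares instead of discs: its preimage under [complex_point] is a real [box], whose
    Lebesgue measure is explicit. *)
Definition cube (z0 : V) (r : R) : set V := [set z | forall k,
  `|complex.Re (z ord0 k) - complex.Re (z0 ord0 k)| <= r /\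
  `|complex.Im (z ord0 k) - complex.Im (z0 ord0 k)| <= r].

Lemma compact_cube z0 r : compact (cube z0 r).
Proof.
pose sq (w : C) := (fun p : R * R => (Complex p.1 p.2 : C)) @`
  (`[complex.Re w - r, complex.Re w + r]%classic `*`
   `[complex.Im w - r, complex.Im w + r]%classic).
have csq w : compact (sq w).
  apply: continuous_compact; last by apply: compact_setX; exact: segment_compact.
  by apply: continuous_subspaceT; exact: continuous_complex.
rewrite (_ : cube z0 r = [set v : V | forall i, sq (z0 ord0 i) (v ord0 i)]).
  exact: (@rV_compact C n (fun i => sq (z0 ord0 i)) (fun i => csq _)).
apply/seteqP; split=> z zz k.
  exists (complex.Re (z ord0 k), complex.Im (z ord0 k)); last by case: (z ord0 k).
  by have [h1 h2] := zz k; split; rewrite /= in_itv/= -ler_distl.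
have [[a b] [/=]] := zz k; rewrite !in_itv/= => h1 h2 <-/=.
by rewrite !ler_distl.
Qed.

Lemma compact_cinv (c : chart) (K : set V) : K `<=` c @` cdom c -> compact K ->
  compact (cinv c @` K).
Proof.
move=> Kc cK; apply: continuous_compact => //.
apply: continuous_in_subspaceT => z /set_mem/Kc[x cx <-].
exact: cinv_continuous.
Qed.

Lemma measurable_compactX (K : set borelX) : compact (K : set X) -> measurable K.
Proof.
move=> /(compact_closed hausdorffX) cK; rewrite -(setCK K); apply: measurableC.
by apply: sub_sigma_algebra; exact: closed_openC.
Qed.

Lemma det_hmat_gt0 (c : chart) x : atlas M c -> cdom c x ->
  0 < complex.Re (\det (hmat omega c x)).
Proof.
move=> cM cx; have := posdef_det_gt0 (hmat_hermitian omega cM cx)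
  (hmat_posdef omega cM cx).
by rewrite ltcE => /andP[].
Qed.

Lemma continuous_det_hmat (c : chart) x : atlas M c -> cdom c x ->
  {for x, continuous (fun y => complex.Re (\det (hmat omega c y)))}.
Proof.
move=> cM cx; apply: continuous_Re; apply: continuous_det => i j.
have [sR sI] := hmat_smooth omega cM i j.
apply: continuous_of_Re_Im; first exact: (smooth_on_continuous sR cx).
exact: (smooth_on_continuous sI cx).
Qed.

(** The density of the volume is the determinant of the Hermitian form, continuous and positive,
    hence bounded below on the compact polydisk by a constant that serves all cubes. The part of the
    manifold over a cube is compact, thus closed and Borel. *)
Lemma volume_cube (c : chart) (r : R) : atlas M c -> cpolydisk r `<=` c @` cdom c ->
  exists2 k : R, 0 < k & forall z0 (s : R), 0 <= s -> cube z0 s `<=` cpolydisk r ->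
    exists A : set borelX, [/\ measurable A,
      A = [set x | cdom c x /\ cube z0 s (c x)] &
      ((k * (2 * s) ^+ (n + n))%:E <= vol A)%E].
Proof.
move=> cM pc; pose K := cinv c @` cpolydisk r.
have cK : compact K by apply: compact_cinv => //; exact: compact_cpolydisk.
have Kc x : K x -> cdom c x.
  by move=> [z /pc[w cw <-] <-]; rewrite cmapK.
pose D x := complex.Re (\det (hmat omega c x)).
have [|B BP] := compact_locally_bounded cK (f := fun x => (D x)^-1).
  move=> x /Kc cx; exists ((D x / 2)^-1).
  have D0 : 0 < D x by exact: det_hmat_gt0.
  have /cvgrPdist_lt/(_ _ (divr_gt0 D0 (ltr0Sn R 1))) Dc := continuous_det_hmat cM cx.
  near=> y => _; have : `|D x - D y| < D x / 2 by near: y.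
  rewrite ltr_norml => /andP[_ h]; rewrite lef_pV2 ?posrE; lra.
have B1 : 0 < `|B| + 1 by rewrite ltr_wpDl.
exists (`|B| + 1)^-1 => [|z0 s s0 sr]; first by rewrite invr_gt0.
pose A : set borelX := cinv c @` cube z0 s.
have cubec : cube z0 s `<=` c @` cdom c by move=> z /sr /pc.
have mA : measurable A.
  by apply: measurable_compactX; apply: compact_cinv => //; exact: compact_cube.
have AE : A = [set x | cdom c x /\ cube z0 s (c x)].
  apply/seteqP; split=> [_ [z zs <-]|x [cx xs]].
    by have [w cw wz] := cubec _ zs; move: zs; rewrite -wz /= cmapK.
  by exists (c x) => //; rewrite cmapK.
exists A; split => //.
have Ac : A `<=` cdom c by rewrite AE => x [].
have cA : c @` A = cube z0 s.
  rewrite AE; apply/seteqP; split=> [_ [x [cx xs] <-]//|z zs].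
  by have [w cw wz] := cubec _ zs; move: zs; rewrite -wz => zs; exists w.
rewrite (volP cM mA Ac) cA.
pose a (i : 'I_(n + n)) : R := match fintype.split i with
  | inl k => complex.Re (z0 ord0 k) | inr k => complex.Im (z0 ord0 k) end.
have boxE : (@complex_point R n) @^-1` cube z0 s = box a s.
  apply/seteqP; split=> t /= h i.
    rewrite /a; case: split_ordP => k ->; have [] := h k; rewrite !mxE//=.
  by rewrite !mxE /=; have := h (lshift n i); have := h (rshift n i);
    rewrite /a -[lshift n i]/(unsplit (inl i)) -[rshift n i]/(unsplit (inr i)) !unsplitK.
rewrite boxE.
rewrite EFinM -(lebesgue_tuple_box a s0) integral_mkcond.
apply: ge0_integral_ge.
- exact: measurable_box.
- by rewrite invr_ge0 ltW.
- move=> t; rewrite patchE; case: ifPn => // /set_mem; rewrite -boxE => /cubec[x cx xE].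
  by rewrite lee_fin -xE cmapK// ltW// det_hmat_gt0.
move=> t tb; rewrite patchE mem_set// lee_fin; move: tb; rewrite -boxE => tz.
have [x cx xE] := cubec _ tz; rewrite -xE cmapK//.
have Kx : K x by exists (c x); [rewrite xE; exact: sr|rewrite cmapK].
have D0 : 0 < D x by exact: det_hmat_gt0.
rewrite -/(D x) -[D x]invrK lef_pV2 ?posrE ?invr_gt0//.
by have := BP _ Kx; have := ler_norm B; lra.
Unshelve. all: by end_near. Qed.

End volume.

(** * Sections of line bundles *)

Section section_norms.
Context {R : realType} {n : nat} {X : ptopologicalType}.
Variables (M : complex_manifold R n X) (L : line_bundle M) (h : bundle_metric L).
Local Notation C := R[i].
Implicit Types (s : local_coefs L) (x : X).

Lemma cabs_cocycle_gt0 (i j : tidx L) x : triv i x -> triv j x ->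
  0 < cabs (cocycle i j x).
Proof. by move=> xi xj; rewrite cabs_gt0 cocycle_neq0. Qed.

(** The definition refers to the frame of index [tloc L x]. In any other frame the modulus of the
    cocycle cancels against the change of weight. *)
Lemma section_normE (U : set X) s i x : holomorphic_section U s -> U x -> triv i x ->
  section_norm h s x = cabs (s i x) * expR (- weight h i x).
Proof.
move=> [_ sP] Ux xi; have xl := tlocP L x; rewrite /section_norm.
rewrite (weight_transition h xl xi) (sP _ _ _ Ux xl xi) opprB expRD.
by rewrite lnK ?posrE ?cabs_cocycle_gt0// cabsM; ring.
Qed.

Lemma section_dotE s s' i x : holomorphic_section setT s ->
  holomorphic_section setT s' -> triv i x ->
  section_dot h s s' x =
    s i x * Num.conj (s' i x) * ((expR (- 2 * weight h i x))%:C)%C.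
Proof.
move=> [_ sP] [_ s'P] xi; have xl := tlocP L x; rewrite /section_dot.
rewrite (weight_transition h xl xi) (sP _ _ _ I xl xi) (s'P _ _ _ I xl xi).
rewrite mulrBr [in RHS]expRB mulNr [in X in _ = X]mulNr.
have g0 := cabs_cocycle_gt0 xl xi; set g := cocycle _ _ _ in g0 *.
have -> : expR (- (2 * ln (cabs g))) = (cabs g ^+ 2)^-1.
  by rewrite mulr_natl -lnXn// expRN lnK// posrE exprn_gt0.
rewrite invrK [in RHS]rmorphM [in RHS]rmorphXn /= -cabsE normCK.
by rewrite [in LHS]rmorphM; ring.
Qed.

Lemma section_dot_norm s x : complex.Re (section_dot h s s x) = section_norm h s x ^+ 2.
Proof.
rewrite /section_dot /section_norm -normCK cabsE -rmorphXn -rmorphM /=.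
by rewrite exprMn -expRM_natl mulNr mulrN.
Qed.

Lemma cabs_section_dot s s' x :
  cabs (section_dot h s s' x) = section_norm h s x * section_norm h s' x.
Proof.
rewrite /section_dot /section_norm !cabsM cabs_real ger0_norm ?expR_ge0//.
have -> : cabs (Num.conj (s' (tloc L x) x)) = cabs (s' (tloc L x) x) by exact: cabs_conj.
rewrite (_ : - 2 * weight h (tloc L x) x =
  (- weight h (tloc L x) x) + (- weight h (tloc L x) x)); last by ring.
by rewrite expRD; ring.
Qed.

End section_norms.

Section borel_measurability.
Context {R : realType} {X : ptopologicalType}.
Local Notation borelX := (g_sigma_algebraType (@open X)).

Lemma open_measurableX (U : set X) : open U -> measurable (U : set borelX).
Proof. by move=> oU; exact: sub_sigma_algebra. Qed.

Lemma continuous_measurableX (U : set X) (f : X -> R) : open U ->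
  (forall x, U x -> {for x, continuous f}) -> measurable_fun (U : set borelX) f.
Proof.
move=> oU cf; apply: (measurability _ (RGenOInfty.measurableE R)) => //.
move=> _ [_ [a ->] <-]; apply: open_measurableX; rewrite openE => x [Ux /= fa].
rewrite in_itv/= andbT in fa.
apply: filterI; first exact: open_nbhs_nbhs.
apply: (cf x Ux); apply: open_nbhs_nbhs; split; first exact: rray_open.
by rewrite /= in_itv/= fa.
Qed.

End borel_measurability.

(** * The L^2 norm of a combination of orthonormal sections *)

Section line_bundle_integrals.
Context {R : realType} {n : nat} {X : ptopologicalType}.
Variables (M : complex_manifold R n X) (compactX : compact [set: X]).
Local Notation C := R[i].
Local Notation borelX := (g_sigma_algebraType (@open X)).
Variable (vol : {measure set borelX -> \bar R}).
Variables (L : line_bundle M) (h : bundle_metric L).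

(** The index [tloc L x] is an arbitrary choice, with no regularity in [x]. Measurability is
    therefore checked on fixed trivializations; a finite cover given by compactness is listed as a
    sequence. *)
Lemma countable_trivialization : exists y : nat -> X,
  forall x, exists k, triv (tloc L (y k)) x.
Proof.
have := compactX; rewrite compact_cover => /(_ X setT (fun y => triv (tloc L y))).
case=> [y _|x _|F _ FX]; first exact: triv_open.
  by exists x => //; exact: tlocP.
exists (fun k => nth point (finmap.enum_fset F) k) => x.
by have [y /= /(nthP point)[k _ <-] xy] := FX x I; exists k.
Qed.

(** Coefficients of holomorphic sections are continuous, so the exceptional set comes from the
    weights alone and serves all pairs of sections. *)
Lemma measurable_section_dot : measurable_weights h vol ->
  exists N : set borelX, [/\ measurable N, vol N = 0 &
    forall s s' : local_coefs L, holomorphic_section setT s ->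
      holomorphic_section setT s' ->
      measurable_fun (~` N) (fun x => complex.Re (section_dot h s s' x)) /\
      measurable_fun (~` N) (fun x => complex.Im (section_dot h s s' x))].
Proof.
move=> mh; have [y yP] := countable_trivialization.
have /choice[NP NPP] : forall k, exists NP : set borelX * (borelX -> R),
    [/\ measurable NP.1, vol NP.1 = 0, measurable_fun setT NP.2 &
      forall x, triv (tloc L (y k)) x -> ~ NP.1 x -> weight h (tloc L (y k)) x = NP.2 x].
  move=> k; have [psi mpsi [N [mN N0 sN]]] := mh (tloc L (y k)).
  exists (N, psi); split => // x xk Nx; apply: contrapT => ne.
  by apply: Nx; exact: sN.
have [N [mN N0 sN]] : vol.-negligible (\bigcup_k (NP k).1).
  by apply: negligible_bigcup => k; exists (NP k).1; have [? ? _ _] := NPP k; split=> // ?.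
exists N; split => // s s' hs hs'.
have DE : ~` N = \bigcup_k (triv (tloc L (y k)) `&` ~` N).
  apply/seteqP; split=> [x Nx|x [k _ []]//].
  by have [k xk] := yP x; exists k.
have mD k : measurable (triv (tloc L (y k)) `&` ~` N : set borelX).
  apply: (@measurableI _ borelX (triv (tloc L (y k))) (~` N)).
    exact: open_measurableX (triv_open _).
  exact: measurableC.
pose u k x := s (tloc L (y k)) x * Num.conj (s' (tloc L (y k)) x).
have cu k x : triv (tloc L (y k)) x -> {for x, continuous (u k)}.
  move=> xk; apply: continuous_mulC.
    by apply: (holomorphic_on_continuous (hs.1 _)).
  have cs' : {for x, continuous (s' (tloc L (y k)))}.
    by apply: (holomorphic_on_continuous (hs'.1 _)).
  apply: continuous_of_Re_Im.
    rewrite (_ : (fun _ => _) = (fun z => complex.Re (s' (tloc L (y k)) z))).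
      exact: continuous_Re.
    by apply/funext => z; case: (s' _ z).
  rewrite (_ : (fun _ => _) = (fun z => - complex.Im (s' (tloc L (y k)) z))).
    exact: (@continuousN _ R^o _ _ _ (continuous_Im cs')).
  by apply/funext => z; case: (s' _ z).
have dotE k x : (triv (tloc L (y k)) `&` ~` N) x ->
    section_dot h s s' x = u k x * ((expR (- 2 * (NP k).2 x))%:C)%C.
  move=> [xk Nx]; rewrite (section_dotE h hs hs' xk).
  have [_ _ _ ->//] := NPP k; apply: contra_not Nx => h0; apply: sN; by exists k.
have mpsi k : measurable_fun (triv (tloc L (y k)) `&` ~` N : set borelX)
    (fun x => expR (- 2 * (NP k).2 x)).
  have [_ _ mp _] := NPP k.
  apply: (@measurable_funS _ _ _ _ setT) => //.
  by apply: measurableT_comp => //; apply: measurable_funM.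
have Re_real (z : C) (r : R) : complex.Re (z * (r%:C)%C) = complex.Re z * r.
  by case: z => a b /=; rewrite mulr0 subr0.
have Im_real (z : C) (r : R) : complex.Im (z * (r%:C)%C) = complex.Im z * r.
  by case: z => a b /=; rewrite mulr0 add0r.
have sub k : (triv (tloc L (y k)) `&` ~` N : set borelX) `<=` triv (tloc L (y k)).
  by move=> x [].
split; rewrite DE; apply/measurable_fun_bigcup => // k.
  apply: (@eq_measurable_fun _ _ borelX _ _
    (fun x => complex.Re (u k x) * expR (- 2 * (NP k).2 x))).
    by move=> x /set_mem/dotE ->; rewrite Re_real.
  apply: measurable_funM => //.
  apply: (@measurable_funS _ _ _ _ (triv (tloc L (y k)) : set borelX)) => //.
    exact: open_measurableX (triv_open _).
  apply: continuous_measurableX; first exact: triv_open.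
  by move=> x /cu; exact: continuous_Re.
apply: (@eq_measurable_fun _ _ borelX _ _
  (fun x => complex.Im (u k x) * expR (- 2 * (NP k).2 x))).
  by move=> x /set_mem/dotE ->; rewrite Im_real.
apply: measurable_funM => //.
apply: (@measurable_funS _ _ _ _ (triv (tloc L (y k)) : set borelX)) => //.
  exact: open_measurableX (triv_open _).
apply: continuous_measurableX; first exact: triv_open.
by move=> x /cu; exact: continuous_Im.
Qed.

Lemma integral_off_null (N : set borelX) (f : borelX -> R) :
  measurable N -> vol N = 0 -> measurable_fun (~` N) f ->
  (\int[vol]_x (f x)%:E = \int[vol]_(x in ~` N) (f x)%:E)%E.
Proof.
move=> mN N0 mf; rewrite [RHS]integral_mkcond; apply: negligible_integral_eq.
  by apply/(measurable_restrictT _ (measurableC mN)); exact/measurable_EFinP.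
exists N; split => // x /= ne; apply: contrapT => Nx; apply: ne.
by rewrite patchE mem_set.
Qed.

(* Since [fine] of an infinite integral is [0], the normalization of the [S j]
   makes them square integrable. *)
Lemma orthonormal_integral (d : nat) (S : 'I_d -> local_coefs L) (a : 'I_d -> C) :
  measurable_weights h vol ->
  (forall j, holomorphic_section setT (S j)) ->
  (forall j k, inner_product h vol (S j) (S k) = (j == k)%:R) ->
  (\int[vol]_x (section_norm h (fun i x => \sum_j a j * S j i x)%R x ^+ 2)%:E =
   (\sum_j cabs (a j) ^+ 2)%:E)%E.
Proof.
move=> mh hS ort; have [N [mN N0 mdot]] := measurable_section_dot mh.
pose D := ~` N; have mD : measurable D by exact: measurableC.
pose r j k (x : borelX) : R := complex.Re (section_dot h (S j) (S k) x).
pose q j k (x : borelX) : R := complex.Im (section_dot h (S j) (S k) x).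
have mr j k : measurable_fun D (r j k) by have [] := mdot _ _ (hS j) (hS k).
have mq j k : measurable_fun D (q j k) by have [] := mdot _ _ (hS j) (hS k).
have rI j k : \int[vol]_(x in D) r j k x = (j == k)%:R.
  rewrite /Rintegral -integral_off_null//.
  have := congr1 (@complex.Re R) (ort j k); rewrite /inner_product /= /Rintegral => ->.
  by case: (j == k).
have qI j k : \int[vol]_(x in D) q j k x = 0.
  rewrite /Rintegral -integral_off_null//.
  have := congr1 (@complex.Im R) (ort j k); rewrite /inner_product /= /Rintegral => ->.
  by case: (j == k).
have rjj j x : r j j x = section_norm h (S j) x ^+ 2 by exact: section_dot_norm.
have irjj j : vol.-integrable D (EFin \o r j j).
  apply/integrableP; split; first exact/measurable_EFinP.
  rewrite (eq_integral (EFin \o r j j)); last first.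
    by move=> x _ /=; rewrite ger0_norm// rjj sqr_ge0.
  have := rI j j; rewrite eqxx /Rintegral.
  case: (integral _ _ _) => [v _|/= /eqP|/= /eqP]; first exact: ltry.
    by rewrite eq_sym oner_eq0.
  by rewrite eq_sym oner_eq0.
(* Mixed products are dominated through |S_j| |S_k| <= |S_j|^2 + |S_k|^2, whose right side is
   integrable by [irjj]. *)
have ijk (f : borelX -> R) j k : measurable_fun D f ->
    (forall x, `|f x| <= cabs (section_dot h (S j) (S k) x)) ->
    vol.-integrable D (EFin \o f).
  move=> mf fle.
  have ii : vol.-integrable D ((EFin \o r j j) \+ (EFin \o r k k))%E by exact: integrableD.
  apply: (le_integrable mD _ _ ii); first exact/measurable_EFinP.
  move=> x _ /=; rewrite lee_fin (le_trans (fle x))// cabs_section_dot !rjj.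
  move: (section_norm _ _ _) (section_norm _ _ _) => u v.
  apply: le_trans (ler_norm _).
  by have := sqr_ge0 (u - v); have := sqr_ge0 (u + v); nra.
have ir j k : vol.-integrable D (EFin \o r j k).
  by apply: ijk => // x; exact: cabs_re.
have iq j k : vol.-integrable D (EFin \o q j k).
  by apply: ijk => // x; exact: cabs_im.
pose b j k := a j * Num.conj (a k).
pose g j k (x : borelX) : R := complex.Re (b j k) * r j k x - complex.Im (b j k) * q j k x.
have normE x : section_norm h (fun i x => \sum_j a j * S j i x) x ^+ 2 =
    \sum_j \sum_k g j k x.
  rewrite -section_dot_norm /section_dot rmorph_sum big_distrl /= mulr_suml raddf_sum.
  apply: eq_bigr => j _; rewrite mulr_sumr mulr_suml raddf_sum; apply: eq_bigr => k _.
  rewrite /g /r /q /b /section_dot rmorphM.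
  set e := ((expR _)%:C)%C; set u := S j _ _; set v := Num.conj (S k _ _).
  have -> : a j * u * (Num.conj (a k) * v) * e = (a j * Num.conj (a k)) * (u * v * e).
    by ring.
  by move: (_ * Num.conj _) (u * v * e) => [? ?] [? ?].
have ig j k : vol.-integrable D (EFin \o g j k).
  rewrite (_ : EFin \o g j k = ((fun x => (complex.Re (b j k))%:E * (r j k x)%:E) \-
    (fun x => (complex.Im (b j k))%:E * (q j k x)%:E))%E)//.
  by apply: integrableB => //; apply: integrableZl => //; [exact: ir|exact: iq].
have Ig j k : (\int[vol]_(x in D) (g j k x)%:E = ((j == k)%:R * complex.Re (b j k))%:E)%E.
  have fi : (\int[vol]_(x in D) (g j k x)%:E)%E \is a fin_num by exact: integrable_fin_num (ig j k).
  rewrite -(fineK fi); congr EFin; rewrite -/(Rintegral vol D (g j k)).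
  have izr : vol.-integrable D (EFin \o (fun x => complex.Re (b j k) * r j k x)).
    exact: integrableZl (ir j k).
  have izq : vol.-integrable D (EFin \o (fun x => complex.Im (b j k) * q j k x)).
    exact: integrableZl (iq j k).
  have irjk := ir j k; have iqjk := iq j k.
  rewrite /g RintegralB// !RintegralZl//.
  by rewrite rI qI mulr0 subr0 mulrC.
rewrite (integral_off_null mN N0); last first.
  apply: (@eq_measurable_fun _ _ borelX _ _ (fun x => \sum_j \sum_k g j k x)).
    by move=> x _; rewrite normE.
  apply: measurable_sum => j; apply: measurable_sum => k.
  by apply/measurable_EFinP; exact: measurable_int (ig j k).
under eq_integral do rewrite normE -sumEFin.
under eq_integral do under eq_bigr do rewrite -sumEFin.
rewrite integral_sum//; last by move=> j; apply: integrable_sum => // k _; exact: ig.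
rewrite -sumEFin; apply: eq_bigr => j _.
rewrite integral_sum//; last by move=> k; exact: ig.
rewrite (bigD1 j)//= big1 ?adde0 => [|k kj]; last first.
  by rewrite Ig eq_sym (negbTE kj) mul0r.
by rewrite Ig eqxx mul1r /b -normCK cabsE -rmorphXn.
Qed.

End line_bundle_integrals.

Lemma near_eq_differentiable (K : numFieldType) (V W : normedModType K)
    (f g : V -> W) (x : V) :
  (\forall y \near x, f y = g y) -> differentiable f x -> differentiable g x.
Proof.
move=> fg df; have fgx := nbhs_singleton fg.
have dg : g \o shift x = cst (g x) + 'd f x +o_ (0 : V) id.
  apply/eqaddoP => e e0; have /diff_locally/eqaddoP/(_ e e0) dfe := df.
  have : \forall h \near (0 : V), f (h + x) = g (h + x).
    by move: fg; rewrite (near_shift 0 x) /=; apply: filterS => h; rewrite subr0.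
  apply: filterS2 dfe => h /= + fgh.
  by rewrite !fctE /= -fgh -fgx.
have cd : continuous ('d f x) by exact: diff_continuous.
by apply/diff_locallyP; rewrite (diff_unique cd dg).
Qed.

(** * Coefficients of sections in a holomorphic frame *)

Section charts.
Context {R : realType} {n : nat} {X : ptopologicalType}.
Variable (M : complex_manifold R n.+1 X).
Local Notation C := R[i].
Local Notation V := 'rV[C]_n.+1.
Local Notation chart := (chart R n.+1 X).
Implicit Types (c : chart) (x : X).

Lemma cinv_cdom c z : (c @` cdom c) z -> cdom c (cinv c z).
Proof. by move=> [x cx <-]; rewrite cmapK. Qed.

Lemma cinvK c z : (c @` cdom c) z -> c (cinv c z) = z.
Proof. by move=> [x cx <-]; rewrite cmapK. Qed.

Lemma near_cdom c x : cdom c x -> \forall z \near c x, (c @` cdom c) z.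
Proof.
by move=> cx; apply: open_nbhs_nbhs; split; [exact: cimg_open|exists x].
Qed.

Lemma near_cinv c x (U : set X) : cdom c x -> open U -> U x ->
  \forall z \near c x, U (cinv c z).
Proof.
move=> cx oU Ux; apply: (cinv_continuous cx); rewrite cmapK//.
exact: open_nbhs_nbhs.
Qed.

Lemma holomorphic_on_differentiable (U : set X) (f : X -> C) c x :
  holomorphic_on M U f -> atlas M c -> U x -> cdom c x ->
  differentiable (f \o cinv c : V -> C^o) (c x).
Proof. by move=> fU cM Ux cx; apply: (fU c cM); exists x. Qed.

Variable (L : line_bundle M).

(* The coefficient of a section of [L^p] in the frame [e^p]. *)
Definition frame_coef (p : nat) (e : local_coefs L)
    (s : local_coefs (tensor_power L p)) (x : X) : C :=
  s (tloc L x) x / e (tloc L x) x ^+ p.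

Variables (p : nat) (c : chart) (e : local_coefs L).
Hypotheses (cM : atlas M c) (eP : holomorphic_frame (cdom c) e).
Implicit Types (s : local_coefs (tensor_power L p)).

Lemma frame_coefE s i x : holomorphic_section setT s -> cdom c x ->
  triv i x -> frame_coef e s x = s i x / e i x ^+ p.
Proof.
move=> [_ sP] cx xi; have xl := tlocP L x; rewrite /frame_coef.
rewrite (sP _ _ _ I xl xi) (eP.1.2 _ _ _ cx xl xi) /= exprMn.
have g0 := cocycle_neq0 xl xi; have e0 := eP.2 _ _ cx xi.
by field; rewrite !expf_neq0.
Qed.

Lemma frame_coef_differentiable s x : holomorphic_section setT s -> cdom c x ->
  differentiable (frame_coef e s \o cinv c : V -> C^o) (c x).
Proof.
move=> hs cx; pose i := tloc L x; have xi : triv i x := tlocP L x.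
apply: (@near_eq_differentiable _ _ _
  (fun z => (s i \o cinv c) z * ((e i \o cinv c) z ^+ p)^-1)).
  have := near_cinv cx (triv_open i) xi; have := near_cdom cx.
  apply: filterS2 => z cz zi.
  by rewrite /= (frame_coefE hs (cinv_cdom cz) zi).
apply: (@differentiableM _ V (s i \o cinv c) (fun z => ((e i \o cinv c) z ^+ p)^-1)).
  exact: (holomorphic_on_differentiable (hs.1 i)).
apply: (@differentiableV _ V (fun z => (e i \o cinv c) z ^+ p)).
  by apply: differentiable_pow; exact: (holomorphic_on_differentiable (eP.1.1 i)).
by rewrite /= cmapK// expf_neq0// eP.2.
Qed.

Lemma section_norm_frame (h : bundle_metric L) s x : cdom c x ->
  section_norm (metric_power h p) s x =
    cabs (frame_coef e s x) * expR (- p%:R * frame_weight h e x).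
Proof.
move=> cx; have e0 : 0 < cabs (e (tloc L x) x).
  by rewrite cabs_gt0; apply: eP.2 => //; exact: tlocP.
rewrite /frame_weight /section_norm /frame_coef /= cabsM cabsV cabsX mulrN mulNr opprK.
rewrite expRM_natl lnK ?posrE ?mulr_gt0 ?expR_gt0// exprMn -mulrN expRM_natl.
by field; rewrite gt_eqF// exprn_gt0.
Qed.

End charts.

Lemma continuous_bounded (R : realType) (T : topologicalType) (f : T -> R[i]) x :
  {for x, continuous f} -> \forall y \near x, cabs (f y) <= cabs (f x) + 1.
Proof.
move=> /cvg_cabsP/(_ 1 ltr01); apply: filterS => y fyx.
by have := cabsD (f y - f x) (f x); rewrite subrK; lra.
Qed.

(** * Vanishing along the hypersurface in an adapted chart *)

Section bergman_local.
Context {R : realType} {n : nat} {X : ptopologicalType}.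
Variables (M : complex_manifold R n.+1 X).
Local Notation C := R[i].
Local Notation V := 'rV[C]_n.+1.
Local Notation chart := (chart R n.+1 X).
Local Notation e1 := (delta_mx ord0 ord0 : V).
Variables (Sigma : set X) (c : chart).
Hypotheses (cS : adapted_chart M Sigma c).

Lemma adapted_Sigma (z : V) : (c @` cdom c) z -> z ord0 ord0 = 0 -> Sigma (cinv c z).
Proof.
move=> cz z0; have : (Sigma `&` cdom c) (cinv c z).
  by rewrite cS.2 /= cinvK//; split => //; exact: cinv_cdom.
by case.
Qed.

Lemma line_continuous (z v : V) : {for (0 : C), continuous (fun u : C => z + u *: v)}.
Proof.
apply: (@differentiable_continuous _ C^o V).
by apply: differentiableD; first exact: differentiable_cst.
Qed.

(** Along the line through [z] in the direction [e1] the first coordinate is [u] itself. The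
    quotient of the section by its power [m] is continuous, hence bounded near [x], and the frame is
    bounded away from 0 there. This is the condition at the center that the Schwarz lemma
    requires. *)
Lemma frame_coef_vanishing (L : line_bundle M) (p m : nat) (e : local_coefs L)
    (s : local_coefs (tensor_power L p)) (z : V) :
  holomorphic_frame (cdom c) e -> holomorphic_section setT s ->
  vanishes_to_order Sigma m s -> (c @` cdom c) z -> z ord0 ord0 = 0 ->
  exists B : R, \forall u \near (0 : C),
    cabs ((frame_coef e s \o cinv c) (z + u *: e1)) <= B * cabs u ^+ m.
Proof.
move=> eP hs vs cz z0; set x := cinv c z.
have cx : cdom c x by exact: cinv_cdom.
have zE : c x = z by exact: cinvK.
pose i := tloc L x; have xi : triv i x := tlocP L x.
have [U [f [oU Ux Uc hf sf]]] := vs i c x cS (adapted_Sigma cz z0) cx xi.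
have fc : {for x, continuous f} by exact: holomorphic_on_continuous hf _.
have ec : {for x, continuous (e i)}.
  by apply: (holomorphic_on_continuous (eP.1.1 i)).
have e0 : 0 < cabs (e i x) by rewrite cabs_gt0 eP.2.
have near_e : \forall y \near x, cabs (e i x) / 2 <= cabs (e i y).
  have /cvg_cabsP/(_ _ (divr_gt0 e0 (ltr0Sn R 1))) := ec; apply: filterS => y.
  by have := cabsD (e i x - e i y) (e i y); rewrite subrK (cabsB (e i x)); lra.
exists ((cabs (f x) + 1) / (cabs (e i x) / 2) ^+ p).
have lc : (fun u : C => z + u *: e1) @ (0 : C) --> c x.
  by have := @line_continuous z e1; rewrite /prop_for /continuous_at scale0r addr0 zE.
have cl : (fun u : C => cinv c (z + u *: e1)) @ (0 : C) --> x.
  have := cinv_continuous cx; rewrite /prop_for /continuous_at cmapK//.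
  by apply: cvg_comp lc.
have nU : \forall y \near x, U y by exact: open_nbhs_nbhs.
have nx : \forall y \near x, [/\ U y, cabs (f y) <= cabs (f x) + 1 &
    cabs (e i x) / 2 <= cabs (e i y)].
  have nf := continuous_bounded fc.
  by apply: filterS3 nU nf near_e => y ? ? ?; split.
have nl : \forall u \near (0 : C), (c @` cdom c) (z + u *: e1).
  exact: lc _ (near_cdom cx).
have nc : \forall u \near (0 : C), let y := cinv c (z + u *: e1) in
    [/\ U y, cabs (f y) <= cabs (f x) + 1 & cabs (e i x) / 2 <= cabs (e i y)].
  exact: cl _ nx.
apply: filterS2 nc nl => u [Uy fy ey] cu /=.
have [cy yi] := Uc _ Uy.
rewrite (frame_coefE eP hs cy yi) (sf _ Uy) cinvK//.
have -> : (z + u *: e1) ord0 ord0 = u by rewrite !mxE z0 add0r mulr1.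
rewrite -mulrA cabsM cabsX [leRHS]mulrC ler_wpM2l ?exprn_ge0 ?cabs_ge0//.
have ey0 : 0 < cabs (e i x) / 2 by rewrite divr_gt0.
rewrite cabsM cabsV cabsX ler_pM ?cabs_ge0 ?invr_ge0 ?exprn_ge0 ?cabs_ge0//.
rewrite lef_pV2 ?posrE ?exprn_gt0// ?(lt_le_trans ey0)//.
by rewrite lerXn2r ?nnegrE ?cabs_ge0 ?(ltW ey0).
Qed.

End bergman_local.

Lemma cube_sub_cpolydisk (R : realType) (n : nat) (z0 z : 'rV[R[i]]_n) (r : R) :
  cube z0 r z -> cpolydisk (2 * r) (z - z0).
Proof.
move=> zr k; have [h1 h2] := zr k; rewrite !mxE.
by apply: le_trans (cabs_le _) _; rewrite !raddfB; lra.
Qed.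

Lemma cabs_sum (R : rcfType) (d : nat) (f : 'I_d -> R[i]) :
  cabs (\sum_j f j) <= \sum_j cabs (f j).
Proof.
elim/big_ind2 : _ => [|x1 x2 y1 y2 h1 h2|//]; first by rewrite cabs0.
exact: le_trans (cabsD _ _) (lerD h1 h2).
Qed.

Lemma measurable_metric_power (R : realType) (n : nat) (X : ptopologicalType)
    (M : complex_manifold R n X) (L : line_bundle M) (h : bundle_metric L)
    (vol : {measure set (g_sigma_algebraType (@open X)) -> \bar R}) (p : nat) :
  measurable_weights h vol -> measurable_weights (metric_power h p) vol.
Proof.
move=> mh i; have [psi mpsi npsi] := mh i.
exists (fun x => p%:R * psi x); first exact: measurable_funM.
by apply: negligibleS npsi => x /= [xi ne]; split=> // e; apply: ne; rewrite e.
Qed.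

(** * The Bergman kernel estimate in one adapted chart *)

Section bergman_local.
Context {R : realType} {n : nat} {X : ptopologicalType}.
Variables (M : complex_manifold R n.+1 X).
Hypotheses (hausdorffX : hausdorff_space X) (compactX : compact [set: X]).
Variables (omega : hermitian_form M).
Variable (vol : {measure set (g_sigma_algebraType (@open X)) -> \bar R}).
Hypothesis volP : is_volume_measure omega vol.
Local Notation C := R[i].
Local Notation V := 'rV[C]_n.+1.
Local Notation chart := (chart R n.+1 X).
Local Notation e1 := (delta_mx ord0 ord0 : V).
Variables (Sigma : set X) (c : chart).
Hypotheses (cS : adapted_chart M Sigma c) (c2 : cpolydisk 2 `<=` c @` cdom c).

(* The sections [S j] are combined into the one that nearly attains the maximum
   of [|S x| / ||S||], with coefficients the conjugates of the values at [x]. *)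
Lemma bergman_local : exists2 B : R, 0 < B &
  forall (L : line_bundle M) (h : bundle_metric L) (e : local_coefs L) (Phi : R)
    (p m d : nat) (S : 'I_d -> local_coefs (tensor_power L p)),
  measurable_weights h vol -> holomorphic_frame (cdom c) e ->
  (forall x, cdom c x -> cpolydisk 2 (c x) -> `|frame_weight h e x| <= Phi) ->
  (0 < m)%N -> (forall j, holomorphic_section setT (S j)) ->
  (forall j, vanishes_to_order Sigma m (S j)) ->
  (forall j k, inner_product (metric_power h p) vol (S j) (S k) = (j == k)%:R) ->
  forall x, cdom c x -> cpolydisk 1 (c x) ->
  bergman_kernel h S x <=
    B * cabs (c x ord0 ord0) ^+ (2 * m) * expR (4 * p%:R * Phi).
Proof.
have cM := cS.1.
have [eps [C0 [eps0 C00 polyP]]] := @polydisk_bound R n.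
have [k k0 kP] := volume_cube hausdorffX volP cM c2.
pose N := (n.+1 + n.+1)%N.
exists (C0 ^+ 2 / (k * eps ^+ N)) => [|L h e Phi p m d S mh eP Phib m0 hS vS ort x cx x1].
  by rewrite divr_gt0 ?mulr_gt0 ?exprn_gt0.
pose sg j := frame_coef e (S j) \o cinv c.
pose a j := Num.conj (sg j (c x)).
pose F (z : V) := \sum_j a j * sg j z.
have dF z : cpolydisk 2 z -> differentiable (F : V -> C^o) z.
  move=> z2; rewrite (_ : F = \sum_j (fun z => a j * sg j z)); last first.
    by apply/funext => w; rewrite fct_sumE.
  apply: differentiable_sum => j.
  apply: (@differentiableM _ V (cst (a j)) (sg j)); first exact: differentiable_cst.
  by rewrite -(cinvK (c2 z2)); apply: frame_coef_differentiable => //; exact/cinv_cdom/c2.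
have vF z : cpolydisk 2 z -> z ord0 ord0 = 0 -> exists B : R,
    \forall u \near (0 : C), cabs (F (z + u *: e1)) <= B * cabs u ^+ m.
  move=> z2 z0.
  have /choice[B BP] : forall j, exists B : R, \forall u \near (0 : C),
      cabs (sg j (z + u *: e1)) <= B * cabs u ^+ m.
    by move=> j; apply: (frame_coef_vanishing cS eP (hS j) (vS j) (c2 z2) z0).
  exists (\sum_j cabs (a j) * B j).
  have FB : \forall u \near (0 : C),
      forall j, cabs (sg j (z + u *: e1)) <= B j * cabs u ^+ m.
    exact: (@filter_forall _ _ _ (nbhs (0 : C))).
  apply: filterS FB => u Bu; rewrite /F mulr_suml.
  apply: le_trans (cabs_sum _) _; apply: ler_sum => j _.
  by rewrite cabsM -mulrA ler_wpM2l ?cabs_ge0.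
have [z0 [dd [dd0 z0P]]] := polyP F m dF m0 vF.
pose tau := cabs (c x ord0 ord0) ^+ m * (C0 * dd ^+ n.+1).
have tauP z : cpolydisk (eps * dd) (z - z0) -> cabs (F (c x)) <= tau * cabs (F z).
  by move=> /z0P[_ /(_ _ x1)]; rewrite /tau -!mulrA.
have tau0 : 0 <= tau.
  by rewrite !mulr_ge0 ?exprn_ge0 ?cabs_ge0// ltW.
(* By the choice of the coefficients, [P0] is both the value of [F] at [c x] and the squared L^2
   norm of the combined section. *)
pose P0 := \sum_j cabs (sg j (c x)) ^+ 2.
have P00 : 0 <= P0 by apply: sumr_ge0 => j _; rewrite sqr_ge0.
have FE : cabs (F (c x)) = P0.
  rewrite /F (_ : \sum_j a j * sg j (c x) = (P0%:C)%C) ?cabs_real ?ger0_norm//.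
  rewrite rmorph_sum; apply: eq_bigr => j _.
  by rewrite /a mulrC -normCK cabsE -rmorphXn.
(* The modulus is at most the sum of the moduli of the real and imaginary parts, so a cube of
   half-side [s] lies in the polydisk of radius [2 * s]. *)
pose s := eps * dd / 2.
have s0 : 0 <= s by rewrite divr_ge0// mulr_ge0// ltW.
have s2 : 2 * s = eps * dd by rewrite /s; field.
have cubep : cube z0 s `<=` (fun z => cpolydisk (eps * dd) (z - z0)).
  by move=> z /cube_sub_cpolydisk; rewrite s2.
have [|A [mA AE volA]] := kP z0 s s0; first by move=> z /cubep /z0P[].
have normE x' : cdom c x' ->
    section_norm (metric_power h p) (fun i x => \sum_j a j * S j i x) x' =
    cabs (F (c x')) * expR (- p%:R * frame_weight h e x').
  move=> cx'; rewrite (section_norm_frame eP)//; congr (cabs _ * _).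
  rewrite /frame_coef mulr_suml; apply: eq_bigr => j _.
  by rewrite /sg /= cmapK// /frame_coef mulrA.
have kernE : bergman_kernel h S x = P0 * expR (- 2 * p%:R * frame_weight h e x).
  rewrite /bergman_kernel /P0 mulr_suml; apply: eq_bigr => j _.
  rewrite (section_norm_frame eP)// exprMn -expRM_natl /sg /= cmapK//.
  by congr (_ * expR _); ring.
have Phix := Phib x cx.
have {}Phix : `|frame_weight h e x| <= Phi.
  by apply: Phix => l; apply: le_trans (x1 l) _; rewrite ler1n.
have Phi0 : 0 <= Phi by exact: le_trans Phix.
have kern_le : bergman_kernel h S x <= P0 * expR (2 * p%:R * Phi).
  rewrite kernE ler_wpM2l// ler_expR.
  have : - frame_weight h e x <= Phi by move: Phix; rewrite ler_norml; lra.
  by move=> /(ler_wpM2l (mulr_ge0 (ler0n R 2) (ler0n R p))); lra.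
have main : P0 <= cabs (c x ord0 ord0) ^+ (2 * m) * (C0 ^+ 2 / (k * eps ^+ N)) *
    expR (2 * p%:R * Phi).
  have [->|P0n] := eqVneq P0 0.
    rewrite mulr_ge0 ?expR_ge0// mulr_ge0 ?exprn_ge0 ?cabs_ge0// ltW//.
    by rewrite divr_gt0 ?mulr_gt0 ?exprn_gt0.
  have {}P0n : 0 < P0 by rewrite lt_def P0n.
  have tau1 : 0 < tau.
    rewrite lt_def tau0 andbT; apply: contraTneq P0n => tau_eq.
    have := tauP z0; rewrite subrr tau_eq mul0r FE -leNgt; apply.
    by apply: cpolydisk0; rewrite mulr_ge0// ltW.
  (* [l] is a lower bound on [A] for the squared pointwise norm of the combined section, whose
     integral is [P0]. *)
  pose l := P0 ^+ 2 * expR (- (2 * p%:R * Phi)) / tau ^+ 2.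
  have l0 : 0 <= l by rewrite !mulr_ge0 ?sqr_ge0 ?expR_ge0 ?invr_ge0 ?sqr_ge0.
  have := orthonormal_integral compactX a (@measurable_metric_power _ _ _ _ _ _ _ p mh) hS ort.
  move=> intE.
  have lb : (l%:E * vol A <= P0%:E)%E.
    have -> : P0 = \sum_j cabs (a j) ^+ 2.
      by apply: eq_bigr => j _; rewrite /a (cabs_conj (sg j (c x))).
    rewrite -intE; apply: ge0_integral_ge => // [x'|x'].
      by rewrite lee_fin sqr_ge0.
    rewrite AE => -[cx' xs]; rewrite lee_fin normE// exprMn.
    rewrite /l ler_pdivrMr ?exprn_gt0// -FE.
    have Fle := tauP _ (cubep _ xs).
    apply: (@le_trans _ _ ((tau * cabs (F (c x'))) ^+ 2 * expR (- (2 * p%:R * Phi)))).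
      rewrite ler_wpM2r ?expR_ge0//.
      by rewrite ler_sqr ?nnegrE ?cabs_ge0// (mulr_ge0 tau0)// cabs_ge0.
    rewrite exprMn -[X in X <= _]mulrA [X in _ <= X]mulrC; apply: ler_wpM2l; first exact: sqr_ge0.
    apply: ler_wpM2l; first exact: sqr_ge0.
    rewrite -expRM_natl ler_expR.
    have Phix' : `|frame_weight h e x'| <= Phi.
      by apply: Phib => //; have [] := z0P _ (cubep _ xs).
    have : frame_weight h e x' <= Phi by move: Phix'; rewrite ler_norml; lra.
    by move=> /(ler_wpM2l (mulr_ge0 (ler0n R 2) (ler0n R p))); lra.
  have : l * (k * (eps * dd) ^+ N) <= P0.
    rewrite -lee_fin EFinM; apply: le_trans lb; apply: lee_wpmul2l => //.
    by rewrite -s2.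
  rewrite /l /tau expRN => h1.
  (* The power of [dd] in the volume of the cube equals the one in [tau ^+ 2], so [dd] cancels from
     the estimate. *)
  have dE : dd ^+ N = (dd ^+ n.+1) ^+ 2 by rewrite -exprM muln2 -addnn.
  have xE : cabs (c x ord0 ord0) ^+ (2 * m) = (cabs (c x ord0 ord0) ^+ m) ^+ 2.
    by rewrite mulnC exprM.
  have edE : (eps * dd) ^+ N = eps ^+ N * (dd ^+ n.+1) ^+ 2 by rewrite exprMn dE.
  move: h1 tau1; rewrite edE xE /tau.
  set X0 := cabs _ ^+ m; set D := dd ^+ n.+1; set E := eps ^+ N; set G := expR _.
  move=> h1 tau1.
  have D0 : 0 < D by rewrite exprn_gt0.
  have E0 : 0 < E by rewrite exprn_gt0.
  have G0 : 0 < G by exact: expR_gt0.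
  have X00 : 0 < X0 by move: tau1; rewrite pmulr_lgt0// mulr_gt0.
  have h2 : P0 * (P0 * (k * E) / (G * (X0 * C0) ^+ 2)) <= P0 * 1.
    rewrite mulr1; apply: le_trans h1; rewrite le_eqVlt; apply/orP; left; apply/eqP.
    by field; rewrite !gt_eqF.
  have den : 0 < G * (X0 * C0) ^+ 2 by rewrite mulr_gt0// exprn_gt0// mulr_gt0.
  move: h2; rewrite (ler_pM2l P0n) (ler_pdivrMr _ _ den) mul1r => h2.
  rewrite -(ler_pM2r (mulr_gt0 k0 E0)); apply: le_trans h2 _.
  by rewrite le_eqVlt; apply/orP; left; apply/eqP; field; rewrite !gt_eqF.
apply: le_trans kern_le _.
apply: le_trans (ler_wpM2r (expR_ge0 _) main) _.
have -> : expR (4 * p%:R * Phi) = expR (2 * p%:R * Phi) * expR (2 * p%:R * Phi).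
  by rewrite -expRD; congr expR; ring.
by rewrite le_eqVlt; apply/orP; left; apply/eqP; ring.
Qed.

End bergman_local.

(** * The first coordinate against a function vanishing to first order *)

Section coordinate_bound.
Context {R : realType} {n : nat}.
Local Notation C := R[i].
Local Notation V := 'rV[C]_n.+1.
Local Notation e1 := (delta_mx ord0 ord0 : V).
Implicit Types (G : V -> C) (z w v : V).

Lemma nbhs_cpolydiskP z (P : V -> Prop) :
  (\forall w \near z, P w) <->
  exists2 d : R, 0 < d & forall w, cpolydisk d (w - z) -> P w.
Proof.
split.
  move=> /nbhs_ballP[e /= e0 eP]; have [eE re0] := lec0E e0.
  exists (complex.Re e / 2) => [|w zw]; first by rewrite divr_gt0.
  apply: eP; split=> // i j; rewrite !ord1 /ball/= eE cabsE ltcR cabsB.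
  have := zw j; rewrite !mxE => /le_lt_trans; apply; lra.
move=> [d d0 dP]; apply/nbhs_ballP; exists (d%:C)%C => /=; first by rewrite ltcR.
move=> w [_ zw]; apply: dP => k; rewrite !mxE ltW// -ltcR -cabsE distrC.
exact: zw.
Qed.

Lemma differentiable_lineP G z v : differentiable (G : V -> C^o) z ->
  forall e : R, 0 < e -> \forall u \near (0 : C),
    cabs (G (z + u *: v) - G z - u * 'd (G : V -> C^o) z v) <= e * cabs u.
Proof.
move=> dG e e0; have /diff_locally/eqaddoP dGe := dG.
have v1 : 0 < `|v| + 1 :> C by rewrite ltr_wpDl.
have [vE rv0] := lec0E v1; set rv := complex.Re _ in vE rv0.
have e' : 0 < ((e / rv)%:C)%C :> C by rewrite ltcR divr_gt0.
have cl : (fun u : C => u *: v) @ (0 : C) --> (0 : V).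
  rewrite -[X in _ --> X](scale0r v).
  by apply: (@differentiable_continuous _ C^o V).
have near_le : \forall u \near (0 : C),
    `|((G : V -> C^o) \o shift z - (cst (G z : C^o) + 'd (G : V -> C^o) z)) (u *: v)| <=
      ((e / rv)%:C)%C * `|u *: v|.
  exact: cl _ (dGe _ e').
apply: filterS near_le => u /=.
rewrite !fctE /= [_ + z]addrC linearZ /= normrZ !cabsE => le1.
have : cabs (G (z + u *: v) - (G z + u * 'd (G : V -> C^o) z v)) <= e / rv * cabs u * rv.
  rewrite -lecR; apply: le_trans le1 _.
  rewrite [leRHS]rmorphM [X in _ <= X * _]rmorphM /= -[leRHS]mulrA.
  rewrite ler_wpM2l ?lecR ?divr_ge0 ?(ltW e0) ?(ltW rv0)//.
  by rewrite ler_wpM2l ?lecR ?cabs_ge0// -vE lerDl.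
by rewrite opprD addrA mulrAC divfK// gt_eqF.
Qed.

Lemma diff_zero_direction G z v : differentiable (G : V -> C^o) z -> G z = 0 ->
  (\forall u \near (0 : C), G (z + u *: v) = 0) -> 'd (G : V -> C^o) z v = 0.
Proof.
move=> dG Gz0 G0; apply/eqP; rewrite -cabs_eq0 eq_le cabs_ge0 andbT.
apply/ler_addgt0Pl => e e0; rewrite addr0.
have := differentiable_lineP v dG e0 => dl.
have /nbhs_cabsP[d d0 dP] : \forall u \near (0 : C), G (z + u *: v) = 0 /\
    cabs (G (z + u *: v) - G z - u * 'd (G : V -> C^o) z v) <= e * cabs u.
  by near=> u; split; near: u.
have [|Gu] := dP ((d / 2)%:C)%C.
  by rewrite subr0 cabs_real ger0_norm; lra.
rewrite Gu Gz0 subr0 sub0r cabsN cabsM mulrC ler_pM2r//.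
by rewrite cabs_real gtr0_norm; lra.
Unshelve. all: by end_near. Qed.

(* On each line parallel to the first axis, the Schwarz lemma compares
   [G (w' + u e1)] with the linear function [u * beta]. *)
Lemma coordinate_bound G z v : z ord0 ord0 = 0 ->
  (\forall w \near z, differentiable (G : V -> C^o) w) ->
  (\forall w \near z, (w : V) ord0 ord0 = 0 -> G w = 0) ->
  'd (G : V -> C^o) z v != 0 ->
  exists B : R, \forall w \near z, cabs ((w : V) ord0 ord0) <= B * cabs (G w).
Proof.
move=> z0 dG G0 dv.
have [d d0 dP] : exists2 d : R, 0 < d & forall w, cpolydisk d (w - z) ->
    differentiable (G : V -> C^o) w /\ (w ord0 ord0 = 0 -> G w = 0).
  by apply/nbhs_cpolydiskP; near=> w; split; near: w.
have zz : cpolydisk d (z - z) by rewrite subrr; exact/cpolydisk0/ltW.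
have dGz := (dP _ zz).1; have Gz0 := (dP _ zz).2 z0.
pose b := 'd (G : V -> C^o) z e1.
have b0 : 0 < cabs b.
  (* Since [G] vanishes where the first coordinate does, its differential vanishes on
     [v - v ord0 ord0 *: e1]; hence a nonzero value at [v] forces a nonzero value at [e1]. *)
  rewrite cabs_gt0; apply: contra_neq dv => be0.
  have -> : v = (v - v ord0 ord0 *: e1) + v ord0 ord0 *: e1 by rewrite subrK.
  have be : 'd (G : V -> C^o) z e1 = 0 by exact: be0.
  rewrite linearD [X in _ + X]linearZ /= be scaler0 addr0.
  apply: diff_zero_direction => //.
  have : \forall u \near (0 : C), G (z + u *: (v - v ord0 ord0 *: e1)) = 0.
    have cl : (fun u : C => z + u *: (v - v ord0 ord0 *: e1)) @ (0 : C) --> z.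
      have := @line_continuous R n z (v - v ord0 ord0 *: e1).
      by rewrite /prop_for /continuous_at scale0r addr0.
    have nl : \forall u \near (0 : C), (z + u *: (v - v ord0 ord0 *: e1)) ord0 ord0 = 0 ->
        G (z + u *: (v - v ord0 ord0 *: e1)) = 0 by exact: cl _ G0.
    apply: filterS nl => u; apply.
    by rewrite !mxE z0 !eqxx mulr1 subrr mulr0 addr0.
  exact.
have b4 : 0 < cabs b / 4 by rewrite divr_gt0.
have /nbhs_cabsP[r1 r10 r1P] := differentiable_lineP e1 dGz b4.
pose r := Num.min d r1 / 8.
have dr0 : 0 < Num.min d r1 by rewrite lt_min d0.
have r0 : 0 < r by rewrite divr_gt0.
have [rd rr1] : 8 * r <= d /\ 8 * r <= r1.
  have -> : 8 * r = Num.min d r1 by rewrite /r; field.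
  by rewrite !ge_min !lexx orbT.
have eta0 : 0 < cabs b * r / 8 by rewrite divr_gt0// mulr_gt0.
have lineE w u k : (w - w ord0 ord0 *: e1 + u *: e1) ord0 k =
    if k == ord0 then u else w ord0 k.
  rewrite !mxE eqxx /=; case: eqVneq => [->|_].
    by rewrite mulr1 subrr add0r mulr1.
  by rewrite !mulr0 subr0 addr0.
have lined w u : cpolydisk d (w - z) -> cabs u <= d ->
    cpolydisk d ((w - w ord0 ord0 *: e1 + u *: e1) - z).
  move=> wz ud k; rewrite mxE lineE mxE; case: eqVneq => [->|_].
    by rewrite z0 subr0.
  by have := wz k; rewrite !mxE.
have zline u : z + u *: e1 = z - z ord0 ord0 *: e1 + u *: e1.
  by rewrite z0 scale0r subr0.
(* Compactness of the disc makes the neighborhood of [z] uniform in [u]: [G] on the line through [w]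
   is close to [G] on the line through [z]. *)
have close : \forall w \near z, [set u : C | cabs u <= 2 * r] `<=`
    [set u | cabs (G ((w : V) - w ord0 ord0 *: e1 + u *: e1) - G (z + u *: e1)) < cabs b * r / 4].
  have /compact_near_coveringP/near_covering_withinP cD := @compact_disc R (2 * r).
  apply: (cD V (nbhs z) (fun w u => cabs (G ((w : V) - w ord0 ord0 *: e1 + u *: e1) -
    G (z + u *: e1)) < cabs b * r / 4)) => u0 /= u0r.
  have dq : differentiable (G : V -> C^o) (z + u0 *: e1).
    by rewrite zline; apply: (dP _ _).1; apply: lined => //; lra.
  have Gc : {for (z + u0 *: e1), continuous (G : V -> C^o)}.
    exact: differentiable_continuous.
  have /nbhs_cpolydiskP[dq1 dq10 dq1P] :
      \forall w \near z + u0 *: e1, cabs (G w - G (z + u0 *: e1)) < cabs b * r / 8.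
    by move/cvg_cabsP : Gc; apply.
  have nu : \forall u \near u0, cabs (u - u0) < dq1 by apply/nbhs_cabsP; exists dq1.
  have nw : \forall w \near z, cpolydisk dq1 (w - z) by apply/nbhs_cpolydiskP; exists dq1.
  near=> u w => _ /=.
  have uu0 : cabs (u - u0) < dq1 by near: u.
  have wz : cpolydisk dq1 (w - z) by near: w.
  have pd w' : cpolydisk dq1 (w' - z) ->
      cpolydisk dq1 ((w' - w' ord0 ord0 *: e1 + u *: e1) - (z + u0 *: e1)).
    move=> w'z k; rewrite zline mxE lineE mxE lineE; case: eqVneq => [_|_]; first exact: ltW.
    by have := w'z k; rewrite !mxE.
  have zz1 : cpolydisk dq1 (z - z) by rewrite subrr; exact/cpolydisk0/ltW.
  have h1 := dq1P _ (pd w wz); have h2 := dq1P _ (pd z zz1).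
  rewrite -zline in h2.
  apply: le_lt_trans (cabsD3 _ (G (z + u0 *: e1)) _) _.
  by rewrite (cabsB (G (z + u0 *: e1)) (G (z + u *: e1))); lra.
(* The Schwarz lemma will bound |G w - b w_1| by |b| |w_1| / 2, whence |G w| is at least |b| |w_1| /
   2. *)
exists (2 / cabs b).
have nd : \forall w \near z, cpolydisk d (w - z) by apply/nbhs_cpolydiskP; exists d.
have nr : \forall w \near z, cpolydisk r (w - z) by apply/nbhs_cpolydiskP; exists r.
near=> w; have wd : cpolydisk d (w - z) by near: w.
have wr : cpolydisk r (w - z) by near: w.
have wc : [set u : C | cabs u <= 2 * r] `<=`
    [set u | cabs (G ((w : V) - w ord0 ord0 *: e1 + u *: e1) - G (z + u *: e1)) < cabs b * r / 4].
  by near: w.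
pose g u := G (w - w ord0 ord0 *: e1 + u *: e1) - b * u.
have rect2 u : rect (- r) r (- r) r u -> cabs u <= 2 * r.
  move=> [/andP[u1 u2] /andP[u3 u4]]; apply: le_trans (cabs_le _) _.
  have -> : 2 * r = r + r by ring.
  by apply: lerD; rewrite ler_norml; lra.
have dg u : rect (- r) r (- r) r u -> differentiable (g : C^o -> C^o) u.
  move=> /rect2 ur; apply: differentiableB.
    by apply: differentiable_line; apply: (dP _ _).1; apply: lined => //; lra.
  by apply: differentiableM; [exact: differentiable_cst|exact: ex_diff].
have r00 : rect (- r) r (- r) r (0 : C) by split; apply/andP => /=; lra.
have g0 : g 0 = 0.
  rewrite /g mulr0 subr0; apply: (dP _ _).2; last by rewrite lineE.
  by apply: lined => //; rewrite cabs0 ltW.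
have [l lP] := differentiable_cabsP (dg 0 r00).
have [e e0 eP] := lP _ (@ltr01 R).
have w0r : cabs (w ord0 ord0) <= r by have := wr ord0; rewrite !mxE z0 subr0.
(* On the boundary of the square [r <= cabs u], so the closeness of the two lines and the
   differentiability at [z] each contribute at most |b| |u| / 4. *)
have : cabs (g (w ord0 ord0)) <= cabs b / 2 * cabs (w ord0 ord0 - 0) ^+ 1.
  apply: (@schwarz _ g 0 1 (- r) r (- r) r (cabs l + 1) _ isT _ dg).
  - by split; apply/andP => /=; lra.
  - apply/nbhs_cabsP; exists e => // u ue; have := eP u ue; rewrite g0 !subr0 expr1.
    have := cabsD (g u - l * u) (l * u); rewrite subrK cabsM mulrDl; lra.
  - move=> u ub; have [ru _] := ub; have ur := rectbd_square ub; rewrite subr0 expr1.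
    have u2 := rect2 _ ru.
    have h1 := wc u u2; rewrite /= in h1.
    have := r1P u; rewrite subr0 Gz0 subr0 -/b [u * b]mulrC => /(_ _) h2.
    have {}h2 : cabs (G (z + u *: e1) - b * u) <= cabs b / 4 * cabs u.
      by apply: h2; apply: le_lt_trans u2 _; lra.
    apply: le_trans (cabsD3 _ (G (z + u *: e1)) _) _.
    have : cabs b * r <= cabs b * cabs u by rewrite ler_pM2l.
    lra.
  - have := cabs_re (w ord0 ord0); have := cabs_im (w ord0 ord0).
    rewrite !ler_norml => /andP[h1 h2] /andP[h3 h4].
    by split; apply/andP; lra.
rewrite subr0 expr1 /g subrK => gw.
have := cabsD (b * w ord0 ord0 - G w) (G w); rewrite subrK cabsB cabsM.
rewrite mulrAC ler_pdivlMr// => h; move: gw; lra.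
Unshelve. all: by end_near. Qed.

End coordinate_bound.

(** * Consequences of compactness for metrics and weights *)

Section metrics.
Context {R : realType} {n : nat} {X : ptopologicalType}.
Variables (M : complex_manifold R n.+1 X).
Local Notation C := R[i].
Local Notation V := 'rV[C]_n.+1.
Local Notation chart := (chart R n.+1 X).
Implicit Types (L : line_bundle M) (c : chart) (x : X).

Lemma near_triv L (i : tidx L) x : triv i x -> \forall y \near x, triv i y.
Proof. by move=> xi; apply: open_nbhs_nbhs; split => //; exact: triv_open. Qed.

Lemma section_norm_continuous L (h : bundle_metric L) (s : local_coefs L) x :
  holomorphic_section setT s -> smooth_metric h ->
  {for x, continuous (section_norm h s)}.
Proof.
move=> hs sh; pose i := tloc L x; have xi : triv i x := tlocP L x.
pose g y := cabs (s i y) * expR (- weight h i y).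
have cg : {for x, continuous g}.
  have cs : {for x, continuous (s i)}.
    by apply: (holomorphic_on_continuous (hs.1 i)).
  have cw : {for x, continuous (weight h i)} by exact: smooth_on_continuous (sh i) xi.
  apply: (@continuousM _ X (fun y => cabs (s i y)) (fun y => expR (- weight h i y))).
    by apply: continuous_comp => //; exact: continuous_cabs.
  apply: (continuous_comp (f := fun y => - weight h i y)).
    exact: (@continuousN _ R^o).
  exact: continuous_expR.
rewrite /prop_for /continuous_at (section_normE h hs I xi) -/(g x).
apply: cvg_trans cg; apply: near_eq_cvg; near=> y.
have yi : triv i y by near: y; exact: near_triv.
by rewrite (section_normE h hs I yi).
Unshelve. all: by end_near. Qed.

Lemma compact_chart_polydisk c (r r' : R) : cpolydisk r `<=` c @` cdom c -> r' <= r ->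
  compact [set x | cdom c x /\ cpolydisk r' (c x)].
Proof.
move=> rc rr'; have r'c : cpolydisk r' `<=` c @` cdom c.
  by move=> z zr; apply: rc => k; exact: le_trans (zr k) rr'.
rewrite (_ : mkset _ = cinv c @` cpolydisk r').
  by apply: compact_cinv => //; exact: compact_cpolydisk.
apply/seteqP; split=> [x [cx xr]|_ [z zr <-]].
  by exists (c x) => //; rewrite cmapK.
by split; [exact/cinv_cdom/r'c|rewrite cinvK//; exact: r'c].
Qed.

(** Ensures that the suprema in [sup_norm] are taken over bounded sets; otherwise [sup] would return
    a default value. *)
Lemma frame_weight_bounded L (h : bundle_metric L) (e : local_coefs L) c :
  locally_bounded_weights h -> holomorphic_frame (cdom c) e ->
  cpolydisk 2 `<=` c @` cdom c ->
  exists B, forall x, cdom c x -> cpolydisk 2 (c x) -> `|frame_weight h e x| <= B.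
Proof.
move=> bh eP c2.
have cK := compact_chart_polydisk c2 (lexx 2).
have [|B BP] := compact_locally_bounded cK (f := fun x => `|frame_weight h e x|).
  move=> x [cx _]; pose i := tloc L x; have xi : triv i x := tlocP L x.
  have [m mP] := bh i x xi.
  have e0 : 0 < cabs (e i x) by rewrite cabs_gt0 eP.2.
  have ec : {for x, continuous (e i)} by apply: (holomorphic_on_continuous (eP.1.1 i)).
  have lc : {for x, continuous (fun y => ln (cabs (e i y)))}.
    apply: (continuous_comp (f := fun y => cabs (e i y))).
      by apply: continuous_comp => //; exact: continuous_cabs.
    exact: continuous_ln.
  have /cvgrPdistC_lt/(_ _ ltr01) lc1 := lc.
  exists (`|ln (cabs (e i x))| + 1 + m); near=> y => -[cy _].
  have yi : triv i y by near: y; exact: near_triv.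
  have ym : `|weight h i y| <= m by near: y.
  have yl : `|ln (cabs (e i y)) - ln (cabs (e i x))| < 1 by near: y.
  have ey : 0 < cabs (e i y) by rewrite cabs_gt0 eP.2.
  rewrite /frame_weight (section_normE h eP.1 cy yi) lnM ?posrE ?expR_gt0// expRK.
  have := ler_normD (ln (cabs (e i y)) - ln (cabs (e i x))) (ln (cabs (e i x))).
  rewrite subrK normrN; have := ler_normB (ln (cabs (e i y))) (weight h i y); lra.
by exists B => x cx x2; apply: BP.
Unshelve. all: by end_near. Qed.

(** Serves the finitely many [p] below the threshold 2/t, to which the exponential estimate does not
    apply. *)
Lemma bergman_kernel_locally_bounded L (h : bundle_metric L) (p d : nat)
    (S : 'I_d -> local_coefs (tensor_power L p)) x :
  locally_bounded_weights h -> (forall j, holomorphic_section setT (S j)) ->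
  exists B, \forall y \near x, bergman_kernel h S y <= B.
Proof.
move=> bh hS; pose i := tloc L x; have xi : triv i x := tlocP L x.
have [m mP] := bh i x xi.
exists (\sum_j ((cabs (S j i x) + 1) * expR (p%:R * m)) ^+ 2).
have Sb j : \forall y \near x, cabs (S j i y) <= cabs (S j i x) + 1.
  by apply: continuous_bounded; apply: (holomorphic_on_continuous ((hS j).1 i)).
have {}Sb : \forall y \near x, forall j, cabs (S j i y) <= cabs (S j i x) + 1.
  exact: (@filter_forall _ _ _ (nbhs x)).
near=> y; apply: ler_sum => j _.
have yi : triv i y by near: y; exact: near_triv.
have ym : `|weight h i y| <= m by near: y.
have Sy : forall j, cabs (S j i y) <= cabs (S j i x) + 1 by near: y.
have h0 : 0 <= section_norm (metric_power h p) (S j) y.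
  by rewrite /section_norm mulr_ge0 ?cabs_ge0 ?expR_ge0.
rewrite lerXn2r ?nnegrE ?mulr_ge0 ?expR_ge0 ?addr_ge0 ?cabs_ge0//.
rewrite (section_normE (metric_power h p) (hS j) I yi).
apply: ler_pM; rewrite ?cabs_ge0 ?expR_ge0 ?Sy// ler_expR /= -mulrN ler_wpM2l//.
by move: ym; rewrite ler_norml; lra.
Unshelve. all: by end_near. Qed.

(** Off [Sigma] the norm is positive and continuous, hence locally bounded below. At a point of
    [Sigma] the local coefficient of the section has a nonzero differential, and [coordinate_bound]
    applies to it. *)
Lemma coordinate_le_section_norm (Sigma : set X) (E : line_bundle M)
    (h : bundle_metric E) (s : local_coefs E) c :
  canonical_section Sigma s -> smooth_metric h -> adapted_chart M Sigma c ->
  cpolydisk 2 `<=` c @` cdom c ->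
  exists B, forall x, cdom c x -> cpolydisk 1 (c x) ->
    cabs (c x ord0 ord0) <= B * section_norm h s x.
Proof.
move=> [hs s0 ds] sh cS c2; have cM := cS.1.
have norm0 x : 0 <= section_norm h s x by rewrite mulr_ge0 ?cabs_ge0 ?expR_ge0.
have cK := compact_chart_polydisk c2 (ler1n R 2).
have [|B BP] := compact_locally_dominated norm0 cK (f := fun x => cabs (c x ord0 ord0)).
  move=> x [cx _]; pose i := tloc E x; have xi : triv i x := tlocP E x.
  have [xS|xS] := pselect (Sigma x); last first.
    have nx : 0 < section_norm h s x.
      rewrite mulr_gt0 ?expR_gt0// cabs_gt0; apply/eqP => sx; apply: xS.
      by apply/(s0 i x xi).
    exists (2 / section_norm h s x).
    have nc : {for x, continuous (section_norm h s)} by exact: section_norm_continuous.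
    have := nc.
    move=> /cvgrPdist_lt/(_ _ (divr_gt0 nx (ltr0Sn R 1))); apply: filterS => y.
    rewrite ltr_norml => /andP[_ ny] [cy y1]; apply: le_trans (y1 ord0) _.
    by rewrite mulrAC ler_pdivlMr//; lra.
  have [v dv] := ds i c x cM xi cx xS.
  pose G := s i \o cinv c.
  have x0 : c x ord0 ord0 = 0.
    have : (Sigma `&` cdom c) x by [].
    by rewrite cS.2 => -[].
  have ncx := near_cdom cx; have nti := near_cinv cx (triv_open i) xi.
  have [||B BP] := @coordinate_bound R n G (c x) v x0 _ _ dv.
  - apply: filterS2 ncx nti => w cw wi; rewrite -(cinvK cw).
    by apply: (holomorphic_on_differentiable (hs.1 i)) => //; exact: cinv_cdom.
  - apply: filterS2 ncx nti => w cw wi w0; apply/(s0 i _ wi).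
    exact: (adapted_Sigma cS).
  have cw : {for x, continuous (weight h i)} by exact: smooth_on_continuous (sh i) xi.
  have ce : {for x, continuous (fun y => expR (weight h i y))}.
    by apply: continuous_comp => //; exact: continuous_expR.
  have /cvgrPdistC_lt/(_ _ ltr01) ce1 := ce.
  have nc : \forall y \near x, cabs (c y ord0 ord0) <= B * cabs (G (c y)).
    exact: (cmap_continuous cx) BP.
  have nd : \forall y \near x, cdom c y.
    by apply: open_nbhs_nbhs; split => //; exact: cdom_open.
  exists (`|B| * (expR (weight h i x) + 1)); near=> y => _.
  have yi : triv i y by near: y; exact: near_triv.
  have cy : cdom c y by near: y.
  have ye : `|expR (weight h i y) - expR (weight h i x)| < 1 by near: y.
  have yB : cabs (c y ord0 ord0) <= B * cabs (G (c y)) by near: y.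
  apply: le_trans yB _; rewrite /G /= cmapK//.
  have -> : cabs (s i y) = expR (weight h i y) * section_norm h s y.
    by rewrite (section_normE h hs I yi) mulrCA -expRD subrr expR0 mulr1.
  rewrite mulrA ler_wpM2r// (le_trans (ler_wpM2r (expR_ge0 _) (ler_norm B)))//.
  by rewrite ler_wpM2l//; move: ye; rewrite ltr_norml; lra.
by exists B => x cx x1; apply: BP.
Unshelve. all: by end_near. Qed.

End metrics.

(** * The decay of the Bergman kernel *)

Section decay.
Context {R : realType}.
Implicit Types (a t r : R).

(** With y = a p / (l + 1), the claim reduces to y^l <= e^((l + 1) y). The denominator l + 1 also
    covers l = 0, and the maximum with 1/2 keeps the logarithm of [b] meaningful when [r] is 0. *)
Lemma geometric_decay r (l : nat) : 0 <= r -> r < 1 ->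
  exists2 B, 0 < B & forall p : nat, (0 < p)%N -> r ^+ p <= B * p%:R ^- l.
Proof.
move=> r0 r1; pose b := Num.max r (1 / 2).
have b0 : 0 < b by rewrite lt_max; apply/orP; right; lra.
have b1 : b < 1 by rewrite gt_max r1 /=; lra.
have rb : r <= b by rewrite le_max lexx.
pose a := - ln b; have a0 : 0 < a by rewrite oppr_gt0 ln_lt0// b0.
have l0 : (0 : R) < l.+1%:R by rewrite ltr0n.
exists ((a / l.+1%:R) ^- l); first by rewrite invr_gt0 exprn_gt0// divr_gt0.
move=> p p0; apply: (@le_trans _ _ (b ^+ p)).
  by rewrite lerXn2r ?nnegrE// ltW.
have p0R : (0 : R) < p%:R by rewrite ltr0n.
have ap : 0 < a / l.+1%:R * p%:R by rewrite mulr_gt0// divr_gt0.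
rewrite -invfM -exprMn -[b]lnK ?posrE// -expRM_natl -[ln b]opprK -/a mulrN expRN.
rewrite lef_pV2 ?posrE ?expR_gt0 ?exprn_gt0//.
have -> : p%:R * a = l.+1%:R * (a / l.+1%:R * p%:R) by field; rewrite gt_eqF.
rewrite expRM_natl exprS; move: ap; set y := a / _ * _ => ap.
have e1 := expR_ge1Dx y; have e0 : y <= expR y by lra.
have e2 : 1 <= expR y by lra.
rewrite -[leLHS]mul1r; apply: ler_pM => //; first by rewrite exprn_ge0// ltW.
by rewrite lerXn2r ?nnegrE ?expR_ge0// ltW.
Qed.

(** Here [A1] is at most its power t p, since t p >= 1. The other factor [u = A2 * N] is at most 1,
    and t p > 2 gives 2 floor(t p) > 2 (t p - 1) > t p. *)
Lemma absorb_constants (A1 A2 N t : R) (p : nat) : 1 <= A1 -> 0 <= A2 ->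
  0 <= N -> 0 < t -> A1 * A2 * N < 1 -> 2 < t * p%:R ->
  A1 * (A2 * N) ^+ (2 * Num.truncn (t * p%:R)) <= ((A1 * A2 * N) `^ t) ^+ p.
Proof.
move=> A11 A20 N0 t0 AN1 tp.
set m := Num.truncn (t * p%:R); pose u := A2 * N.
have u0 : 0 <= u by rewrite mulr_ge0.
have A10 : 0 <= A1 by lra.
have [mt tm] : m%:R <= t * p%:R /\ t * p%:R < m.+1%:R.
  by apply/andP; apply: truncn_itv; lra.
have m2 : t * p%:R <= (2 * m)%:R.
  by rewrite natrM; move: tm; rewrite -natr1; lra.
rewrite -/u -[A1 * A2 * N]mulrA -/u in AN1 *.
rewrite -[leRHS]powR_mulrn ?powR_ge0// -powRrM powRM//.
(* The comparison of exponents requires a positive base; in the application [u = 0] at the points of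
   [Sigma]. *)
have [u00|un0] := eqVneq u 0.
  have m1 : (0 < 2 * m)%N by rewrite -(ltr0n R); lra.
  by rewrite u00 expr0n eqn0Ngt m1 mulr0 mulr_ge0// powR_ge0.
have up : 0 < u by rewrite lt_def un0.
have u1 : u <= 1.
  by apply: le_trans (ltW AN1); rewrite ler_peMl.
apply: ler_pM => //; first exact: exprn_ge0.
  by apply: le1r_powR => //; lra.
by rewrite -powR_mulrn// ger_powR// up.
Qed.

End decay.

Theorem corollary3p3 (R : realType) (n : nat) (X : ptopologicalType)
  (M : complex_manifold R n.+1 X)
  (hausdorffX : hausdorff_space X) (compactX : compact [set: X])
  (omega : hermitian_form M)
  (vol : {measure set (g_sigma_algebraType (@open X)) -> \bar R})
  (volP : is_volume_measure omega vol)
  (Sigma : set X) (SigmaP : smooth_hypersurface M Sigma)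
  (rho : X -> \bar R) (rhoP : is_log_norm M Sigma rho)
  (rho_lt0 : forall x, (rho x < 0)%E)
  (N : nat) (W : 'I_N -> chart R n.+1 X) (y : 'I_N -> X)
  (WP : good_cover M Sigma W y) :
  exists2 A : R, 1 <= A &
    forall (t : R) (t_gt0 : 0 < t)
      (L : line_bundle M) (h : bundle_metric L)
      (h_measurable : measurable_weights h vol)
      (h_bounded : locally_bounded_weights h)
      (e : 'I_N -> local_coefs L)
      (eP : forall j, holomorphic_frame (cdom (W j)) (e j)),
    let q (x : X) : R :=
      (A * fine (expeR (rho x))) `^ t * expR (4 * sup_norm h W y e) in
    let U : set X :=
      [set x | (\bigcup_j polydisk (W j) (y j) 1) x /\ q x < 1] in
    (forall (p d : nat) (S : 'I_d -> local_coefs (tensor_power L p)),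
       orthonormal_basis vol Sigma t h S ->
       forall x, U x -> 2 * t^-1 < p%:R -> bergman_kernel h S x <= q x ^+ p)
    /\
    (forall (d : nat -> nat)
            (S : forall p, 'I_(d p) -> local_coefs (tensor_power L p)),
       (forall p, (0 < p)%N -> orthonormal_basis vol Sigma t h (S p)) ->
       O_pinfty U (fun p => bergman_kernel h (S p))).
Proof.
have [E [hE [s [sP sE rhoE]]]] := rhoP.
pose nrm := section_norm hE s.
have nrm0 x : 0 <= nrm x by rewrite mulr_ge0 ?cabs_ge0 ?expR_ge0.
(* This includes the points of [Sigma], where [rho] is [-oo] and both sides are 0. *)
have expE x : fine (expeR (rho x)) = nrm x.
  by rewrite rhoE lneK// in_itv/= lee_fin nrm0 leey.
have nrm_cont x : {for x, continuous nrm}.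
  by have [hs _ _] := sP; exact: section_norm_continuous.
have W0 j : W j (y j) = 0 by have [] := cover_center WP j.
have polyE j r : polydisk (W j) (y j) r = [set x | cdom (W j) x /\ cpolydisk r (W j x)].
  apply/seteqP; split=> x [cx xr]; split=> // k; have := xr k;
  by rewrite W0 !mxE subr0.
have c2 j : cpolydisk 2 `<=` W j @` cdom (W j).
  have h : polydisk_in_chart (W j) (y j) 2 by case: WP.
  move=> z z2; apply: h => k.
  by rewrite W0 mxE subr0.
have BE j := cid2 (bergman_local hausdorffX compactX volP (cover_adapted WP j) (@c2 j)).
pose B j := s2val (BE j).
have AE j := cid (coordinate_le_section_norm sP sE (cover_adapted WP j) (@c2 j)).
pose A j := sval (AE j).
(* The sums dominate the constants of all the charts at once, and the terms [1] ensure
   [1 <= A1 * A2], also for an empty cover. *)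
pose A1 := 1 + \sum_j B j; pose A2 := 1 + \sum_j `|A j|.
have B0 j : 0 <= B j by exact/ltW/(s2valP (BE j)).
have BA1 j : B j <= A1.
  rewrite /A1 (bigD1 j)//= addrCA lerDl addr_ge0//; apply: sumr_ge0 => k _; exact: B0.
have AA2 j : `|A j| <= A2.
  by rewrite /A2 (bigD1 j)//= addrCA lerDl addr_ge0//; apply: sumr_ge0.
have A11 : 1 <= A1 by rewrite lerDl sumr_ge0.
have A21 : 1 <= A2 by rewrite lerDl sumr_ge0.
have A20 : 0 <= A2 by lra.
have A0 : 0 <= A1 * A2 by apply: mulr_ge0 => //; lra.
exists (A1 * A2); first by rewrite -[leLHS]mulr1 ler_pM.
move=> t t0 L h mh bh e eP.
set Phi := sup_norm h W y e.
pose q x := (A1 * A2 * nrm x) `^ t * expR (4 * Phi).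
have qE x : (A1 * A2 * fine (expeR (rho x))) `^ t * expR (4 * Phi) = q x by rewrite expE.
move=> q' U; have q'E x : q' x = q x by rewrite /q' qE.
have Phi1 : 1 <= Phi.
  by rewrite /Phi /sup_norm; elim/big_rec : _ => // j b _ b1; rewrite le_max b1 orbT.
have PhiP j x : cdom (W j) x -> cpolydisk 2 (W j x) -> `|frame_weight h (e j) x| <= Phi.
  move=> cx x2; apply: (@bigmax_sup _ _ _ _ j) => //; apply: ub_le_sup.
    have [b bP] := frame_weight_bounded bh (eP j) (@c2 j).
    by exists b => _ [w + <-]; rewrite polyE => -[cw w2]; exact: bP.
  by exists x => //; rewrite polyE.
(* Since [expR (4 * Phi)] is at least 1, the condition [q x < 1] bounds the power alone and then its
   base, as [absorb_constants] requires. *)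
have AN1 x : q x < 1 -> A1 * A2 * nrm x < 1.
  move=> qx; rewrite ltNge; apply/negP => AN.
  have p1 : 1 <= (A1 * A2 * nrm x) `^ t.
    have := @ge0_ler_powR R t (ltW t0) 1 (A1 * A2 * nrm x).
    by rewrite powR1 !nnegrE; apply => //; apply: le_trans AN.
  have e1 : 1 <= expR (4 * Phi) by rewrite -[leLHS]expR0 ler_expR; lra.
  by move: qx; rewrite ltNge -[X in X <= _]mulr1 ler_pM.
have main p d (S : 'I_d -> local_coefs (tensor_power L p)) :
    orthonormal_basis vol Sigma t h S -> forall x, U x -> 2 * t^-1 < p%:R ->
    bergman_kernel h S x <= q x ^+ p.
  move=> [HS ort _] x [[j _]]; rewrite q'E polyE => -[cx x1] qx tp.
  have {}tp : 2 < t * p%:R by rewrite mulrC -ltr_pdivrMr.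
  have m0 : (0 < Num.truncn (t * p%:R))%N by rewrite truncn_gt0; lra.
  apply: le_trans (s2valP' (BE j) L h (e j) Phi p _ d S mh (eP j) (PhiP j) m0
    (fun j => (HS j).1) (fun j => (HS j).2) ort x cx x1) _.
  have xA : cabs (W j x ord0 ord0) <= A2 * nrm x.
    apply: le_trans (svalP (AE j) x cx x1) _; rewrite ler_wpM2r//.
    exact: le_trans (ler_norm _) (AA2 j).
  rewrite /q exprMn; apply: ler_pM.
  - exact: (mulr_ge0 (B0 j) (exprn_ge0 _ (cabs_ge0 _))).
  - exact: expR_ge0.
  - apply: le_trans (absorb_constants A11 A20 (nrm0 x) t0 (AN1 x qx) tp).
    rewrite -/(B j); apply: ler_pM => //; first by rewrite exprn_ge0// cabs_ge0.
    by rewrite lerXn2r ?nnegrE ?cabs_ge0// mulr_ge0.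
  - by rewrite -expRM_natl ler_expR le_eqVlt; apply/orP; left; apply/eqP; ring.
split=> [p d S ort x Ux tp|d S ort K cK KU l]; first by rewrite q'E; exact: main.
have [K0|/set0P Kn0] := eqVneq K set0.
  by exists 1 => // p _ x; rewrite K0.
(* [q] is a nondecreasing function of [nrm], so its maximum on [K] is attained at [k0] and is less
   than 1: one ratio serves the geometric decay on all of [K]. *)
have [|k0 /set_mem Kk0 k0P] := compact_EVT_max (f := nrm) Kn0 cK.
  by apply: continuous_in_subspaceT => x _; exact: nrm_cont.
have q0 x : 0 <= q x by rewrite mulr_ge0 ?powR_ge0 ?expR_ge0.
have qk x : K x -> q x <= q k0.
  move=> /mem_set/k0P nx; apply: ler_wpM2r; first exact: expR_ge0.
  apply: (ge0_ler_powR (ltW t0)); rewrite ?nnegrE.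
  - exact: mulr_ge0 A0 (nrm0 _).
  - exact: mulr_ge0 A0 (nrm0 _).
  - exact: ler_wpM2l A0 _ _ nx.
have qk1 : q k0 < 1 by have [_] := KU _ Kk0; rewrite q'E.
have [D D0 DP] := geometric_decay l (q0 k0) qk1.
have /choice[b bP] : forall p, exists b, (0 < p)%N ->
    forall x, K x -> bergman_kernel h (S p) x <= b.
  move=> p; have [p0|/negP p0] := boolP (0 < p)%N; last by exists 0.
  have [|b bP] := compact_locally_bounded cK (f := bergman_kernel h (S p)).
    move=> x Kx; have [HS _ _] := ort p p0.
    have [b bP] := bergman_kernel_locally_bounded x bh (fun j => (HS j).1).
    by exists b; apply: filterS bP.
  by exists b.
(* From [P] on, [p] exceeds 2/t. Below [P] the bound [b p] is used, with a factor [p%:R ^+ l] that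
   compensates the required decay; there are finitely many such terms, so they enter the constant as
   a sum. *)
pose P := (Num.truncn (2 * t^-1)).+1.
pose b' p := `|b p| * p%:R ^+ l.
have b'0 p : 0 <= b' p by rewrite mulr_ge0 ?exprn_ge0.
exists (D + \sum_(p < P) b' p) => [|p p0 x Kx].
  by rewrite ltr_wpDr// sumr_ge0.
have k_ge0 : 0 <= bergman_kernel h (S p) x by apply: sumr_ge0 => j _; exact: sqr_ge0.
rewrite ger0_norm// mulrDl.
have pl : 0 <= (p%:R ^- l : R) by rewrite invr_ge0 exprn_ge0.
have [pP|Pp] := ltnP p P.
  apply: (@le_trans _ _ (b' p * p%:R ^- l)).
    rewrite /b' mulfK ?expf_neq0 ?pnatr_eq0 -?lt0n//.
    by apply: le_trans (bP p p0 x Kx) (ler_norm _).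
  rewrite -mulrDl ler_wpM2r// (bigD1 (Ordinal pP))//= addrCA lerDl addr_ge0//; first exact: ltW.
  by apply: sumr_ge0.
apply: (@le_trans _ _ (D * p%:R ^- l)); last first.
  by rewrite lerDl mulr_ge0// sumr_ge0.
apply: le_trans (DP p p0); apply: (@le_trans _ _ (q x ^+ p)).
  apply: (main p (d p)); [exact: ort|exact: KU|].
  by apply: lt_le_trans (truncnS_gt _) _; rewrite ler_nat.
by apply: lerXn2r (qk _ Kx); rewrite nnegrE; exact: q0.
Qed.
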